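(* Let $(\Omega,\mathcal H,\widehat{\mathbb E})$ be a sub-linear expectation space satisfying condition (CC) with a family $\mathcal P$ of probability measures, and let $\{X_n;n\ge 1\}\subset\mathcal H$ be a sequence of independent random variables under $\widehat{\mathbb E}$. Put $s_n^2=\sum_{i=1}^n\widehat{\mathbb E}[X_i^2]$, $\underline s_n^2=\sum_{i=1}^n\widehat{\mathcal E}[X_i^2]$, $t_n=\sqrt{2\log\log s_n^2}$ and $a_n=s_nt_n$. Assume that: (i) $\underline s_n^2/s_n^2\to r$ for some real number $r>0$; (ii) $s_n^2\to\infty$, and $|X_n|\le \alpha_n\, s_n/t_n$ for all $n$, where $\alpha_n$ are real constants with $\alpha_n\to 0$; (iii) $\dfrac{\sum_{j=1}^n\big(|\widehat{\mathbb E}[X_j]|+|\widehat{\mathcal E}[X_j]|\big)}{a_n}\to 0$. Then for each of the capacities $V=\mathbb V^{\mathcal P}$, $V=\mathbb C^{*}$ and $V=\widehat{\mathbb V}^{*}$, and for every real $t\ge 0$, $$V\left(C\left\{\frac{\sum_{i=1}^nX_i}{\sqrt{2s_n^2\log\log s_n^2}}\right\}=[-\sqrt t,\sqrt t]\right)=\begin{cases}1&\text{if } t\in[r,1],\\ 0&\text{if } t\notin[r,1].\end{cases}$$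
   Context: Setting. $(\Omega,\mathcal F)$ is a measurable space and $\mathcal H$ is a linear space of real measurable functions on $(\Omega,\mathcal F)$ such that $\varphi(X_1,\dots,X_n)\in\mathcal H$ whenever $X_1,\dots,X_n\in\mathcal H$ and $\varphi\in C_{l,Lip}(\mathbb R^n)$, where $C_{l,Lip}(\mathbb R^n)$ is the space of functions with $|\varphi(x)-\varphi(y)|\le C(1+|x|^k+|y|^k)|x-y|$ for some $C>0,k\in\mathbb N$ depending on $\varphi$. $C_{b,Lip}(\mathbb R^n)$ denotes bounded Lipschitz functions. A sub-linear expectation is a map $\widehat{\mathbb E}:\mathcal H\to[-\infty,\infty]$ which is monotone ($X\ge Y\Rightarrow\widehat{\mathbb E}[X]\ge\widehat{\mathbb E}[Y]$), preserves constants, is sub-additive ($\widehat{\mathbb E}[X+Y]\le\widehat{\mathbb E}[X]+\widehat{\mathbb E}[Y]$ whenever the right side is not $\infty-\infty$ or $-\infty+\infty$), and is positively homogeneous ($\widehat{\mathbb E}[\lambda X]=\lambda\widehat{\mathbb E}[X]$ for $\lambda\ge0$, with $0\cdot\infty=0$). $(\Omega,\mathcal H,\widehat{\mathbb E})$ is then a sub-linear expectation space. The conjugate expectation is $\widehat{\mathcal E}[X]=-\widehat{\mathbb E}[-X]$. Independence. A random vector $\bm Y$ (with components in $\mathcal H$) is independent to a random vector $\bm X$ under $\widehat{\mathbb E}$ if $\widehat{\mathbb E}[\varphi(\bm X,\bm Y)]=\widehat{\mathbb E}\big[\widehat{\mathbb E}[\varphi(\bm x,\bm Y)]|_{\bm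 x=\bm X}\big]$ for all bounded Lipschitz $\varphi$. A sequence $\{X_n\}$ is independent if $X_{i+1}$ is independent to $(X_1,\dots,X_i)$ for each $i\ge1$. Condition (CC). Let $\mathcal H_b=\{f\in\mathcal H: f\text{ bounded}\}$. $\widehat{\mathbb E}$ satisfies (CC) (with the family $\mathcal P$) if $\widehat{\mathbb E}[X]=\sup_{P\in\mathcal P}P[X]$ for all $X\in\mathcal H_b$ (with $P[X]=\int X\,dP$), where $\mathcal P$ is a family of probability measures on $(\Omega,\sigma(\mathcal H))$ that is countable-dimensionally weakly compact: for any $Y_1,Y_2,\dots\in\mathcal H_b$ and any sequence $\{P_n\}\subset\mathcal P$ there are a subsequence $\{n_k\}$ and $P\in\mathcal P$ with $\lim_k P_{n_k}[\varphi(Y_1,\dots,Y_d)]=P[\varphi(Y_1,\dots,Y_d)]$ for all $\varphi\in C_{b,Lip}(\mathbb R^d)$, $d\ge1$. Capacities. $\mathbb V^{\mathcal P}(A)=\sup_{P\in\mathcal P}P(A)$ for $A\in\sigma(\mathcal H)$. For $A\in\mathcal F$: $\widehat{\mathbb V}(A)=\inf\{\widehat{\mathbb E}[\xi]: I_A\le\xi,\ \xi\in\mathcal H\}$; $\widehat{\mathbb V}^*(A)=\inf\{\sum_{n=1}^\infty\widehat{\mathbb V}(A_n): A\subset\bigcup_{n=1}^\infty A_n,\ A_n\in\mathcal F\}$; $\mathbb C^*(A)=\inf\{\lim_{n\to\infty}\widehat{\mathbb E}[\sum_{i=1}^n g_i]: I_A\le\sum_{n=1}^\infty g_n,\ 0\le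 g_n\in\mathcal H\}$. Conventions. $\log x=\ln\max(e,x)$. $C\{x_n\}$ denotes the cluster set (set of limit points of subsequences in $\mathbb R$) of a real sequence $\{x_n\}$. *)

(* Defs.v *)
From HB Require Import structures.
From mathcomp Require Import all_boot all_order all_algebra.
From mathcomp Require Import all_classical all_reals all_analysis.

Set Implicit Arguments.
Unset Strict Implicit.
Unset Printing Implicit Defensive.

Import Order.TTheory GRing.Theory Num.Theory.
Import numFieldNormedType.Exports.

Local Open Scope classical_set_scope.
Local Open Scope ring_scope.

(* Euclidean norm; the library norm on 'rV[R]_n is the sup norm. *)
Definition enorm (R : realType) (n : nat) (x : 'rV[R]_n) : R :=
  Num.sqrt (\sum_(i < n) x ord0 i ^+ 2).

Definition C_lLip (R : realType) (n : nat) (phi : 'rV[R]_n -> R) : Prop :=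
  exists (C : R) (k : nat), 0 < C /\
    forall x y : 'rV[R]_n,
      `|phi x - phi y| <= C * (1 + enorm x ^+ k + enorm y ^+ k) * enorm (x - y).

Definition C_bLip (R : realType) (n : nat) (phi : 'rV[R]_n -> R) : Prop :=
  (exists M : R, forall x, `|phi x| <= M) /\
  (exists L : R, forall x y, `|phi x - phi y| <= L * enorm (x - y)).

Definition conj_expectation {Omega : Type} {R : realType}
    (E : (Omega -> R) -> \bar R) (X : Omega -> R) : \bar R :=
  (- E (fun w => (- X w)%R))%E.

Section sublinear_expectation.
Context {d : measure_display} {Omega : measurableType d} {R : realType}.
Implicit Types (H : set (Omega -> R)) (E : (Omega -> R) -> \bar R).
Implicit Types (X Y : Omega -> R).

Record function_space H : Prop := {
  fs_measurable : forall X, H X -> measurable_fun setT X;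
  fs_zero : H (fun=> 0);
  fs_add : forall X Y, H X -> H Y -> H (fun w => X w + Y w);
  fs_scale : forall (c : R) X, H X -> H (fun w => c * X w);
  fs_comp : forall n (X : 'I_n -> Omega -> R) (phi : 'rV[R]_n -> R),
    (0 < n)%N -> (forall i, H (X i)) -> C_lLip phi ->
    H (fun w => phi (\row_i X i w)) }.

(* A sub-linear expectation is a map on H; E is a total function here, but its
   values outside H are never constrained nor used. *)
Record sublinear_expectation H E : Prop := {
  sl_mono : forall X Y, H X -> H Y -> (forall w, Y w <= X w) -> (E Y <= E X)%E;
  sl_cst : forall c : R, E (fun=> c) = c%:E;
  sl_subadd : forall X Y, H X -> H Y -> (E X +? E Y)%E ->
    (E (fun w => X w + Y w)%R <= E X + E Y)%E;
  sl_homo : forall (c : R) X, 0 <= c -> H X ->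
    E (fun w => c * X w) = (c%:E * E X)%E }.

(* For bounded phi the inner expectation lies in [- M, M], so [fine] only
   changes its type. *)
Definition independent_to E m n
    (Y : Omega -> 'rV[R]_n) (X : Omega -> 'rV[R]_m) : Prop :=
  forall phi : 'rV[R]_(m + n) -> R, C_bLip phi ->
    E (fun w => phi (row_mx (X w) (Y w))) =
    E (fun w => fine (E (fun w' => phi (row_mx (X w) (Y w'))))).

(* Sequences of random variables are indexed from 1: X 0 plays no role. *)
Definition independent_seq E (X : nat -> Omega -> R) : Prop :=
  forall i, (1 <= i)%N ->
    independent_to E (fun w => \row_(j < 1) X i.+1 w)
                     (fun w => \row_(j < i) X j.+1 w).

Definition bounded_part H : set (Omega -> R) :=
  [set X : Omega -> R | H X /\ exists M : R, forall w, `|X w| <= M].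

Definition preimages H : set (set Omega) :=
  \bigcup_(X in H) preimage_set_system setT X measurable.

End sublinear_expectation.

(* The measurable space (Omega, sigma(H)). *)
Notation sigma_space H := (g_sigma_algebraType (preimages H)).

Section capacities.
Context {d : measure_display} {Omega : measurableType d} {R : realType}.
Implicit Types (H : set (Omega -> R)) (E : (Omega -> R) -> \bar R).
Implicit Types (A : set Omega).

Definition P_expectation H (P : probability (sigma_space H) R)
    (X : Omega -> R) : \bar R :=
  (\int[P]_w (X w)%:E)%E.

Definition cdim_weakly_compact H
    (Pfam : set (probability (sigma_space H) R)) : Prop :=
  forall (Y : nat -> Omega -> R) (Pn : nat -> probability (sigma_space H) R),
    (forall i, bounded_part H (Y i)) -> (forall n, Pfam (Pn n)) ->
    exists (nk : nat -> nat) (P : probability (sigma_space H) R),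
      [/\ {homo nk : i j / (i < j)%N}, Pfam P &
        forall n (phi : 'rV[R]_n -> R), (1 <= n)%N -> C_bLip phi ->
          P_expectation (Pn (nk k)) (fun w => phi (\row_(i < n) Y i w))
            @[k --> \oo]
          --> P_expectation P (fun w => phi (\row_(i < n) Y i w))].

Definition condition_CC H E
    (Pfam : set (probability (sigma_space H) R)) : Prop :=
  (forall X, bounded_part H X ->
     E X = ereal_sup [set P_expectation P X | P in Pfam]) /\
  cdim_weakly_compact Pfam.

Definition V_P H (Pfam : set (probability (sigma_space H) R)) A : \bar R :=
  ereal_sup [set (P : set Omega -> \bar R) A | P in Pfam].

Definition V_hat H E A : \bar R :=
  ereal_inf [set E xi | xi in
    [set xi : Omega -> R | H xi /\ forall w, \1_A w <= xi w]].

Definition V_hat_star H E A : \bar R :=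
  ereal_inf [set (\sum_(0 <= n <oo) V_hat H E (B n))%E | B in
    [set B : nat -> set Omega |
      (forall n, measurable (B n)) /\ A `<=` \bigcup_n B n]].

(* The series of the g n may diverge at some points, hence the comparison in
   the extended reals. *)
Definition C_star H E A : \bar R :=
  ereal_inf [set limn (fun n => E (fun w => \sum_(0 <= i < n) g i w)) | g in
    [set g : nat -> Omega -> R |
      (forall n, H (g n) /\ forall w, 0 <= g n w) /\
      (forall w, ((\1_A w : R)%:E <= \sum_(0 <= n <oo) (g n w)%:E)%E)]].

End capacities.

Definition cluster_set (R : realType) (x : nat -> R) : set R :=
  [set l | exists2 nk : nat -> nat,
     {homo nk : i j / (i < j)%N} & x (nk k) @[k --> \oo] --> l].

Definition llog (R : realType) (x : R) : R := ln (Num.max (expR 1) x).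

Section normalizers.
Context {Omega : Type} {R : realType}.
Variables (E : (Omega -> R) -> \bar R) (X : nat -> Omega -> R).

(* [fine] would send an infinite second moment to 0.  No case is lost or gained
   in the theorem: its bound |X n| <= alpha n * (s n / t n) is by a real number,
   so each X n is bounded and all the expectations involved are finite. *)
Definition s2 (n : nat) : R :=
  \sum_(1 <= i < n.+1) fine (E (fun w => X i w ^+ 2)).

Definition s2_low (n : nat) : R :=
  \sum_(1 <= i < n.+1) fine (conj_expectation E (fun w => X i w ^+ 2)).

Definition s_ (n : nat) : R := Num.sqrt (s2 n).
Definition t_ (n : nat) : R := Num.sqrt (2 * llog (llog (s2 n))).
Definition a_ (n : nat) : R := s_ n * t_ n.

End normalizers.

Definition cluster_event {Omega : Type} {R : realType}
    (E : (Omega -> R) -> \bar R) (X : nat -> Omega -> R) (t : R) : set Omega :=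
  [set w | cluster_set (fun n => (\sum_(1 <= i < n.+1) X i w) /
                          Num.sqrt (2 * s2 E X n * llog (llog (s2 E X n))))
           = [set` `[- Num.sqrt t, Num.sqrt t]]].

(* Main.v *)
(* A set is null for all the measures of the family, and for the capacities, as
   soon as it is covered by sets [{xi_k >= 1}] where the [xi_k] are nonnegative
   bounded Lipschitz functions of finitely many [X_i] whose integrals have a small
   sum; independence under [E] bounds these integrals for every [P] through the
   conditional means and second moments of the [X_i] alone.  An exponential
   martingale, stopped smoothly, gives in this way [limsup |S_n| / a_n <= 1]; on
   geometric blocks, an exponential tilt compared with its neighbours bounds from
   below the conditional probability of a large increment, and gives
   [limsup S_n / a_n >= sqrt r].  This settles [t] outside [[r, 1]].  For [t] in
   [[r, 1]], weak compactness provides a [P] in the family under which each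
   [X_i ^ 2] has either its upper or its lower mean; being extremal, these are also
   the conditional means.  Choosing greedily between the two makes the total
   variance equivalent to [t s_n ^ 2], and both halves of the argument then have
   the constant [sqrt t], so that the event has [P]-probability [1]. *)

Require Import Defs.
From HB Require Import structures.
From mathcomp Require Import all_boot all_order all_algebra.
From mathcomp Require Import all_classical all_reals all_analysis.
From mathcomp Require Import measurable_realfun ring lra.

Set Implicit Arguments.
Unset Strict Implicit.
Unset Printing Implicit Defensive.

Import Order.TTheory GRing.Theory Num.Theory.
Import numFieldNormedType.Exports.

Local Open Scope classical_set_scope.
Local Open Scope ring_scope.

(** Under a fixed [P] of the family the [X_i] need not be independent, and independence under [E]
    and weak compactness speak only of bounded Lipschitz functions. The estimates therefore use no
    stopping time, indicator or conditional expectation: stopping becomes a weight in [[0, 1]] that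
    is a Lipschitz function of the past. What a single [P] retains of independence is one
    inequality: for a nonnegative [W] in the past, the integral of [W * f (x i)] is at most
    [E (f (x i))] times that of [W]. It leaves the conditional variance anywhere between two bounds,
    so the tilts of the lower half are compensated by the realised sum of squares: [1 + u] lies
    between [exp (u - (1 + e) / 2 * u ^ 2)] and [exp (u - (1 - e) / 2 * u ^ 2)], and after averaging
    only the means enter. For the outer capacities, [C_star] is at most [V_hat_star]: covers bound
    the larger one, and a [P] giving full mass to the event bounds the smaller one from below. *)

Section exponential_bounds.
Context {R : realType}.
Implicit Types u v x e : R.

Lemma sqr_norm x : `|x| ^+ 2 = x ^+ 2.
Proof. by rewrite real_normK ?num_real. Qed.

Lemma expR_le_inv x : x < 1 -> expR x <= (1 - x)^-1.
Proof.
move=> x1; rewrite -(invrK (expR x)) lef_pV2 ?posrE ?subr_gt0 ?invr_gt0 ?expR_gt0//.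
by rewrite -expRN; apply: le_trans (expR_ge1Dx _).
Qed.

(** Squeezed between [1 + v] and [1 / (1 - v)], whose difference is [v ^ 2 / (1 - v)]. *)
Lemma expR_taylor1 v : `|v| <= 2^-1 -> `|expR v - 1 - v| <= 2 * v ^+ 2.
Proof.
rewrite ler_norml => /andP[v1 v2].
rewrite ger0_norm; last by have := expR_ge1Dx v; lra.
have /(_ _)/le_trans h := @expR_le_inv v.
have : expR v <= (1 - v)^-1 by apply: expR_le_inv; lra.
have v0 : 0 < 1 - v by lra.
rewrite -(ler_pM2l v0) mulfV ?gt_eqF// => le1.
have e1 := expR_ge1Dx v.
nra.
Qed.

(** Mean value theorem for the remainder [F], whose derivative is the first order remainder bounded
    by [expR_taylor1]. *)
Lemma expR_taylor2 v : `|v| <= 2^-1 ->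
  `|expR v - 1 - v - v ^+ 2 / 2| <= 2 * `|v| ^+ 3.
Proof.
move=> hv.
pose F (t : R) := expR t - 1 - t - t ^+ 2 / 2.
have dF x : is_derive x 1 F (expR x - 1 - x).
  rewrite /F; apply: is_derive_eq.
  by rewrite /GRing.scale /=; field.
have cF : continuous F.
  move=> x; by apply: differentiable_continuous; apply/derivable1_diffP; case: (dF x).
have F0 : F 0 = 0 by rewrite /F expR0 expr0n /=; lra.
have key (a b : R) : a <= b -> `|a| <= `|v| -> `|b| <= `|v| ->
    `|F b - F a| <= 2 * `|v| ^+ 2 * (b - a).
  move=> ab av bv.
  have [c cab ->] := @MVT_segment R F (fun x => expR x - 1 - x) a b ab
    (fun x _ => dF x) (continuous_subspaceT cF).
  have cv : `|c| <= `|v|.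
    move: cab; rewrite in_itv /= => /andP[ac cb].
    move: av bv; rewrite !ler_norml => /andP[? ?] /andP[? ?].
    by apply/andP; split; lra.
  rewrite normrM (ger0_norm (_ : 0 <= b - a)) ?subr_ge0//.
  rewrite ler_wpM2r ?subr_ge0//.
  apply: le_trans (expR_taylor1 (le_trans cv hv)) _.
  by rewrite -(sqr_norm c) ler_wpM2l// ler_pXn2r// nnegrE.
rewrite -/(F v) exprSr mulrA.
have [v0|v0] := leP 0 v.
  have := key 0 v v0; rewrite F0 !subr0 normr0 lexx => /(_ (normr_ge0 _) isT).
  by rewrite {3}(ger0_norm v0).
have := key v 0 (ltW v0); rewrite F0 !sub0r normr0 lexx normrN.
by move=> /(_ isT (normr_ge0 _)); rewrite {3}(ltr0_norm v0).
Qed.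

(** The cubic remainder [2 * |u| ^ 3] is at most [e / 8 * u ^ 2], within the margin
    [e / 2 * u ^ 2]. *)
Lemma expR_quadr_ub u e : 0 < e <= 1 -> `|u| <= e / 16 ->
  expR u <= 1 + u + (1 + e) / 2 * u ^+ 2.
Proof.
move=> /andP[e0 e1] hu.
have : `|u| <= 2^-1 by lra.
move=> /expR_taylor2; rewrite ler_norml => /andP[_ h].
have h3 : `|u| ^+ 3 <= e / 16 * u ^+ 2.
  by rewrite exprS -(sqr_norm u) ler_wpM2r// exprn_ge0.
have := sqr_ge0 u; nra.
Qed.

(** Meant for [b = 1 - e] and [b = 1 + e]: the second order term is then [e / 2 * u ^ 2] or its
    opposite, and the error is no larger, so the comparison with [1 + u] has a definite sign. *)
Let quad_aux u e (b : R) : 0 < e <= 1 -> `|u| <= e / 16 -> 0 <= b <= 2 ->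
  `|expR (u - b * u ^+ 2 / 2) - (1 + u + (1 - b) * u ^+ 2 / 2)| <= e * u ^+ 2 / 2.
Proof.
move=> /andP[e0 e1] hu /andP[b0 b2].
set v := u - b * u ^+ 2 / 2.
have u2 : 0 <= u ^+ 2 by exact: sqr_ge0.
have un := normr_ge0 u.
have u2n : u ^+ 2 = `|u| * `|u| by rewrite -expr2 sqr_norm.
have u2le : u ^+ 2 <= `|u| / 16 by rewrite u2n; nra.
have vu : `|v| <= 17 / 16 * `|u|.
  apply: le_trans (ler_normB _ _) _.
  rewrite (ger0_norm (_ : 0 <= b * u ^+ 2 / 2)); last first.
    by rewrite divr_ge0// mulr_ge0.
  nra.
have : `|v| <= 2^-1 by lra.
move=> /expR_taylor2 h.
have v3 : `|v| ^+ 3 <= (17/16)^+3 * (e / 16 * u ^+ 2).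
  apply: (@le_trans _ _ ((17/16 * `|u|)^+3)).
    by rewrite lerXn2r// nnegrE mulr_ge0.
  rewrite exprMn ler_wpM2l//.
  by rewrite exprS -(sqr_norm u) ler_wpM2r// exprn_ge0.
have vv : `|v ^+ 2 - u ^+ 2| <= (2 + 1/8) * (e / 16 * u ^+ 2).
  rewrite (_ : v ^+ 2 - u ^+ 2 = u ^+ 2 * (- b * u + b ^+2 * u^+2 / 4)); last first.
    by rewrite /v; field.
  rewrite normrM (ger0_norm u2).
  rewrite [leRHS](_ : _ = u ^+ 2 * ((2 + 1/8) * (e / 16))); last by field.
  rewrite ler_wpM2l//.
  apply: le_trans (ler_normD _ _) _.
  rewrite normrM normrN (ger0_norm b0) (ger0_norm (_ : 0 <= b ^+ 2 * u ^+ 2 / 4)).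
    have b4 : b ^+ 2 <= 4 by nra.
    have : b ^+ 2 * u ^+ 2 <= 4 * (`|u| / 16) by apply: ler_pM => //; exact: sqr_ge0.
    nra.
  by rewrite divr_ge0// mulr_ge0// sqr_ge0.
have -> : expR v - (1 + u + (1 - b) * u ^+ 2 / 2) =
   (expR v - 1 - v - v ^+ 2 / 2) + (v ^+ 2 - u ^+ 2) / 2 by rewrite /v; field.
apply: le_trans (ler_normD _ _) _.
rewrite normrM (ger0_norm (_ : 0 <= 2^-1 :> R)); last by [].
have eu : 0 <= e * u ^+ 2 by apply: mulr_ge0 => //; exact: ltW.
have := exprn_ge0 3 (normr_ge0 v).
lra.
Qed.

Lemma expR_quadr_ge u e : 0 < e <= 1 -> `|u| <= e / 16 ->
  1 + u <= expR (u - (1 - e) / 2 * u ^+ 2).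
Proof.
move=> he hu; have /andP[e0 e1] := he.
have := @quad_aux u e (1 - e) he hu.
have -> : 0 <= 1 - e <= 2 by apply/andP; split; lra.
move=> /(_ isT); rewrite ler_norml => /andP[+ _].
by rewrite (_ : (1 - e) * u ^+ 2 / 2 = (1 - e) / 2 * u ^+ 2); [lra|field].
Qed.

Lemma expR_quadr_le u e : 0 < e <= 1 -> `|u| <= e / 16 ->
  expR (u - (1 + e) / 2 * u ^+ 2) <= 1 + u.
Proof.
move=> he hu; have /andP[e0 e1] := he.
have := @quad_aux u e (1 + e) he hu.
have -> : 0 <= 1 + e <= 2 by apply/andP; split; lra.
move=> /(_ isT); rewrite ler_norml => /andP[_ +].
by rewrite (_ : (1 + e) * u ^+ 2 / 2 = (1 + e) / 2 * u ^+ 2); [lra|field].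
Qed.

Lemma expRN2_le x : 0 <= x <= 2^-1 -> expR (- (2 * x)) <= 1 - x.
Proof.
move=> /andP[x0 x1]; apply: le_trans (expR_le_inv _) _; first lra.
have h : 0 < 1 - - (2 * x) by lra.
by rewrite -div1r ler_pdivrMr//; nra.
Qed.

Lemma expRN_le_linear x e : 0 <= x -> x <= e -> expR (- x) <= 1 - (1 - e) * x.
Proof.
move=> x0 xe; apply: le_trans (expR_le_inv _) _; first lra.
have h : 0 < 1 - - x by lra.
by rewrite -div1r ler_pdivrMr//; nra.
Qed.

End exponential_bounds.

(** * Growth of the truncated logarithm *)

Section iterated_logarithm.
Context {R : realType}.
Implicit Types x y k : R.

Let e_gt0 : 0 < expR 1 :> R := expR_gt0 1.

Lemma llog_ge1 x : 1 <= llog x.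
Proof.
rewrite /llog -{1}[1](expRK) ler_ln ?posrE//; first by rewrite le_max lexx.
by rewrite lt_max e_gt0.
Qed.

Lemma llog_gt0 x : 0 < llog x.
Proof. exact: lt_le_trans ltr01 (llog_ge1 x). Qed.

Lemma ler_llog : {homo @llog R : x y / x <= y}.
Proof.
move=> x y xy; rewrite /llog ler_ln ?posrE ?lt_max ?e_gt0//.
by rewrite ge_max !le_max lexx /= xy orbT.
Qed.

Lemma llogE x : expR 1 <= x -> llog x = ln x.
Proof. by move=> ?; rewrite /llog; congr ln; apply/max_idPr. Qed.

Lemma llogM k x : 1 <= k -> llog (k * x) <= k * llog x.
Proof.
move=> k1; have k0 : 0 < k by lra.
have m0 : 0 < Num.max (expR 1) x by rewrite lt_max e_gt0.
apply: (@le_trans _ _ (ln (k * Num.max (expR 1) x))).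
  rewrite /llog ler_ln ?posrE ?lt_max ?e_gt0//; last exact: mulr_gt0.
  rewrite ge_max; apply/andP; split.
    apply: (@le_trans _ _ (1 * Num.max (expR 1) x)).
      by rewrite mul1r le_max lexx.
    by rewrite ler_wpM2r// ltW.
  by rewrite ler_pM2l// le_max lexx orbT.
rewrite lnM ?posrE// -/(llog x).
have : ln k <= k - 1 by rewrite -{1}(subrKC 1 k); apply: le_ln1Dx; lra.
have := llog_ge1 x; nra.
Qed.

Lemma llog_le x : 1 <= x -> llog x <= x.
Proof.
move=> x1; have [xe|ex] := leP x (expR 1).
  by rewrite /llog (max_idPl xe) expRK.
by rewrite llogE; [apply: ltW; apply: ln_sublinear; lra|exact: ltW].
Qed.

Lemma llog_le_sqrt x : 1 <= x -> llog x <= 2 * Num.sqrt x.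
Proof.
move=> x1; have s1 : 1 <= Num.sqrt x by rewrite -sqrtr1 ler_wsqrtr.
have [xe|ex] := leP x (expR 1).
  by rewrite /llog (max_idPl xe) expRK; lra.
rewrite llogE; last exact: ltW.
have s0 : 0 < Num.sqrt x by lra.
rewrite -{1}(@sqr_sqrtr _ x); last by lra.
rewrite lnXn// mulr2n.
have := ln_sublinear s0; lra.
Qed.

End iterated_logarithm.

(** * Calculus of bounded Lipschitz functions on row vectors *)

Section bounded_lipschitz.
Context {R : realType}.

Lemma enorm_ge0 n (z : 'rV[R]_n) : 0 <= enorm z.
Proof. exact: sqrtr_ge0. Qed.

Lemma coord_le_enorm n (z : 'rV[R]_n) (j : 'I_n) : `|z ord0 j| <= enorm z.
Proof.
rewrite -sqrtr_sqr ler_wsqrtr// (bigD1 j)//= lerDl.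
by apply: sumr_ge0 => k _; exact: sqr_ge0.
Qed.

Lemma enorm_lsubmx m n (z : 'rV[R]_(m + n)) : enorm (lsubmx z) <= enorm z.
Proof.
rewrite ler_wsqrtr// [leRHS]big_split_ord/=.
rewrite (eq_bigr (fun i => z ord0 (lshift n i) ^+ 2)).
  by rewrite lerDl sumr_ge0// => k _; exact: sqr_ge0.
by move=> i _; rewrite mxE.
Qed.

Lemma C_bLip_cst n (c : R) : C_bLip (fun _ : 'rV[R]_n => c).
Proof.
split; first by exists `|c|.
by exists 0 => z t; rewrite subrr normr0 mul0r.
Qed.

Lemma C_bLip_pos n (phi : 'rV[R]_n -> R) : C_bLip phi ->
  exists K : R, [/\ 0 <= K, forall z, `|phi z| <= K &
    forall z t, `|phi z - phi t| <= K * enorm (z - t)].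
Proof.
move=> [[M hM] [K hK]]; exists (Num.max 0 (Num.max M K)); split.
- by rewrite le_max lexx.
- by move=> z; rewrite !le_max hM orbT.
- move=> z t; apply: le_trans (hK z t) _.
  by rewrite ler_wpM2r ?enorm_ge0// !le_max lexx !orbT.
Qed.

Lemma C_bLip_add n (phi psi : 'rV[R]_n -> R) : C_bLip phi -> C_bLip psi ->
  C_bLip (fun z => phi z + psi z).
Proof.
move=> /C_bLip_pos[K [K0 bK lK]] /C_bLip_pos[J [J0 bJ lJ]]; split.
  by exists (K + J) => z; apply: le_trans (ler_normD _ _) _; apply: lerD.
exists (K + J) => z t; rewrite opprD addrACA mulrDl.
by apply: le_trans (ler_normD _ _) _; apply: lerD.
Qed.

Lemma C_bLip_mul n (phi psi : 'rV[R]_n -> R) : C_bLip phi -> C_bLip psi ->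
  C_bLip (fun z => phi z * psi z).
Proof.
move=> /C_bLip_pos[K [K0 bK lK]] /C_bLip_pos[J [J0 bJ lJ]]; split.
  by exists (K * J) => z; rewrite normrM ler_pM.
exists (K * J + K * J) => z t.
have -> : phi z * psi z - phi t * psi t =
  phi z * (psi z - psi t) + (phi z - phi t) * psi t by ring.
rewrite [leRHS]mulrDl; apply: le_trans (ler_normD _ _) _; rewrite !normrM.
apply: lerD; first by rewrite -mulrA ler_pM.
by rewrite mulrAC ler_pM.
Qed.

(** Enough for composition after a bounded function, and satisfied by [expR] and by squaring, which
    are not globally Lipschitz. *)
Definition locally_lipschitz (g : R -> R) : Prop := forall M, exists K : R,
  forall a b, `|a| <= M -> `|b| <= M -> `|g a - g b| <= K * `|a - b|.

Lemma C_bLip_comp n (phi : 'rV[R]_n -> R) (g : R -> R) :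
  C_bLip phi -> locally_lipschitz g -> C_bLip (fun z => g (phi z)).
Proof.
move=> /C_bLip_pos[M [M0 bM lM]] /(_ M)[K hK].
have K0 : forall a b, `|a| <= M -> `|b| <= M ->
    `|g a - g b| <= `|K| * `|a - b|.
  by move=> a b aM aM'; apply: le_trans (hK a b aM aM') _; rewrite ler_wpM2r// ler_norm.
split.
  exists (`|g 0| + `|K| * M) => z.
  rewrite -(subrK (g 0) (g _)) addrC.
  apply: le_trans (ler_normD _ _) _; rewrite lerD2l.
  apply: le_trans (K0 _ _ _ _) _ => //; first by rewrite normr0.
  by rewrite subr0 ler_wpM2l.
exists (`|K| * M) => z t; apply: le_trans (K0 _ _ _ _) _ => //.
by rewrite -mulrA ler_wpM2l.
Qed.

Lemma C_bLip_lsubmx m n (phi : 'rV[R]_m -> R) : C_bLip phi ->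
  C_bLip (fun z : 'rV[R]_(m + n) => phi (lsubmx z)).
Proof.
move=> /C_bLip_pos[K [K0 bK lK]]; split; first by exists K.
exists K => z t; apply: le_trans (lK _ _) _.
by rewrite ler_wpM2l// -linearB; exact: enorm_lsubmx.
Qed.

(** A coordinate is not a bounded function; clamped at a bound of the corresponding variable it
    becomes an admissible test function with the same values along the sequence. *)
Lemma C_bLip_clamp n (j : 'I_n) (M : R) : 0 <= M ->
  C_bLip (fun z : 'rV[R]_n => Num.max (- M) (Num.min M (z ord0 j))).
Proof.
move=> M0; split.
  exists M => z; rewrite ler_norml ge_max le_max lexx/=.
  by rewrite ge_min lexx /= andbT; lra.
exists 1 => z t; rewrite mul1r.
apply: le_trans _ (coord_le_enorm _ j); rewrite !mxE.
move: (z _ _) (t _ _) => a b.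
by rewrite /Num.max /Num.min; do !case: ifPn; rewrite ?ltNge ?negbK ?ler_norml;
  move=> *; case: (ger0P (a - b)); lra.
Qed.

Lemma clamp_id (M a : R) : `|a| <= M -> Num.max (- M) (Num.min M a) = a.
Proof. by rewrite ler_norml => /andP[? ?]; rewrite min_r// max_r. Qed.

Lemma locally_lipschitz_lip (g : R -> R) K :
  (forall a b, `|g a - g b| <= K * `|a - b|) -> locally_lipschitz g.
Proof. by move=> h M; exists K. Qed.

Lemma locally_lipschitz_expR : locally_lipschitz (@expR R).
Proof.
move=> M; exists (expR M).
have key (a b : R) : b <= a -> `|a| <= M -> `|expR a - expR b| <= expR M * `|a - b|.
  move=> ba aM; rewrite !ger0_norm ?subr_ge0 ?ler_expR//.
  apply: (@le_trans _ _ (expR a * (a - b))).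
    have -> : expR b = expR a * expR (b - a) by rewrite -expRD subrKC.
    have := expR_ge1Dx (b - a); have := expR_gt0 a; nra.
  rewrite ler_wpM2r ?subr_ge0// ler_expR.
  by apply: le_trans aM; exact: ler_norm.
move=> a b aM bM; have [ba|ab] := leP b a; first exact: key.
by rewrite distrC (distrC a) key// ltW.
Qed.

Lemma locally_lipschitz_norm : locally_lipschitz (@Num.norm R R).
Proof.
by apply: (@locally_lipschitz_lip _ 1) => a b; rewrite mul1r ler_dist_dist.
Qed.

End bounded_lipschitz.

(** The variables available are [x 0, ..., x (i - 1)]: [past x i] describes the time just before
    [x i] is revealed. The class is the one for which independence and weak compactness are
    stated. *)
Definition past {Omega : Type} {R : realType} (x : nat -> Omega -> R) (i : nat) :
    set (Omega -> R) :=
  [set f | exists2 phi : 'rV[R]_i -> R,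
     C_bLip phi & f = fun w => phi (\row_j x j w)].

(** * Closure properties of the functionals of the past *)

Section past_algebra.
Context {Omega : Type} {R : realType}.
Variable x : nat -> Omega -> R.
Hypothesis x_bnd : forall i, exists M : R, forall w, `|x i w| <= M.
Implicit Types f g : Omega -> R.

Lemma past_bounded i f : past x i f -> exists M : R, forall w, `|f w| <= M.
Proof. by move=> [phi [[M hM] _] ->]; exists M. Qed.

Lemma past_cst i c : past x i (fun=> c).
Proof. by exists (fun=> c) => //; exact: C_bLip_cst. Qed.

Lemma past_add i f g : past x i f -> past x i g -> past x i (fun w => f w + g w).
Proof.
by move=> [p hp ->] [q hq ->]; exists (fun z => p z + q z) => //; exact: C_bLip_add.
Qed.

Lemma past_mul i f g : past x i f -> past x i g -> past x i (fun w => f w * g w).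
Proof.
by move=> [p hp ->] [q hq ->]; exists (fun z => p z * q z) => //; exact: C_bLip_mul.
Qed.

Lemma past_comp i f (h : R -> R) : past x i f -> locally_lipschitz h ->
  past x i (fun w => h (f w)).
Proof.
by move=> [p hp ->] hh; exists (fun z => h (p z)) => //; exact: C_bLip_comp.
Qed.

Lemma pastS i f : past x i f -> past x i.+1 f.
Proof.
move=> [p hp ->]; rewrite -(addn1 i).
exists (fun z : 'rV_(i + 1) => p (lsubmx z)); first exact: C_bLip_lsubmx.
apply/funext => w; congr p; apply/rowP => j; rewrite !mxE.
by congr x.
Qed.

Lemma past_widen i j f : (i <= j)%N -> past x i f -> past x j f.
Proof.
move=> /subnK <-; elim: (j - i)%N => [//|k ih] hf.
by rewrite addSn; apply/pastS/ih.
Qed.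

Lemma past_var i : past x i.+1 (x i).
Proof.
have [M hM] := x_bnd i.
exists (fun z : 'rV_i.+1 => Num.max (- `|M|) (Num.min `|M| (z ord0 ord_max))).
  exact: C_bLip_clamp.
apply/funext => w; rewrite mxE/= clamp_id//.
by apply: le_trans (hM w) _; exact: ler_norm.
Qed.

Lemma past_scale i c f : past x i f -> past x i (fun w => c * f w).
Proof. by move=> hf; apply: past_mul => //; exact: past_cst. Qed.

Lemma past_opp i f : past x i f -> past x i (fun w => - f w).
Proof.
move=> hf; rewrite (_ : (fun w => - f w) = (fun w => (-1) * f w)).
  exact: past_scale.
by apply/funext => w; rewrite mulN1r.
Qed.

Lemma past_sub i f g : past x i f -> past x i g -> past x i (fun w => f w - g w).
Proof. by move=> hf hg; apply: past_add => //; exact: past_opp. Qed.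

Lemma past_exprn i f n : past x i f -> past x i (fun w => f w ^+ n).
Proof.
move=> hf; elim: n => [|n ih]; first exact: past_cst.
rewrite (_ : (fun w => f w ^+ n.+1) = (fun w => f w * f w ^+ n)).
  exact: past_mul.
by apply/funext => w; rewrite exprS.
Qed.

Lemma past_expR i f : past x i f -> past x i (fun w => expR (f w)).
Proof. by move=> hf; apply: past_comp => //; exact: locally_lipschitz_expR. Qed.

Lemma past_max0 i f : past x i f -> past x i (fun w => Num.max 0 (f w)).
Proof.
move=> hf; rewrite (_ : (fun w => _) = (fun w => 2^-1 * (f w + `|f w|))).
  apply: past_scale; apply: past_add => //.
  by apply: past_comp => //; exact: locally_lipschitz_norm.
apply/funext => w; have [f0|f0] := leP 0 (f w).
  by rewrite ger0_norm//; lra.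
by rewrite ltr0_norm//; lra.
Qed.

Lemma past_sum i (F : nat -> Omega -> R) a b :
  (forall k, (a <= k < b)%N -> past x i (F k)) ->
  past x i (fun w => \sum_(a <= k < b) F k w).
Proof.
move=> hF; have [ba|ab] := leqP b a.
  rewrite (_ : (fun w => _) = fun=> 0); first exact: past_cst.
  by apply/funext => w; rewrite big_geq.
rewrite -(subnKC (ltnW ab)) in hF *.
elim: (b - a)%N hF => [|k ih] hF.
  rewrite (_ : (fun w => _) = fun=> 0); first exact: past_cst.
  by apply/funext => w; rewrite big_geq// addn0.
rewrite (_ : (fun w => _) =
  (fun w => \sum_(a <= k < a + k) F k w + F (a + k)%N w)).
  apply: past_add.
    by apply: ih => j /andP[aj jk]; apply: hF; rewrite aj /= addnS ltnS ltnW.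
  by apply: hF; rewrite leq_addr addnS ltnS leqnn.
by apply/funext => w; rewrite addnS big_nat_recr//= leq_addr.
Qed.

Lemma past_prod i (F : nat -> Omega -> R) a b :
  (forall k, (a <= k < b)%N -> past x i (F k)) ->
  past x i (fun w => \prod_(a <= k < b) F k w).
Proof.
move=> hF; have [ba|ab] := leqP b a.
  rewrite (_ : (fun w => _) = fun=> 1); first exact: past_cst.
  by apply/funext => w; rewrite big_geq.
rewrite -(subnKC (ltnW ab)) in hF *.
elim: (b - a)%N hF => [|k ih] hF.
  rewrite (_ : (fun w => _) = fun=> 1); first exact: past_cst.
  by apply/funext => w; rewrite big_geq// addn0.
rewrite (_ : (fun w => _) =
  (fun w => \prod_(a <= k < a + k) F k w * F (a + k)%N w)).
  apply: past_mul.
    by apply: ih => j /andP[aj jk]; apply: hF; rewrite aj /= addnS ltnS ltnW.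
  by apply: hF; rewrite leq_addr addnS ltnS leqnn.
by apply/funext => w; rewrite addnS big_nat_recr//= leq_addr.
Qed.

End past_algebra.

(* [L] stands for integration: [m] bounds the conditional means of [x], and [l],
   [u] bound its conditional second moments, given the past. *)
Record cond_moments {Omega : Type} {R : realType} (x : nat -> Omega -> R)
    (m l u : nat -> R) (L : (Omega -> R) -> R) : Prop := {
  cm_add : forall i f g, past x i f -> past x i g ->
    L (fun w => f w + g w) = L f + L g;
  cm_scale : forall i c f, past x i f -> L (fun w => c * f w) = c * L f;
  cm_ge0 : forall i f, past x i f -> (forall w, 0 <= f w) -> 0 <= L f;
  cm_one : L (fun=> 1) = 1;
  cm_mean_ge0 : forall i, 0 <= m i;
  cm_mean : forall i f, past x i f -> (forall w, 0 <= f w) ->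
    `|L (fun w => f w * x i w)| <= m i * L f;
  cm_var : forall i f, past x i f -> (forall w, 0 <= f w) ->
    l i * L f <= L (fun w => f w * x i w ^+ 2) <= u i * L f }.

(** * One-step conditional estimates and their iteration *)

Section conditional_steps.
Context {Omega : Type} {R : realType}.
Variables (x : nat -> Omega -> R) (m l u : nat -> R) (L : (Omega -> R) -> R).
Hypothesis x_bnd : forall i, exists M : R, forall w, `|x i w| <= M.
Hypothesis cmL : cond_moments x m l u L.
Implicit Types f g W k : Omega -> R.

Lemma cm_sub i f g : past x i f -> past x i g ->
  L (fun w => f w - g w) = L f - L g.
Proof.
move=> hf hg; rewrite (_ : (fun w => _) = (fun w => f w + (-1) * g w)); last first.
  by apply/funext => w; rewrite mulN1r.
rewrite (cm_add cmL hf); last exact: past_scale.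
by rewrite (cm_scale cmL _ hg) mulN1r.
Qed.

Lemma cm_mono i f g : past x i f -> past x i g -> (forall w, f w <= g w) ->
  L f <= L g.
Proof.
move=> hf hg fg; rewrite -subr_ge0 -(cm_sub hg hf).
by apply: (cm_ge0 cmL (past_sub hg hf)) => w; rewrite subr_ge0.
Qed.

Lemma cm_cst c : L (fun=> c) = c.
Proof.
have := cm_scale cmL c (past_cst x 0 1).
by rewrite (cm_one cmL) !mulr1.
Qed.

Let past_step i W k (a b : R) : past x i W -> past x i k ->
  past x i.+1 (fun w => W w * (1 + a * (k w * x i w) + b * x i w ^+ 2)).
Proof.
move=> hW hk; have hx := past_var x_bnd i.
apply: past_mul; first exact: pastS.
apply: past_add; last by apply: past_scale; exact: past_exprn.
apply: past_add; first exact: past_cst.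
by apply: past_scale; apply: past_mul => //; exact: pastS.
Qed.

Let step_expand i W k (a b : R) : past x i W -> past x i k ->
  L (fun w => W w * (1 + a * (k w * x i w) + b * x i w ^+ 2)) =
  L W + a * L (fun w => W w * k w * x i w) + b * L (fun w => W w * x i w ^+ 2).
Proof.
move=> hW hk; have hx := past_var x_bnd i.
have hW' := pastS hW; have hk' := pastS hk.
have h1 : past x i.+1 (fun w => W w * k w * x i w).
  by apply: past_mul => //; exact: past_mul.
have h2 : past x i.+1 (fun w => W w * x i w ^+ 2).
  by apply: past_mul => //; exact: past_exprn.
rewrite -(cm_scale cmL a h1) -(cm_scale cmL b h2).
rewrite -(cm_add cmL hW' (past_scale a h1)).
rewrite -(cm_add cmL (past_add hW' (past_scale a h1)) (past_scale b h2)).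
by congr L; apply/funext => w; ring.
Qed.

Let mean_part i W k : past x i W -> (forall w, 0 <= W w) ->
  past x i k -> (forall w, 0 <= k w <= 1) ->
  `|L (fun w => W w * k w * x i w)| <= m i * L W.
Proof.
move=> hW W0 hk k01.
have hWk := past_mul hW hk.
have Wk0 w : 0 <= W w * k w by rewrite mulr_ge0//; case/andP: (k01 w).
apply: le_trans (cm_mean cmL hWk Wk0) _.
rewrite ler_wpM2l// ?(cm_mean_ge0 cmL)//.
apply: cm_mono hWk hW _ => w; rewrite ler_piMr//; by case/andP: (k01 w).
Qed.

(** [k] is a predictable weight on the linear term. The conditional mean is known only up to [m i],
    whence [|a| * m i], and the sign of [b] decides which second moment bounds the square. The
    exponential form lets the steps multiply. *)
Lemma cm_step_le i W k (a b B : R) : past x i W -> (forall w, 0 <= W w) ->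
  past x i k -> (forall w, 0 <= k w <= 1) ->
  (0 <= b /\ B = b * u i) \/ (b <= 0 /\ B = b * l i) ->
  L (fun w => W w * (1 + a * (k w * x i w) + b * x i w ^+ 2))
    <= expR (`|a| * m i + B) * L W.
Proof.
move=> hW W0 hk k01 hB; rewrite step_expand//.
have LW0 := cm_ge0 cmL hW W0.
apply: (@le_trans _ _ ((1 + (`|a| * m i + B)) * L W)); last first.
  by rewrite ler_wpM2r// expR_ge1Dx.
rewrite mulrDl mul1r -addrA lerD2l mulrDl; apply: lerD.
  apply: le_trans (ler_norm _) _; rewrite normrM -mulrA ler_wpM2l//.
  exact: mean_part.
have /andP[vl vu] := cm_var cmL hW W0.
by case: hB => -[b0 ->]; rewrite -mulrA; [rewrite ler_wpM2l|rewrite ler_wnM2l].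
Qed.

(** Without a square term only the mean enters; [1 - y >= exp (- 2 * y)] for [0 <= y <= 1 / 2]
    restores the exponential form. *)
Lemma cm_step_ge i W k (a : R) : past x i W -> (forall w, 0 <= W w) ->
  past x i k -> (forall w, 0 <= k w <= 1) -> `|a| * m i <= 2^-1 ->
  expR (- (2 * (`|a| * m i))) * L W <=
  L (fun w => W w * (1 + a * (k w * x i w))).
Proof.
move=> hW W0 hk k01 am.
have LW0 := cm_ge0 cmL hW W0.
rewrite (_ : (fun w => _) =
  (fun w => W w * (1 + a * (k w * x i w) + 0 * x i w ^+ 2))); last first.
  by apply/funext => w; rewrite mul0r addr0.
rewrite step_expand// mul0r addr0.
apply: (@le_trans _ _ ((1 - `|a| * m i) * L W)).
  by rewrite ler_wpM2r// expRN2_le// am mulr_ge0// (cm_mean_ge0 cmL).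
rewrite mulrBl mul1r lerD2l lerNl.
apply: le_trans (ler_norm _) _; rewrite normrN normrM -mulrA ler_wpM2l//.
exact: mean_part.
Qed.

(** Induction on the right end of the block. The weight [W], known at time [M], is carried along
    unchanged, which makes the bound conditional on the past of the block. *)
Lemma cm_iter_le M N (Z k : nat -> Omega -> R) W (a b : R) (c : nat -> R) :
  (M <= N)%N -> past x M W -> (forall w, 0 <= W w) ->
  (forall i, (M <= i <= N)%N -> past x i (Z i)) ->
  (forall i w, (M <= i <= N)%N -> 0 <= Z i w) ->
  (forall i, (M <= i < N)%N -> past x i (k i)) ->
  (forall i w, (M <= i < N)%N -> 0 <= k i w <= 1) ->
  (forall i, (M <= i < N)%N ->
     (0 <= b /\ c i = b * u i) \/ (b <= 0 /\ c i = b * l i)) ->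
  (forall i w, (M <= i < N)%N ->
    Z i.+1 w <= Z i w * (1 + a * (k i w * x i w) + b * x i w ^+ 2)) ->
  L (fun w => W w * Z N w) <=
  expR (\sum_(M <= i < N) (`|a| * m i + c i)) * L (fun w => W w * Z M w).
Proof.
move=> MN hW W0 hZ Z0 hk k01 hc hstep.
rewrite -(subnKC MN) in hZ Z0 hk k01 hc hstep *.
elim: (N - M)%N hZ Z0 hk k01 hc hstep => [|n ih] hZ Z0 hk k01 hc hstep.
  by rewrite addn0 big_geq// expR0 mul1r.
have lt i : (M <= i < M + n)%N -> (M <= i < M + n.+1)%N.
  by move=> /andP[-> h]/=; rewrite addnS ltnW.
have le i : (M <= i <= M + n)%N -> (M <= i <= M + n.+1)%N.
  by move=> /andP[-> h]/=; rewrite addnS (leq_trans h).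
have hn : (M <= M + n < M + n.+1)%N by rewrite leq_addr addnS ltnS leqnn.
have hn' : (M <= M + n <= M + n.+1)%N by rewrite leq_addr addnS leqnSn.
have hn2 : (M <= (M + n).+1 <= M + n.+1)%N.
  by rewrite addnS leqnn leqW ?leq_addr.
have {ih}IH := ih (fun i h => hZ i (le i h)) (fun i w h => Z0 i w (le i h))
  (fun i h => hk i (lt i h)) (fun i w h => k01 i w (lt i h))
  (fun i h => hc i (lt i h)) (fun i w h => hstep i w (lt i h)).
have hWn : past x (M + n)%N W by apply: past_widen hW; exact: leq_addr.
have hWZ := past_mul hWn (hZ _ hn').
rewrite addnS big_nat_recr/= ?leq_addr// addrC expRD -mulrA.
apply: le_trans (_ : _ <= expR (`|a| * m (M + n)%N + c (M + n)%N) *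
  L (fun w => W w * Z (M + n)%N w)) _; last by rewrite ler_wpM2l// expR_ge0.
apply: le_trans (cm_step_le a hWZ _ (hk _ hn) (fun w => k01 _ w hn) (hc _ hn)).
  apply: (@cm_mono (M + n).+1).
  - by apply: past_mul; [exact: pastS|exact: hZ].
  - by apply: past_step => //; exact: hk.
  - by move=> w; rewrite -mulrA ler_wpM2l// hstep.
by move=> w; rewrite mulr_ge0// Z0.
Qed.

Lemma cm_iter_ge M N (Z k : nat -> Omega -> R) W (a : R) :
  (M <= N)%N -> past x M W -> (forall w, 0 <= W w) ->
  (forall i, (M <= i <= N)%N -> past x i (Z i)) ->
  (forall i w, (M <= i <= N)%N -> 0 <= Z i w) ->
  (forall i, (M <= i < N)%N -> past x i (k i)) ->
  (forall i w, (M <= i < N)%N -> 0 <= k i w <= 1) ->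
  (forall i, (M <= i < N)%N -> `|a| * m i <= 2^-1) ->
  (forall i w, (M <= i < N)%N ->
    Z i w * (1 + a * (k i w * x i w)) <= Z i.+1 w) ->
  expR (- (2 * `|a| * \sum_(M <= i < N) m i)) * L (fun w => W w * Z M w) <=
  L (fun w => W w * Z N w).
Proof.
move=> MN hW W0 hZ Z0 hk k01 ham hstep.
rewrite -(subnKC MN) in hZ Z0 hk k01 ham hstep *.
elim: (N - M)%N hZ Z0 hk k01 ham hstep => [|n ih] hZ Z0 hk k01 ham hstep.
  by rewrite addn0 big_geq// mulr0 oppr0 expR0 mul1r.
have lt i : (M <= i < M + n)%N -> (M <= i < M + n.+1)%N.
  by move=> /andP[-> h]/=; rewrite addnS ltnW.
have le i : (M <= i <= M + n)%N -> (M <= i <= M + n.+1)%N.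
  by move=> /andP[-> h]/=; rewrite addnS (leq_trans h).
have hn : (M <= M + n < M + n.+1)%N by rewrite leq_addr addnS ltnS leqnn.
have hn' : (M <= M + n <= M + n.+1)%N by rewrite leq_addr addnS leqnSn.
have hn2 : (M <= (M + n).+1 <= M + n.+1)%N.
  by rewrite addnS leqnn leqW ?leq_addr.
have {ih}IH := ih (fun i h => hZ i (le i h)) (fun i w h => Z0 i w (le i h))
  (fun i h => hk i (lt i h)) (fun i w h => k01 i w (lt i h))
  (fun i h => ham i (lt i h)) (fun i w h => hstep i w (lt i h)).
have hWn : past x (M + n)%N W by apply: past_widen hW; exact: leq_addr.
have hWZ := past_mul hWn (hZ _ hn').
rewrite addnS big_nat_recr/= ?leq_addr// mulrDr opprD addrC expRD -mulrA.
apply: le_trans (_ : _ <= expR (- (2 * (`|a| * m (M + n)%N))) *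
  L (fun w => W w * Z (M + n)%N w)) _.
  by rewrite (mulrA 2) ler_wpM2l// expR_ge0.
apply: le_trans (cm_step_ge hWZ _ (hk _ hn) (fun w => k01 _ w hn) (ham _ hn)) _.
  by move=> w; rewrite mulr_ge0// Z0.
apply: (@cm_mono (M + n).+1).
- apply: past_mul => //; first exact: pastS.
  apply: past_add; first exact: past_cst.
  apply: past_scale; apply: past_mul; [apply: pastS; exact: hk|exact: past_var].
- by apply: past_mul; [exact: pastS|exact: hZ].
- by move=> w; rewrite -mulrA ler_wpM2l// hstep.
Qed.

End conditional_steps.

(** * Exponential functionals with predictable weights *)

Section exponential_functionals.
Context {Omega : Type} {R : realType}.
Variables (x : nat -> Omega -> R) (m l u : nat -> R) (L : (Omega -> R) -> R).
Hypothesis x_bnd : forall i, exists M : R, forall w, `|x i w| <= M.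
Hypothesis cmL : cond_moments x m l u L.

Section fixed_weights.
Variables (M N : nat) (k : nat -> Omega -> R).
Hypothesis MN : (M <= N)%N.
Hypothesis hk : forall i, (M <= i < N)%N -> past x i (k i).
Hypothesis k01 : forall i w, (M <= i < N)%N -> 0 <= k i w <= 1.

Definition wsum n w : R := \sum_(M <= i < n) k i w * x i w.
Definition wqv n w : R := \sum_(M <= i < n) (k i w * x i w) ^+ 2.
Definition qv n w : R := \sum_(M <= i < n) x i w ^+ 2.
(** The two compensators are kept apart: the walk [wsum] feels only the weighted squares [wqv],
    whereas the unweighted squares [qv] tell how much variance the block has really produced. *)
Definition wexp a b c n w : R := expR (a * wsum n w - b * wqv n w - c * qv n w).

Let pkx i n : (M <= i < n)%N -> (n <= N)%N -> past x n (fun w => k i w * x i w).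
Proof.
move=> /andP[Mi iN] nN; apply: (@past_widen _ _ _ i.+1) => //.
apply: past_mul; last exact: past_var.
by apply/pastS/hk; rewrite Mi (leq_trans iN).
Qed.

Lemma past_wsum n : (n <= N)%N -> past x n (wsum n).
Proof. by move=> nN; apply: past_sum => i hi; exact: pkx. Qed.

Lemma past_wqv n : (n <= N)%N -> past x n (wqv n).
Proof.
by move=> nN; apply: past_sum => i hi; apply: past_exprn; exact: pkx.
Qed.

Lemma past_qv n : past x n (qv n).
Proof.
apply: past_sum => i /andP[Mi iN]; apply: past_exprn.
by apply: (@past_widen _ _ _ i.+1) => //; exact: past_var.
Qed.

Lemma past_wexp a b c n : (n <= N)%N -> past x n (wexp a b c n).
Proof.
move=> nN; apply: past_expR; apply: past_sub; last exact/past_scale/past_qv.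
by apply: past_sub; apply: past_scale; [exact: past_wsum|exact: past_wqv].
Qed.

Lemma wexpM a b c w : wexp a b c M w = 1.
Proof. by rewrite /wexp /wsum /wqv /qv !big_geq// !mulr0 !subr0 expR0. Qed.

Lemma wexpS a b c i w : (M <= i)%N -> wexp a b c i.+1 w = wexp a b c i w *
  expR (a * (k i w * x i w) - b * (k i w * x i w) ^+ 2 - c * x i w ^+ 2).
Proof.
move=> Mi; rewrite /wexp /wsum /wqv /qv !big_nat_recr//= -expRD.
congr expR; ring.
Qed.

Let wexp_le a b c (beta : R) (cc : nat -> R) W :
  past x M W -> (forall w, 0 <= W w) ->
  (forall i, (0 <= beta /\ cc i = beta * u i) \/
             (beta <= 0 /\ cc i = beta * l i)) ->
  (forall i w, (M <= i < N)%N ->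
    expR (a * (k i w * x i w) - b * (k i w * x i w) ^+ 2 - c * x i w ^+ 2)
    <= 1 + a * (k i w * x i w) + beta * x i w ^+ 2) ->
  L (fun w => W w * wexp a b c N w) <=
  expR (`|a| * (\sum_(M <= i < N) m i) + \sum_(M <= i < N) cc i) * L W.
Proof.
move=> hW W0 hcc hstep.
have := @cm_iter_le _ _ _ _ _ _ _ x_bnd cmL M N (wexp a b c) k W a beta cc MN hW W0.
rewrite big_split -mulr_sumr /= (_ : (fun w => W w * wexp a b c M w) = W); last first.
  by apply/funext => w; rewrite wexpM mulr1.
apply => //.
- by move=> i /andP[Mi iN]; exact: past_wexp.
- by move=> i w _; exact: expR_ge0.
- by move=> i w /[dup] /andP[Mi _] hi; rewrite wexpS// ler_wpM2l ?expR_ge0// hstep.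
Qed.

Let kx_small (a c : R) i w : (M <= i < N)%N -> `|a| * `|x i w| <= c ->
  `|a * (k i w * x i w)| <= c.
Proof.
move=> hi; apply: le_trans; rewrite !normrM ler_wpM2l//.
have /andP[k0 k1] := k01 w hi.
by rewrite (ger0_norm k0) ler_piMl.
Qed.

Variables (e a : R) (W : Omega -> R).
Hypothesis he : 0 < e <= 1.
Hypothesis ha : forall i w, (M <= i < N)%N -> `|a| * `|x i w| <= e / 16.
Hypothesis hW : past x M W.
Hypothesis W0 : forall w, 0 <= W w.

Lemma wexp_compensated_le :
  L (fun w => W w * wexp a ((1 + e) / 2 * a ^+ 2) 0 N w) <=
  expR (`|a| * \sum_(M <= i < N) m i) * L W.
Proof.
have := @wexp_le a ((1 + e) / 2 * a ^+ 2) 0 0 (fun=> 0) W hW W0.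
rewrite [\sum_(_ <= _ < _) 0]big1// addr0; apply.
  by move=> i; left; rewrite mul0r.
move=> i w hi; rewrite !mul0r subr0 addr0 -mulrA -exprMn.
by apply: expR_quadr_le => //; apply: kx_small => //; exact: ha.
Qed.

Lemma wexp_compensated_ge :
  (forall i, (M <= i < N)%N -> `|a| * m i <= 2^-1) ->
  expR (- (2 * `|a| * \sum_(M <= i < N) m i)) * L W <=
  L (fun w => W w * wexp a ((1 - e) / 2 * a ^+ 2) 0 N w).
Proof.
move=> ham.
have := @cm_iter_ge _ _ _ _ _ _ _ x_bnd cmL M N
  (wexp a ((1 - e) / 2 * a ^+ 2) 0) k W a MN hW W0.
rewrite (_ : (fun w => W w * wexp _ _ _ M w) = W); last first.
  by apply/funext => w; rewrite wexpM mulr1.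
apply => //.
- by move=> i /andP[Mi iN]; exact: past_wexp.
- by move=> i w _; exact: expR_ge0.
- move=> i w /[dup] /andP[Mi _] hi; rewrite wexpS// ler_wpM2l ?expR_ge0//.
  rewrite mul0r subr0 -[_ * _ ^+ 2 * _ ^+ 2]mulrA -exprMn.
  by apply: expR_quadr_ge => //; apply: kx_small => //; exact: ha.
Qed.

Lemma wexp_le_upper_var :
  L (fun w => W w * wexp a 0 0 N w) <=
  expR (`|a| * \sum_(M <= i < N) m i +
        (1 + e) / 2 * a ^+ 2 * \sum_(M <= i < N) u i) * L W.
Proof.
have := @wexp_le a 0 0 ((1 + e) / 2 * a ^+ 2)
  (fun i => (1 + e) / 2 * a ^+ 2 * u i) W hW W0.
have b0 : 0 <= (1 + e) / 2 * a ^+ 2.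
  by rewrite mulr_ge0 ?sqr_ge0//; case/andP: he => *; lra.
rewrite -mulr_sumr; apply; first by move=> i; left.
move=> i w hi; rewrite !mul0r !subr0.
apply: le_trans (expR_quadr_ub he (kx_small hi (ha w hi))) _.
rewrite lerD2l exprMn mulrA ler_wpM2l// exprMn ler_piMl ?sqr_ge0//.
by have /andP[k0 k1] := k01 w hi; rewrite expr_le1.
Qed.

(** The extra damping [exp (- a ^ 2 * qv)] is paid for by the lower second moments: under the tilted
    weight, a realised sum of squares well below [\sum l] carries little mass. *)
Lemma wexp_le_lower_var :
  (forall i w, (M <= i < N)%N -> (a * x i w) ^+ 2 <= e) ->
  L (fun w => W w * wexp a ((1 - e) / 2 * a ^+ 2) (a ^+ 2) N w) <=
  expR (`|a| * \sum_(M <= i < N) m i -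
        (1 - e) ^+ 3 * a ^+ 2 * \sum_(M <= i < N) l i) * L W.
Proof.
move=> hax.
have e1 : 0 <= 1 - e by case/andP: he => *; lra.
have := @wexp_le a ((1 - e) / 2 * a ^+ 2) (a ^+ 2) (- ((1 - e) ^+ 3 * a ^+ 2))
  (fun i => - ((1 - e) ^+ 3 * a ^+ 2) * l i) W hW W0.
rewrite -mulr_sumr mulNr; apply.
  by move=> i; right; rewrite oppr_le0 mulr_ge0 ?sqr_ge0// exprn_ge0.
move=> i w hi.
set v := a * (k i w * x i w); set y := a ^+ 2 * x i w ^+ 2.
have vs : `|v| <= e / 16 by apply: kx_small => //; exact: ha.
have /andP[e0 e1'] := he.
have y0 : 0 <= y by rewrite mulr_ge0 ?sqr_ge0.
have ye : y <= e by rewrite /y -exprMn; exact: hax.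
have vy : v ^+ 2 <= y.
  rewrite /v /y !exprMn ler_wpM2l ?sqr_ge0// ler_piMl ?sqr_ge0//.
  by have /andP[k0 k1] := k01 w hi; rewrite expr_le1.
(* The first summand gives at most [1 + v]. Since [v ^ 2 <= y], the second is at most
   [- (1 - e) * y], whose exponential is at most [1 - (1 - e) ^ 2 * y]. Multiplying by
   [1 + v >= 1 - e] yields the third power. *)
have -> : v - (1 - e) / 2 * a ^+ 2 * (k i w * x i w) ^+ 2 - y =
  (v - (1 + e) / 2 * v ^+ 2) + (e * v ^+ 2 - y) by rewrite /v; field.
rewrite expRD.
apply: (@le_trans _ _ ((1 + v) * (1 - (1 - e) * ((1 - e) * y)))).
  apply: ler_pM; rewrite ?expR_ge0//; first exact: expR_quadr_le.
  apply: le_trans (_ : _ <= expR (- ((1 - e) * y))) _.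
    by rewrite ler_expR; nra.
  apply: expRN_le_linear; first exact: mulr_ge0.
  nra.
have -> : - ((1 - e) ^+ 3 * a ^+ 2) * x i w ^+ 2 = - ((1 - e) ^+ 3 * y).
  by rewrite /y; ring.
have v1 : - e <= v by move: vs; rewrite ler_norml => /andP[? ?]; lra.
have z0 : 0 <= (1 - e) ^+ 2 * y by rewrite mulr_ge0// sqr_ge0.
have -> : (1 - e) ^+ 3 * y = (1 - e) * ((1 - e) ^+ 2 * y) by ring.
have -> : (1 - e) * ((1 - e) * y) = (1 - e) ^+ 2 * y by ring.
nra.
Qed.

End fixed_weights.

End exponential_functionals.

(** * Piecewise linear cutoffs *)

Section cutoff.
Context {R : realType}.
Variables (y0 y1 : R).
Hypothesis y01 : y0 < y1.

(** Indicators are not admissible test functions; this interpolation, [1] up to [y0] and [0] from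
    [y1] on, stands in for them. *)
Definition cutoff (s : R) : R := Num.max 0 (1 - Num.max 0 ((s - y0) / (y1 - y0))).

Let y10 : 0 < y1 - y0. Proof. by rewrite subr_gt0. Qed.

Lemma cutoff01 s : 0 <= cutoff s <= 1.
Proof.
rewrite /cutoff le_max lexx /= ge_max ler01 /=.
by rewrite lerBlDr lerDl le_max lexx.
Qed.

Lemma cutoff1 s : s <= y0 -> cutoff s = 1.
Proof.
move=> s0; have h : (s - y0) / (y1 - y0) <= 0.
  by rewrite ler_pdivrMr// mul0r subr_le0.
by rewrite /cutoff (max_l h) subr0 max_r.
Qed.

Lemma cutoff0 s : y1 <= s -> cutoff s = 0.
Proof.
move=> s1; rewrite /cutoff; apply/max_idPl; rewrite subr_le0 le_max.
by rewrite ler_pdivlMr// mul1r lerD2r s1 orbT.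
Qed.

Lemma cutoff_le : {homo cutoff : s t / s <= t >-> t <= s}.
Proof.
move=> s t st; rewrite /cutoff ge_max le_max lexx /= le_max; apply/orP; right.
rewrite lerD2l lerN2 ge_max le_max lexx /= le_max; apply/orP; right.
by rewrite ler_pM2r ?invr_gt0// lerD2r.
Qed.

Lemma past_cutoff {Omega : Type} (x : nat -> Omega -> R) i f :
  past x i f -> past x i (fun w => cutoff (f w)).
Proof.
move=> hf; apply: past_max0; apply: past_sub; first exact: past_cst.
apply: past_max0.
rewrite (_ : (fun w => _) = (fun w => (y1 - y0)^-1 * (f w - y0))).
  by apply: past_scale; apply: past_sub => //; exact: past_cst.
by apply/funext => w; rewrite mulrC.
Qed.

End cutoff.

(** * A smooth maximal inequality *)

Section maximal_functional.
Context {Omega : Type} {R : realType}.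
Variable (x : nat -> Omega -> R).
Hypothesis x_bnd : forall i, exists M : R, forall w, `|x i w| <= M.

Let S n w : R := \sum_(0 <= i < n) x i w.

(* The weights switch the walk off once it has passed [y1]; summation by parts
   then shows that the stopped walk ends above [y0]. *)
Lemma maximal_functional N (lam e y0 y1 : R) :
  0 < lam -> 0 <= y0 -> y0 < y1 -> 0 < e <= 1 ->
  (forall i w, (i < N)%N -> lam * `|x i w| <= e / 16) ->
  exists xi : Omega -> R, [/\ past x N xi, forall w, 0 <= xi w,
    forall w n, (n <= N)%N -> y1 <= S n w -> 1 <= xi w &
    forall m l u L, cond_moments x m l u L ->
      L xi <= expR (- (lam * y0) + lam * (\sum_(0 <= i < N) m i) +
                    (1 + e) / 2 * lam ^+ 2 * \sum_(0 <= i < N) u i)].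
Proof.
move=> lam0 y00 y01 he hx.
pose h n w := \prod_(0 <= j < n.+1) cutoff y0 y1 (S j w).
have pS n : past x n (S n).
  apply: past_sum => i /andP[_ iN].
  by apply: (@past_widen _ _ _ i.+1) => //; exact: past_var.
have ph n : past x n (h n).
  apply: past_prod => i /andP[_ iN]; apply: past_cutoff.
  by apply: (@past_widen _ _ _ i).
have h01 n w : 0 <= h n w <= 1.
  rewrite /h big_nat_cond; apply: (big_ind (fun z : R => 0 <= z <= 1)).
  - by rewrite ler01 lexx.
  - by move=> a b /andP[a0 a1] /andP[b0 b1]; rewrite mulr_ge0// mulr_ile1.
  - by move=> i _; exact: cutoff01.
have hS n w : h n.+1 w = h n w * cutoff y0 y1 (S n.+1 w).
  by rewrite /h big_nat_recr.
pose T n w := wsum x 0 h n w.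
(* [T n - S n * h n] is the sum of [S j * (h (j - 1) - h j)] over [1 <= j <= n], and [h] decreases
   at [j] only where [S j > y0]. *)
have inv n w : y0 * (1 - h n w) <= T n w - S n w * h n w.
  elim: n => [|n ih].
    have S0 : S 0 w = 0 by rewrite /S big_geq.
    rewrite /T /wsum /h big_nat1 big_geq// cutoff1 ?S0//.
    by rewrite subrr mulr0 mul0r subrr.
  have -> : T n.+1 w = T n w + h n w * x n w.
    by rewrite /T /wsum big_nat_recr.
  have SS : S n.+1 w = S n w + x n w by rewrite /S big_nat_recr.
  rewrite hS; have /andP[h0 h1] := h01 n w.
  have [s0|s0] := leP (S n.+1 w) y0.
    by rewrite (cutoff1 y01 s0); rewrite SS; nra.
  have /andP[c0 c1] := cutoff01 y0 y1 (S n.+1 w).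
  set c := cutoff _ _ _ in c0 c1 *.
  have : 0 <= (S n.+1 w - y0) * (h n w * (1 - c)).
    by apply: mulr_ge0; [lra|apply: mulr_ge0 => //; lra].
  rewrite SS; nra.
have hz n w : y1 <= S n w -> h n w = 0.
  by move=> s1; rewrite /h big_nat_recr//= (cutoff0 y01 s1) mulr0.
have hz' n j w : h n w = 0 -> h (n + j)%N w = 0.
  by move=> h0; elim: j => [|j ih]; rewrite ?addn0// addnS hS ih mul0r.
exists (fun w => expR (- (lam * y0)) * wexp x 0 h lam 0 0 N w); split.
- by apply: past_scale; apply: past_wexp.
- by move=> w; rewrite mulr_ge0// expR_ge0.
- move=> w n nN s1; rewrite /wexp -expRD !mul0r !subr0 -/(T N w).
  rewrite -[leLHS]expR0 ler_expR.
  have := inv N w; rewrite -(subnKC nN) hz' ?hz// subr0 mulr1 mulr0 subr0 subnKC//.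
  by nra.
- move=> m l u L cmL.
  rewrite (cm_scale cmL _ (@past_wexp _ _ _ x_bnd 0 N h (fun i _ => ph i) lam 0 0 N (leqnn N))).
  rewrite -addrA expRD ler_pM2l ?expR_gt0//.
  have := @wexp_le_upper_var _ _ _ _ _ _ _ x_bnd cmL 0 N h (leq0n N)
    (fun i _ => ph i) (fun i w _ => h01 i w) e lam (fun=> 1) he.
  rewrite (gtr0_norm lam0) (cm_one cmL) mulr1.
  rewrite (_ : (fun w => 1 * wexp _ _ _ _ _ _ _ w) = wexp x 0 h lam 0 0 N); last first.
    by apply/funext => w; rewrite mul1r.
  by apply => //; exact: past_cst.
Qed.

End maximal_functional.

(** * A test function detecting a large increment on one block *)

Section block_functional.
Context {Omega : Type} {R : realType}.
Variable (x : nat -> Omega -> R).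
Hypothesis x_bnd : forall i, exists M : R, forall w, `|x i w| <= M.

(* Second exponential tilt: [D (1 +- d)] dominates [D 1] as soon as [X] is off
   its tilted mean [Lam]. *)
Let tilted_window (Lam d e X V V' : R) :
  0 < d <= 1/10 -> e = d ^+ 2 / 20 -> 0 <= Lam ->
  (Lam <= V' -> (1 - e) * Lam <= V <= (1 + e) * Lam) ->
  let A := (1 + 2 * d - (1 - e) ^+ 2 / 2) * Lam in
  let D s b := expR (s * X - b / 2 * s ^+ 2 * V) in
  let f := expR (- A) * (D 1 (1 - e)
    - expR (- (d ^+ 2 * Lam)) * D (1 + d) (1 + e)
    - expR (- (d ^+ 2 * Lam)) * D (1 - d) (1 + e)
    - expR Lam * expR (X - (1 - e) / 2 * V - V')) in
  f <= 1 /\ (0 < f -> (1 - 2 * d) * Lam <= X).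
Proof.
move=> /andP[d0 d1] he L0 hV A D f.
have e0 : 0 < e by rewrite he divr_gt0// exprn_gt0.
have d2 : 0 < d ^+ 2 by rewrite exprn_gt0.
have dd : d ^+ 2 <= d / 10 by nra.
have D0 s b : 0 <= D s b by exact: expR_ge0.
have E0 z : 0 <= expR z :> R by exact: expR_ge0.
have D1E : D 1 (1 - e) = expR (X - (1 - e) / 2 * V).
  by rewrite /D mul1r expr1n mulr1.
have neg : (D 1 (1 - e) <= expR (- (d ^+ 2 * Lam)) * D (1 + d) (1 + e) \/
   D 1 (1 - e) <= expR (- (d ^+ 2 * Lam)) * D (1 - d) (1 + e) \/
   D 1 (1 - e) <= expR Lam * expR (X - (1 - e) / 2 * V - V')) -> f <= 0.
  move=> h; rewrite /f pmulr_rle0 ?expR_gt0//.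
  have := mulr_ge0 (E0 (- (d ^+ 2 * Lam))) (D0 (1 + d) (1 + e)).
  have := mulr_ge0 (E0 (- (d ^+ 2 * Lam))) (D0 (1 - d) (1 + e)).
  have := mulr_ge0 (E0 Lam) (E0 (X - (1 - e) / 2 * V - V')).
  by case: h => [|[|]]; lra.
suff : f <= 0 \/ (f <= 1 /\ (1 - 2 * d) * Lam <= X).
  by case=> [h|[h1 h2]]; split => //; [lra|lra].
have [V'L|LV'] := ltP V' Lam.
  left; apply: neg; right; right.
  by rewrite D1E -expRD ler_expR; lra.
have /andP[V1 V2] := hV LV'.
have eL : 0 <= e * Lam by rewrite mulr_ge0// ltW.
have dL : 0 <= d * Lam by rewrite mulr_ge0// ltW.
have d2L : d ^+ 2 * Lam <= d / 10 * Lam by rewrite ler_wpM2r.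
have eL2 : e * Lam = d ^+ 2 * Lam / 20 by rewrite he; ring.
have [Xhi|Xhi] := ltP ((1 + 2 * d) * Lam) X.
  left; apply: neg; left.
  rewrite D1E /D -expRD ler_expR.
  have B : (1 + e) / 2 * (1 + d) ^+ 2 - (1 - e) / 2 <= d + 7 / 10 * d ^+ 2.
    by rewrite he; nra.
  have B0 : 0 <= d + 7 / 10 * d ^+ 2 by lra.
  have : (d + 7 / 10 * d ^+ 2) * V <= (d + 7 / 10 * d ^+ 2) * ((1 + e) * Lam).
    by rewrite ler_wpM2l.
  have V0 : 0 <= V by apply: le_trans V1; rewrite mulr_ge0//; nra.
  have : ((1 + e) / 2 * (1 + d) ^+ 2 - (1 - e) / 2) * V <= (d + 7 / 10 * d ^+ 2) * V.
    by rewrite ler_wpM2r.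
  have : (d + 7 / 10 * d ^+ 2) * ((1 + e) * Lam) <= (d + d ^+ 2) * Lam.
    rewrite mulrA ler_wpM2r// he; nra.
  have : d * ((1 + 2 * d) * Lam) <= d * X by rewrite ler_wpM2l ?(ltW Xhi)// ltW.
  have : 0 <= d ^+ 2 * Lam by rewrite mulr_ge0// ltW.
  by nra.
have [Xlo|Xlo] := ltP X ((1 - 2 * d) * Lam).
  left; apply: neg; right; left.
  rewrite D1E /D -expRD ler_expR.
  have B : d - 7 / 10 * d ^+ 2 <= (1 - e) / 2 - (1 + e) / 2 * (1 - d) ^+ 2.
    by rewrite he; nra.
  have B0 : 0 <= d - 7 / 10 * d ^+ 2 by lra.
  have V0 : 0 <= V by apply: le_trans V1; rewrite mulr_ge0//; nra.
  have : (d - 7 / 10 * d ^+ 2) * ((1 - e) * Lam) <= (d - 7 / 10 * d ^+ 2) * V.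
    by rewrite ler_wpM2l.
  have : (d - 7 / 10 * d ^+ 2) * V <= ((1 - e) / 2 - (1 + e) / 2 * (1 - d) ^+ 2) * V.
    by rewrite ler_wpM2r.
  have : (d - d ^+ 2) * Lam <= (d - 7 / 10 * d ^+ 2) * ((1 - e) * Lam).
    rewrite mulrA ler_wpM2r// he; nra.
  have : d * X <= d * ((1 - 2 * d) * Lam) by rewrite ler_wpM2l ?(ltW Xlo)// ltW.
  have : 0 <= d ^+ 2 * Lam by rewrite mulr_ge0// ltW.
  by nra.
right; split => //.
(* On the window [X <= (1 + 2 * d) * Lam] and [V >= (1 - e) * Lam], so [A] bounds the exponent of
   the main term; this is where its value comes from. *)
apply: (@le_trans _ _ (expR (- A) * D 1 (1 - e))).
  rewrite /f ler_pM2l ?expR_gt0//.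
  have := mulr_ge0 (E0 (- (d ^+ 2 * Lam))) (D0 (1 + d) (1 + e)).
  have := mulr_ge0 (E0 (- (d ^+ 2 * Lam))) (D0 (1 - d) (1 + e)).
  have := mulr_ge0 (E0 Lam) (E0 (X - (1 - e) / 2 * V - V')).
  lra.
rewrite D1E -expRD -[leRHS]expR0 ler_expR /A.
have e1 : 0 <= 1 - e by nra.
have : (1 - e) * ((1 - e) * Lam) <= (1 - e) * V by rewrite ler_wpM2l.
by nra.
Qed.

(** Each of the three subtracted terms is at most a sixth of the common lower bound [E] of the main
    one, so half of it survives. The sixth comes from [exp (d ^ 2 * Lam / 2) >= 1 + 5], whence the
    threshold [10]. Together [A] and the cost [2 * e * Lam] of the means stay below
    [(1 / 2 + 3 * d) * Lam]. *)
Let tilted_mass (Lam d e M V : R) :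
  0 < d <= 1/10 -> e = d ^+ 2 / 20 -> 10 <= d ^+ 2 * Lam ->
  0 <= M -> M <= e * Lam -> (1 + d) * Lam <= V ->
  forall A, A = (1 + 2 * d - (1 - e) ^+ 2 / 2) * Lam ->
  2^-1 * expR (- ((1 / 2 + 3 * d) * Lam)) <=
  expR (- A) * (expR (- (2 * M))
    - expR (- (d ^+ 2 * Lam)) * expR ((1 + d) * M)
    - expR (- (d ^+ 2 * Lam)) * expR ((1 - d) * M)
    - expR Lam * expR (M - (1 - e) ^+ 3 * V)).
Proof.
move=> /andP[d0 d1] he hL M0 ML hV A hA.
have d2 : 0 < d ^+ 2 by rewrite exprn_gt0.
have dd : d ^+ 2 <= d / 10 by nra.
have L0 : 0 < Lam by rewrite -(pmulr_rgt0 _ d2); lra.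
have eL2 : e * Lam = d ^+ 2 * Lam / 20 by rewrite he; ring.
have dL : d ^+ 2 * Lam <= d * Lam / 10.
  by rewrite [leRHS]mulrAC ler_wpM2r// ltW.
have half : expR (- (d ^+ 2 * Lam / 2)) <= 6^-1.
  rewrite expRN lef_pV2 ?posrE ?expR_gt0//.
  by apply: le_trans (expR_ge1Dx _); lra.
have dM : d * M <= 1 / 10 * M by rewrite ler_wpM2r.
have dM0 : 0 <= d * M by rewrite mulr_ge0// ltW.
set E := expR (- (2 * (e * Lam))).
have E1 : E <= expR (- (2 * M)) by rewrite ler_expR; lra.
have bound z : z <= - (2 * (e * Lam)) - d ^+ 2 * Lam / 2 -> expR z <= E * 6^-1.
  move=> hz; apply: le_trans (_ : _ <= E * expR (- (d ^+ 2 * Lam / 2))) _.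
    by rewrite -expRD ler_expR.
  by rewrite ler_wpM2l// expR_ge0.
have h2 : expR (- (d ^+ 2 * Lam)) * expR ((1 + d) * M) <= E * 6^-1.
  by rewrite -expRD; apply: bound; lra.
have h3 : expR (- (d ^+ 2 * Lam)) * expR ((1 - d) * M) <= E * 6^-1.
  by rewrite -expRD; apply: bound; lra.
have h4 : expR Lam * expR (M - (1 - e) ^+ 3 * V) <= E * 6^-1.
  rewrite -expRD; apply: bound.
  have e1 : 1 - 3 * e <= (1 - e) ^+ 3 by rewrite he; nra.
  have e3 : 0 <= 1 - 3 * e by rewrite he; lra.
  have : (1 - 3 * e) * ((1 + d) * Lam) <= (1 - e) ^+ 3 * V.
    by apply: ler_pM => //; rewrite mulr_ge0//; lra.
  have : d * (e * Lam) <= e * Lam / 10 by nra.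
  nra.
apply: (@le_trans _ _ (expR (- A) * (E * 2^-1))); last first.
  by rewrite ler_pM2l ?expR_gt0//; lra.
rewrite mulrA [leRHS]mulrC ler_pM2l// -expRD ler_expR hA.
have : (1 - e) ^+ 2 * Lam >= (1 - 2 * e) * Lam.
  by rewrite ler_wpM2r ?(ltW L0)//; nra.
nra.
Qed.

(** [g] is the positive part of the difference studied in [tilted_window]. Here [lam] is the tilt,
    [q] the realised variance to be reached and [Lam = lam ^ 2 * q] the tilted mean of [lam] times
    the walk; the price is [Lam / 2], up to [3 * d * Lam]. The arbitrary [W] makes the lower bound
    conditional on what precedes the block. *)
Lemma block_functional M N (d e q lam : R) :
  (M <= N)%N -> 0 < d <= 1/10 -> e = d ^+ 2 / 20 -> 0 < q -> 0 < lam ->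
  10 <= d ^+ 2 * (lam ^+ 2 * q) ->
  (forall i w, (M <= i < N)%N -> lam * `|x i w| <= e / 32) ->
  exists g : Omega -> R, [/\ past x N g, forall w, 0 <= g w <= 1,
    forall w, 0 < g w -> exists2 n, (M <= n <= N)%N &
      (1 - 3 * d) * (lam * q) <= \sum_(M <= i < n) x i w &
    forall m l u L, cond_moments x m l u L ->
      lam * (\sum_(M <= i < N) m i) <= e * (lam ^+ 2 * q) ->
      (forall i, (M <= i < N)%N -> lam * m i <= 2^-1) ->
      (1 + d) * q <= \sum_(M <= i < N) l i ->
      forall W, past x M W -> (forall w, 0 <= W w) ->
      2^-1 * expR (- ((1 / 2 + 3 * d) * (lam ^+ 2 * q))) * L W <=
      L (fun w => W w * g w)].
Proof.
move=> MN hd he q0 lam0 hL hx; set Lam := lam ^+ 2 * q in hL *.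
have /andP[d0 d1] := hd.
have d2 : 0 < d ^+ 2 by rewrite exprn_gt0.
have dd : d ^+ 2 <= d / 10 by nra.
have e0 : 0 < e by rewrite he; lra.
have e1 : e <= 1 by rewrite he; lra.
have he1 : 0 < e <= 1 by rewrite e0.
have L0 : 0 < Lam by rewrite mulr_gt0// exprn_gt0.
have l2 : 0 < lam ^+ 2 by rewrite exprn_gt0.
have hx2 i w : (M <= i < N)%N -> lam ^+ 2 * x i w ^+ 2 <= (e / 32) ^+ 2.
  move=> hi; rewrite -(sqr_norm (x i w)) -exprMn lerXn2r ?nnegrE//.
  - by rewrite mulr_ge0// ltW.
  - by rewrite divr_ge0// ltW.
  - exact: hx.
have hxe i w : (M <= i < N)%N -> (lam * x i w) ^+ 2 <= e.
  by move=> /(hx2 i w); rewrite exprMn; nra.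
have hxq i w : (M <= i < N)%N -> x i w ^+ 2 <= e * q.
  move=> /(hx2 i w) h; rewrite -(ler_pM2l l2) [leRHS]mulrCA -/Lam.
  have : e * Lam = d ^+ 2 * Lam / 20 by rewrite he; ring.
  nra.
pose y0 := (1 - e) * q.
have y01 : y0 < q by rewrite /y0; nra.
(* The walk is switched off when its realised sum of squares nears [q]. As one square is at most
   [e * q], the weighted sum of squares ends within [e * q] of [q] whenever the block produces at
   least [q]: the variance becomes nearly deterministic. *)
pose h i w := cutoff y0 q (qv x M i w).
have ph i : past x i (h i) by apply: past_cutoff; exact: past_qv.
have h01 i w : 0 <= h i w <= 1 by exact: cutoff01.
have qv_mono i w : (M <= i)%N -> qv x M i w <= qv x M i.+1 w.
  by move=> Mi; rewrite /qv big_nat_recr//= lerDl sqr_ge0.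
have wqvS i w : (M <= i)%N ->
    wqv x M h i.+1 w = wqv x M h i w + (h i w * x i w) ^+ 2.
  by move=> Mi; rewrite /wqv big_nat_recr.
have qvS i w : (M <= i)%N -> qv x M i.+1 w = qv x M i w + x i w ^+ 2.
  by move=> Mi; rewrite /qv big_nat_recr.
have wsumS i w : (M <= i)%N -> wsum x M h i.+1 w = wsum x M h i w + h i w * x i w.
  by move=> Mi; rewrite /wsum big_nat_recr.
have sub i : (M <= i)%N -> i = (M + (i - M))%N by move=> /subnKC.
have qv_low i w : (M <= i)%N -> Num.min (qv x M i w) y0 <= wqv x M h i w.
  move=> /sub ->; elim: (i - M)%N => [|n ih].
    by rewrite addn0 /qv /wqv !big_geq// ge_min lexx.
  rewrite addnS wqvS ?leq_addr// qvS ?leq_addr//.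
  have [qy|qy] := leP (qv x M (M + n) w) y0.
    rewrite {2}/h (cutoff1 y01 qy) mul1r ge_min; apply/orP; left.
    rewrite lerD2r.
    by apply: le_trans ih; rewrite le_min lexx.
  rewrite ge_min; apply/orP; right; apply: le_trans (_ : _ <= wqv x M h (M + n) w) _.
    by apply: le_trans ih; rewrite le_min lexx ltW.
  by rewrite lerDl sqr_ge0.
have qv_high i w : (M <= i <= N)%N ->
    wqv x M h i w <= qv x M i w /\ wqv x M h i w <= (1 + e) * q.
  move=> /andP[/sub ->]; elim: (i - M)%N => [_|n ih].
    by rewrite addn0 /qv /wqv !big_geq//; split=> //; rewrite mulr_ge0// ?ltW//; lra.
  rewrite addnS => nN; have [ih1 ih2] := ih (ltnW nN).
  have hn : (M <= M + n < N)%N by rewrite leq_addr.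
  rewrite wqvS ?leq_addr// qvS ?leq_addr//.
  have /andP[k0 k1] := h01 (M + n)%N w.
  have kx : (h (M + n)%N w * x (M + n)%N w) ^+ 2 <= x (M + n)%N w ^+ 2.
    by rewrite exprMn ler_piMl ?sqr_ge0// expr_le1.
  split; first exact: lerD.
  have [qy|qy] := leP q (qv x M (M + n) w).
    by rewrite {2}/h (cutoff0 y01 qy) mul0r expr0n addr0.
  have := hxq _ w hn; lra.
have wqvN w : q <= qv x M N w ->
    (1 - e) * q <= wqv x M h N w <= (1 + e) * q.
  move=> hq; apply/andP; split; last by case: (qv_high N w); rewrite ?MN ?leqnn.
  apply: le_trans (qv_low N w MN); rewrite le_min lexx andbT.
  by apply: le_trans hq; exact: ltW.
(* Abel summation: with nonincreasing weights in [[0, 1]], the weighted sum cannot exceed a bound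
   [Y >= 0] of all the partial sums. A large weighted sum thus reveals a large partial sum. *)
have maxT w Y : 0 <= Y -> (forall n, (M <= n <= N)%N ->
    \sum_(M <= i < n) x i w <= Y) -> wsum x M h N w <= Y.
  move=> Y0 hY.
  have inv i : (M <= i <= N)%N ->
      wsum x M h i w <= Y - h i w * (Y - \sum_(M <= i0 < i) x i0 w).
    move=> /andP[/sub ->]; elim: (i - M)%N => [_|n ih].
      rewrite addn0 /wsum !big_geq// subr0.
      by have /andP[k0 k1] := h01 M w; nra.
    rewrite addnS => nN; have := ih (ltnW nN).
    rewrite wsumS ?leq_addr// big_nat_recr ?leq_addr//=.
    have := hY (M + n).+1; rewrite nN leqW ?leq_addr// => /(_ isT).
    rewrite big_nat_recr ?leq_addr//=.
    have : h (M + n).+1 w <= h (M + n)%N w.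
      by apply: cutoff_le => //; apply: qv_mono; exact: leq_addr.
    nra.
  have := inv N; rewrite MN leqnn => /(_ isT).
  have /andP[k0 k1] := h01 N w.
  have := hY N; rewrite MN leqnn => /(_ isT).
  nra.
pose A := (1 + 2 * d - (1 - e) ^+ 2 / 2) * Lam.
pose D s b := wexp x M h (s * lam) (b / 2 * (s * lam) ^+ 2) 0 N.
pose D4 := wexp x M h lam ((1 - e) / 2 * lam ^+ 2) (lam ^+ 2) N.
pose c := expR (- (d ^+ 2 * Lam)).
pose f w := expR (- A) * (D 1 (1 - e) w - c * D (1 + d) (1 + e) w
  - c * D (1 - d) (1 + e) w - expR Lam * D4 w).
have pD s b : past x N (D s b) by apply: past_wexp.
have pD4 : past x N D4 by apply: past_wexp.
have pf1 : past x N (fun w => D 1 (1 - e) w - c * D (1 + d) (1 + e) w).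
  by apply: past_sub => //; exact: past_scale.
have pf2 : past x N (fun w => D 1 (1 - e) w - c * D (1 + d) (1 + e) w
    - c * D (1 - d) (1 + e) w).
  by apply: past_sub => //; exact: past_scale.
have pf : past x N f.
  by apply: past_scale; apply: past_sub => //; exact: past_scale.
have window w : f w <= 1 /\ (0 < f w -> (1 - 2 * d) * Lam <= lam * wsum x M h N w).
  have := @tilted_window Lam d e (lam * wsum x M h N w)
    (lam ^+ 2 * wqv x M h N w) (lam ^+ 2 * qv x M N w) hd he (ltW L0).
  rewrite /= (_ : expR (- _) * (_ - _ - _ - expR Lam * _) = f w); last first.
    rewrite /f /D /D4 /wexp /c.
    by congr (_ * (_ - _ * _ - _ * _ - _ * _)); congr expR; ring.
  apply; rewrite ler_pM2l// => /wqvN /andP[w1 w2].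
  by rewrite /Lam mulrCA ler_pM2l// w1 /= mulrCA ler_pM2l.
exists (fun w => Num.max 0 (f w)); split.
- exact: past_max0.
- move=> w; rewrite le_max lexx /= ge_max ler01 /=.
  by case: (window w).
- move=> w; rewrite lt_max ltxx /= => /(proj2 (window w)) hT.
  apply: contrapT => hn.
  have : wsum x M h N w <= (1 - 3 * d) * (lam * q).
    apply: maxT => [|n hn']; first by rewrite !mulr_ge0// ?ltW//; lra.
    rewrite leNgt; apply/negP => /ltW hh; apply: hn; by exists n.
  rewrite -(ler_pM2l lam0) (_ : lam * (_ * _) = (1 - 3 * d) * Lam); last first.
    by rewrite /Lam; ring.
  have : 0 < d * Lam by exact: mulr_gt0.
  lra.
- move=> m l u L cmL hm hm1 hl W hW W0.
  have M0 : 0 <= lam * \sum_(M <= i < N) m i.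
    by rewrite mulr_ge0 ?(ltW lam0)// sumr_ge0// => i _; exact: cm_mean_ge0 cmL _.
  have LW0 : 0 <= L W := cm_ge0 cmL hW W0.
  have hWN := past_widen MN hW.
  have pW F : past x N F -> past x N (fun w => W w * F w) by exact: past_mul.
  have hxs s i w : `|s| <= 1 + d -> (M <= i < N)%N ->
      `|s * lam| * `|x i w| <= e / 16.
    move=> hs hi; rewrite normrM (gtr0_norm lam0) -mulrA.
    apply: le_trans (_ : _ <= 2 * (e / 32)) _; last by lra.
    by apply: ler_pM => //; [rewrite mulr_ge0// ltW|lra|exact: hx].
  have B2 s : 0 <= s <= 1 + d ->
      L (fun w => W w * D s (1 + e) w) <= expR (s * (lam * \sum_(M <= i < N) m i)) * L W.
    move=> /andP[s0 s1].
    have hs : `|s| <= 1 + d by rewrite ger0_norm.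
    have := @wexp_compensated_le _ _ _ _ _ _ _ x_bnd cmL M N h MN
      (fun i _ => ph i) (fun i w _ => h01 i w) e (s * lam) W he1
      (fun i w => @hxs s i w hs) hW W0.
    by rewrite (ger0_norm (_ : 0 <= s * lam)) ?mulr_ge0 ?(ltW lam0)// -(mulrA s).
  have hs1 : `|1| <= 1 + d :> R by rewrite normr1; lra.
  have B1 : expR (- (2 * (lam * \sum_(M <= i < N) m i))) * L W <=
      L (fun w => W w * D 1 (1 - e) w).
    have := @wexp_compensated_ge _ _ _ _ _ _ _ x_bnd cmL M N h MN
      (fun i _ => ph i) (fun i w _ => h01 i w) e (1 * lam) W he1
      (fun i w => @hxs 1 i w hs1) hW W0.
    by rewrite mul1r (gtr0_norm lam0) -(mulrA 2) /D !mul1r; apply.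
  have B4 : L (fun w => W w * D4 w) <=
     expR (lam * (\sum_(M <= i < N) m i) -
       (1 - e) ^+ 3 * (lam ^+ 2 * \sum_(M <= i < N) l i)) * L W.
    have := @wexp_le_lower_var _ _ _ _ _ _ _ x_bnd cmL M N h MN
      (fun i _ => ph i) (fun i w _ => h01 i w) e lam W he1 _ hW W0 hxe.
    rewrite (gtr0_norm lam0) -(mulrA ((1 - e) ^+ 3)); apply.
    by move=> i w hi; have := @hxs 1 i w hs1 hi; rewrite mul1r (gtr0_norm lam0).
  suff hf : 2^-1 * expR (- ((1 / 2 + 3 * d) * Lam)) * L W <= L (fun w => W w * f w).
    apply: le_trans hf _; apply: (cm_mono cmL (pW _ pf) (pW _ (past_max0 pf))).
    by move=> w; rewrite ler_wpM2l// le_max lexx orbT.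
  have -> : L (fun w => W w * f w) = expR (- A) *
    (L (fun w => W w * D 1 (1 - e) w) - c * L (fun w => W w * D (1 + d) (1 + e) w)
     - c * L (fun w => W w * D (1 - d) (1 + e) w) - expR Lam * L (fun w => W w * D4 w)).
    have p1 := pW _ (pD 1 (1 - e)); have p2 := pW _ (pD (1 + d) (1 + e)).
    have p3 := pW _ (pD (1 - d) (1 + e)); have p4 := pW _ pD4.
    rewrite -(cm_scale cmL c p2) -(cm_scale cmL c p3) -(cm_scale cmL (expR Lam) p4).
    have q1 := past_sub p1 (past_scale c p2).
    have q2 := past_sub q1 (past_scale c p3).
    have q3 := past_sub q2 (past_scale (expR Lam) p4).
    rewrite -(cm_sub cmL p1 (past_scale c p2)) -(cm_sub cmL q1 (past_scale c p3)).
    rewrite -(cm_sub cmL q2 (past_scale (expR Lam) p4)) -(cm_scale cmL _ q3).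
    by congr L; apply/funext => w; rewrite /f; ring.
  apply: le_trans (_ : _ <= expR (- A) * (expR (- (2 * (lam * \sum_(M <= i < N) m i)))
    - c * expR ((1 + d) * (lam * \sum_(M <= i < N) m i))
    - c * expR ((1 - d) * (lam * \sum_(M <= i < N) m i))
    - expR Lam * expR (lam * (\sum_(M <= i < N) m i) -
       (1 - e) ^+ 3 * (lam ^+ 2 * \sum_(M <= i < N) l i))) * L W) _.
    rewrite ler_wpM2r//; apply: tilted_mass => //.
    by rewrite /Lam mulrCA ler_pM2l.
  rewrite -mulrA ler_pM2l ?expR_gt0//.
  have s1 : 0 <= 1 + d <= 1 + d by apply/andP; split; lra.
  have s2 : 0 <= 1 - d <= 1 + d by apply/andP; split; lra.
  have := ler_wpM2l (expR_ge0 (- (d ^+ 2 * Lam))) (B2 _ s1).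
  have := ler_wpM2l (expR_ge0 (- (d ^+ 2 * Lam))) (B2 _ s2).
  have := ler_wpM2l (expR_ge0 Lam) B4.
  rewrite -/c; move: B1; lra.
Qed.

End block_functional.

(** * The normalizers as functions of the variance *)

Section lil_normalizer.
Context {R : realType}.
Implicit Types x y : R.

(** At [x = s_n ^ 2] these are [t_n] and [a_n]. As functions of the variance they inherit
    monotonicity in [n] from [v]. *)
Definition itau x : R := Num.sqrt (2 * llog (llog x)).
Definition lil x : R := Num.sqrt x * itau x.

Lemma itau_sqr x : itau x ^+ 2 = 2 * llog (llog x).
Proof. by rewrite sqr_sqrtr// mulr_ge0// ltW// llog_gt0. Qed.

Lemma itau_sqr_ge2 x : 2 <= itau x ^+ 2.
Proof. by rewrite itau_sqr; have := llog_ge1 (llog x); lra. Qed.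

Lemma itau_gt0 x : 0 < itau x.
Proof. by rewrite sqrtr_gt0 mulr_gt0// llog_gt0. Qed.

Lemma lil_ge0 x : 0 <= lil x.
Proof. by rewrite mulr_ge0 ?sqrtr_ge0. Qed.

Lemma ler_lil : {homo lil : x y / x <= y}.
Proof.
move=> x y xy; by rewrite ler_pM ?sqrtr_ge0 ?ler_wsqrtr// ler_pM2l// !ler_llog.
Qed.

(** Squared, it is [x * llog (llog y) <= y * llog (llog x)], that is [llogM] twice with [k = y / x].
    It transports a bound on a variable, given at its own index, to later indices. *)
Lemma itau_ratio x y : 0 < x -> x <= y ->
  Num.sqrt x * itau y <= Num.sqrt y * itau x.
Proof.
move=> x0 xy; have y0 : 0 < y by exact: lt_le_trans xy.
rewrite -ler_sqr ?nnegrE ?mulr_ge0 ?sqrtr_ge0// !exprMn !itau_sqr.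
rewrite !sqr_sqrtr ?(ltW x0) ?(ltW y0)//.
rewrite mulrCA [leRHS]mulrCA ler_pM2l//.
have k1 : 1 <= y / x by rewrite ler_pdivlMr// mul1r.
have -> : y = y / x * x by rewrite divfK ?gt_eqF.
have h1 : llog (y / x * x) <= y / x * llog x by exact: llogM.
have h2 : llog (llog (y / x * x)) <= y / x * llog (llog x).
  by apply: le_trans (ler_llog h1) _; exact: llogM.
apply: le_trans (_ : x * (y / x * llog (llog x)) <= _); first by rewrite ler_pM2l.
by rewrite mulrCA mulrA.
Qed.

(** [itau_ratio] multiplied by [sqrt x * sqrt y]. On a geometric block it bounds the variation of
    [lil] by that of the variance. *)
Lemma lil_ratio x y : 0 < x -> x <= y -> x * lil y <= y * lil x.
Proof.
move=> x0 xy; have y0 : 0 < y by exact: lt_le_trans xy.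
have := itau_ratio x0 xy; rewrite /lil.
have := sqrtr_gt0 x; have := sqrtr_gt0 y; rewrite x0 y0.
have := sqr_sqrtr (ltW x0); have := sqr_sqrtr (ltW y0).
move: (Num.sqrt x) (Num.sqrt y) => a b yE xE b0 a0 h.
rewrite -[X in X * (b * _)]xE -[X in X * (a * _)]yE.
have -> : a ^+ 2 * (b * itau y) = (a * b) * (a * itau y) by ring.
have -> : b ^+ 2 * (a * itau x) = (a * b) * (b * itau x) by ring.
by rewrite ler_pM2l// mulr_gt0.
Qed.

Lemma llog_unbounded (C : R) : exists V, forall x, V <= x -> C <= llog x.
Proof.
exists (expR C) => x h; rewrite /llog -{1}(expRK C) ler_ln ?posrE ?expR_gt0//.
  by rewrite le_max h orbT.
by rewrite lt_max expR_gt0.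
Qed.

Lemma itau_unbounded (C : R) : exists V, forall x, V <= x -> C <= itau x ^+ 2.
Proof.
have [V1 hV1] := llog_unbounded (C / 2).
have [V2 hV2] := llog_unbounded V1.
by exists V2 => x /hV2 /hV1; rewrite itau_sqr; lra.
Qed.

Lemma itau_small (e : R) : 0 < e ->
  exists V, forall x, V <= x -> itau x <= e * Num.sqrt x.
Proof.
move=> e0; exists (Num.max 1 ((4 / e ^+ 2) ^+ 2)) => x; rewrite ge_max => /andP[x1 xe].
have e2 : 0 < e ^+ 2 by rewrite exprn_gt0.
have s0 : 0 < Num.sqrt x by rewrite sqrtr_gt0; lra.
have s4 : 4 / e ^+ 2 <= Num.sqrt x.
  rewrite -(@gtr0_norm _ (4 / e ^+ 2)) ?divr_gt0// -sqrtr_sqr.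
  exact: ler_wsqrtr.
rewrite -ler_sqr ?nnegrE ?mulr_ge0 ?(ltW e0) ?(ltW s0) ?sqrtr_ge0// itau_sqr.
have := llog_le (llog_ge1 x); have := llog_le_sqrt x1.
move: s4; rewrite ler_pdivrMr// exprMn.
nra.
Qed.

End lil_normalizer.

(** * Series and geometric scales *)

Section series_estimates.
Context {R : realType}.

Lemma sum_geometric_half (e : R) n : 0 <= e ->
  \sum_(0 <= i < n) e / 2 ^+ i.+1 <= e.
Proof.
move=> e0; have -> : \sum_(0 <= i < n) e / 2 ^+ i.+1 = e * (1 - 2 ^- n).
  elim: n => [|n ih]; first by rewrite big_geq// expr0 invr1 subrr mulr0.
  rewrite big_nat_recr//= ih exprS invfM.
  by field.
by rewrite ler_piMr// gerBl invr_ge0 exprn_ge0.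
Qed.

Lemma sum_harmonic_unbounded (C : R) j :
  exists n, C <= \sum_(j <= k < n) k.+1%:R^-1.
Proof.
apply: contrapT => hn.
have hC n : \sum_(j <= k < n) (k.+1%:R^-1 : R) <= C.
  by rewrite leNgt; apply/negP => /ltW h; apply: hn; exists n.
apply: (@dvg_harmonic R); apply: nondecreasing_is_cvgn.
  by apply: nondecreasing_series => k _ _; exact: harmonic_ge0.
exists (\sum_(0 <= k < j) (k.+1%:R^-1 : R) + C) => _ [n _ <-].
rewrite /series /=; have [nj|jn] := leqP n j.
  apply: (@le_trans _ _ (\sum_(0 <= k < j) k.+1%:R^-1)).
    by rewrite [leRHS](big_cat_nat (leq0n n) nj)//= lerDl sumr_ge0.
  by rewrite lerDl; apply: le_trans (hC j); rewrite big_geq.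
by rewrite (big_cat_nat (leq0n j) (ltnW jn))//= lerD2l.
Qed.

(* Comparison with the telescoping series of [k `^ - e]. *)
Lemma sum_riemann_tail (b e d : R) : 0 < b -> 0 < e -> 0 < d ->
  exists k0, (0 < k0)%N /\ forall n,
    \sum_(k0 <= k < n) expR (- ((1 + e) * ln (k%:R * b))) <= d.
Proof.
move=> b0 e0 d0.
pose F k : R := expR (- (e * ln k%:R)).
pose C := expR (- ((1 + e) * ln b)).
have C0 : 0 < C by exact: expR_gt0.
have term k : (1 < k)%N ->
    expR (- ((1 + e) * ln (k%:R * b))) <= C / e * (F k.-1 - F k).
  move=> k1; have k0 : 0 < k%:R :> R by rewrite ltr0n ltnW.
  have k10 : 0 < k.-1%:R :> R by rewrite ltr0n -subn1 subn_gt0.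
  have kk : k.-1%:R = k%:R - 1 :> R by rewrite -subn1 natrB// ltnW.
  rewrite lnM ?posrE// mulrDr opprD expRD mulrC -/C -mulrA ler_pM2l//.
  have -> : expR (- ((1 + e) * ln k%:R)) = F k / k%:R.
    rewrite mulrDl mul1r opprD expRD mulrC; congr (_ * _).
    by rewrite expRN lnK ?posrE.
  rewrite ler_pdivlMl//.
  have -> : F k.-1 = F k * expR (e * (ln k%:R - ln k.-1%:R)).
    by rewrite -expRD; congr expR; ring.
  have h1 : k%:R^-1 <= ln k%:R - ln k.-1%:R :> R.
    rewrite -[leRHS]opprB lerNr -ln_div ?posrE// kk.
    have -> : (k%:R - 1) / k%:R = 1 + (- k%:R^-1) :> R.
      by rewrite mulrBl mul1r mulfV ?gt_eqF.
    by apply: le_ln1Dx; rewrite ltrN2 invf_lt1// ltr1n.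
  have F0 : 0 < F k by exact: expR_gt0.
  apply: (@le_trans _ _ (F k * (e * (ln k%:R - ln k.-1%:R)))).
    by rewrite mulrCA ler_pM2l// ler_pM2l.
  rewrite -[X in _ <= _ - X]mulr1 -mulrBr ler_pM2l//.
  by have := expR_ge1Dx (e * (ln k%:R - ln k.-1%:R)); lra.
pose D := d * e / C.
have D0 : 0 < D by rewrite divr_gt0// mulr_gt0.
have [j hj] : exists j, (0 < j)%N /\ F j <= D.
  exists (Num.truncn (expR (- ln D / e))).+1; split=> //.
  rewrite /F -[leRHS]lnK ?posrE// ler_expR lerNl mulrC -ler_pdivrMr//.
  rewrite -[leLHS]expRK ler_ln ?posrE ?expR_gt0//.
  by apply: ltW; exact: Num.Theory.truncnS_gt.
case: hj => j0 hj.
exists j.+1; split=> // n.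
have [nj|jn] := leqP n j.+1; first by rewrite big_geq// ltW.
apply: (@le_trans _ _ (\sum_(j.+1 <= k < n) C / e * (F k.-1 - F k))).
  rewrite big_nat_cond [leRHS]big_nat_cond; apply: ler_sum => k.
  by rewrite andbT => /andP[jk _]; apply: term; rewrite (leq_trans _ jk).
rewrite -mulr_sumr.
have -> : \sum_(j.+1 <= k < n) (F k.-1 - F k) = F j - F n.-1.
  rewrite -(subnKC jn); elim: (n - j.+2)%N => [|i ih].
    by rewrite addn0 big_nat1.
  rewrite addnS big_nat_recr/=; last by rewrite addSn ltnW// ltnS leq_addr.
  by rewrite ih !addSn /=; ring.
apply: (@le_trans _ _ (C / e * D)).
  rewrite ler_pM2l ?divr_gt0//.
  by apply: le_trans hj; rewrite gerBl expR_ge0.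
rewrite (_ : C / e * D = d)//.
by rewrite /D; field; rewrite !gt_eqF.
Qed.

Lemma exprn_unbounded (c y : R) : 1 < c -> exists n, y < c ^+ n.
Proof.
move=> c1; have c0 : 0 < c - 1 by rewrite subr_gt0.
exists (Num.truncn (y / (c - 1))).+1; set n := (Num.truncn _).+1.
have yn : y < n%:R * (c - 1) by rewrite -ltr_pdivrMr//; exact: Num.Theory.truncnS_gt.
apply: lt_le_trans yn _; elim: n => [|n ih]; first by rewrite mul0r.
have : 1 <= c ^+ n by rewrite exprn_ege1// ltW.
by rewrite exprS -natr1; nra.
Qed.

Lemma exprn_window (c y : R) : 1 < c -> 1 <= y ->
  exists k, c ^+ k <= y < c ^+ k.+1.
Proof.
move=> c1 y1; have ex := exprn_unbounded y c1.
case: (ex_minnP ex) => -[|k] yk mink; first by move: yk; rewrite expr0; lra.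
exists k; rewrite yk andbT leNgt; apply/negP => /mink.
by rewrite ltnn.
Qed.

End series_estimates.

(* The covering functionals are bounded uniformly over all admissible [L], so one
   covering yields both sets of measure zero and sets of outer capacity zero. *)
Definition qnull {Omega : Type} {R : realType} (x : nat -> Omega -> R)
    (m l u : nat -> R) (A : set Omega) : Prop :=
  forall eps : R, 0 < eps -> exists (xi : nat -> Omega -> R) (e : nat -> R),
    [/\ forall n, exists i, past x i (xi n), forall n w, 0 <= xi n w,
        forall n, 0 <= e n /\ forall L, cond_moments x m l u L -> L (xi n) <= e n,
        forall n, \sum_(0 <= i < n) e i <= eps &
        forall w, A w -> exists n, 1 <= xi n w].

Section qnull_algebra.
Context {Omega : Type} {R : realType}.
Variables (x : nat -> Omega -> R) (m l u : nat -> R).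

Lemma qnull_sub A B : A `<=` B -> qnull x m l u B -> qnull x m l u A.
Proof.
move=> AB hB eps e0; have [xi [e [h1 h2 h3 h5 h6]]] := hB eps e0.
by exists xi, e; split=> // w /AB /h6.
Qed.

Lemma qnullU A B : qnull x m l u A -> qnull x m l u B -> qnull x m l u (A `|` B).
Proof.
move=> hA hB eps e0; have e20 : 0 < eps / 2 by rewrite divr_gt0.
have [xi [e [h1 h2 h3 h5 h6]]] := hA _ e20.
have [xi' [e' [h1' h2' h3' h5' h6']]] := hB _ e20.
have hij n : exists i, past x i (xi n) /\ past x i (xi' n).
  have [i hi] := h1 n; have [j hj] := h1' n; exists (maxn i j).
  by split; [apply: past_widen hi|apply: past_widen hj]; rewrite leq_max leqnn ?orbT.
exists (fun n w => xi n w + xi' n w), (fun n => e n + e' n); split.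
- by move=> n; have [i [hi hj]] := hij n; exists i; exact: past_add.
- by move=> n w; rewrite addr_ge0.
- move=> n; have [e1 le1] := h3 n; have [e2 le2] := h3' n.
  split=> [|L cmL]; first by rewrite addr_ge0.
  by have [i [hi hj]] := hij n; rewrite (cm_add cmL hi hj) lerD ?le1 ?le2.
- by move=> n; rewrite big_split/=; have := h5 n; have := h5' n; lra.
- move=> w [/h6|/h6'] [n hn]; exists n.
    by apply: le_trans hn _; rewrite lerDl.
  by apply: le_trans hn _; rewrite lerDr.
Qed.

End qnull_algebra.

(** * The upper and lower halves of the law of the iterated logarithm *)

Section lil_halves.
Context {Omega : Type} {R : realType}.
Variables (x : nat -> Omega -> R) (m l u v : nat -> R).
Hypothesis x_bnd : forall i, exists M : R, forall w, `|x i w| <= M.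
Hypothesis v0 : v 0%N = 0.
Hypothesis v_mono : {homo v : i j / (i <= j)%N >-> i <= j}.
Hypothesis v_infty : forall C, \forall n \near \oo, C <= v n.
Hypothesis x_small : forall eta : R, 0 < eta -> \forall N \near \oo,
  forall i w, (i < N)%N -> itau (v N) * `|x i w| <= eta * Num.sqrt (v N).
Hypothesis m_small : forall eta : R, 0 < eta -> \forall N \near \oo,
  \sum_(0 <= i < N) m i <= eta * lil (v N).

Local Notation S n w := (\sum_(0 <= i < n) x i w).

Let near_ge (P : nat -> Prop) : (\forall n \near \oo, P n) ->
  exists N, forall n, (N <= n)%N -> P n.
Proof. by move=> [N _ hN]; exists N. Qed.

Let v_pos : \forall n \near \oo, 0 < v n.
Proof. by apply: filterS (v_infty 1) => n; exact: lt_le_trans. Qed.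

Section upper_half.
Variables (rho x0 : R).
Hypothesis rho0 : 0 <= rho.
Hypothesis x0_gt0 : 0 < x0.
Hypothesis x0_rho : rho < x0 ^+ 2.
Hypothesis u_le : forall rho', rho < rho' -> \forall N \near \oo,
  \sum_(0 <= i < N) u i <= rho' * v N.

Lemma upper_tail : exists2 e : R, 0 < e & \forall N \near \oo,
  exists xi : Omega -> R, [/\ past x N xi, forall w, 0 <= xi w,
    forall w n, (n <= N)%N -> x0 * lil (v N) <= S n w -> 1 <= xi w &
    forall L, cond_moments x m l u L ->
      L xi <= expR (- ((1 + e) * llog (llog (v N))))].
Proof.
have [r0 x00 x0r] := And3 rho0 x0_gt0 x0_rho.
(* [rho < rho' < x' ^ 2 < x0 ^ 2], equally spaced: one gap for the variance, one for [kap > 1], one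
   for the width of the cutoff. *)
pose rho' := (2 * rho + x0 ^+ 2) / 3.
pose x' : R := Num.sqrt ((rho + 2 * x0 ^+ 2) / 3).
have x02 : 0 < x0 ^+ 2 by rewrite exprn_gt0.
have rho'0 : 0 < rho' by rewrite /rho'; lra.
have x'2 : x' ^+ 2 = (rho + 2 * x0 ^+ 2) / 3 by rewrite sqr_sqrtr//; lra.
have x'0 : 0 < x' by rewrite sqrtr_gt0; lra.
have x'x0 : x' < x0.
  by rewrite -ltr_sqr ?nnegrE ?(ltW x'0) ?(ltW x0_gt0)// x'2; lra.
pose kap : R := x' ^+ 2 / rho'.
have kap1 : 1 < kap by rewrite /kap ltr_pdivlMr// x'2 /rho'; lra.
pose e : R := (kap - 1) / (4 * kap).
have kap0 : 0 < kap by lra.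
have he : 0 < e <= 1.
  have k40 : 0 < 4 * kap by lra.
  by apply/andP; split; [apply: divr_gt0; lra|rewrite /e ler_pdivrMr//; lra].
have /andP[e0 e1] := he.
have eE : e * kap = (kap - 1) / 4 by rewrite /e; field; lra.
have rr' : rho < rho' by rewrite /rho'; lra.
have kapE : kap = x' ^+ 2 / rho' by [].
clearbody e kap x' rho'.
exists ((kap - 1) / 2); first lra.
(* The means and the factor [1 + e] will each cost [(kap - 1) / 8 * t ^ 2]: together half of the
   excess of [kap * t ^ 2 / 2] over [t ^ 2 / 2]. The other half is the exponent announced. *)
pose eta := (kap - 1) / 8 * (rho' / x').
have eta0 : 0 < eta by rewrite mulr_gt0 ?divr_gt0//; lra.
pose eta2 := e / 16 * (rho' / x').
have eta20 : 0 < eta2 by rewrite mulr_gt0 ?divr_gt0//.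
near=> N.
have vN : 0 < v N by near: N.
have hM : \sum_(0 <= i < N) m i <= eta * lil (v N) by near: N; exact: m_small.
have hB : forall i w, (i < N)%N -> itau (v N) * `|x i w| <= eta2 * Num.sqrt (v N).
  by near: N; exact: x_small.
rewrite /lil in hM *.
set s := Num.sqrt (v N) in hM hB *; set t := itau (v N) in hM hB *.
have s0 : 0 < s by rewrite sqrtr_gt0.
have t0 : 0 < t by exact: itau_gt0.
have s2 : s ^+ 2 = v N by rewrite sqr_sqrtr// ltW.
have hU : \sum_(0 <= i < N) u i <= rho' * s ^+ 2.
  by rewrite s2; near: N; exact: u_le.
(* The Chernoff optimum for level [x' * s * t] and variance [rho' * s ^ 2]: the exponent is
   [- kap * t ^ 2 / 2], where [t ^ 2 / 2] is the iterated logarithm of [v N]. *)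
pose lam := x' / rho' * (t / s).
have lam0 : 0 < lam by rewrite mulr_gt0 ?divr_gt0.
have st0 : 0 < s * t by rewrite mulr_gt0.
have y00 : 0 <= x' * (s * t) by rewrite mulr_ge0 ?ltW.
have y01 : x' * (s * t) < x0 * (s * t) by rewrite ltr_pM2r.
have hlam i w : (i < N)%N -> lam * `|x i w| <= e / 16.
  move=> iN; have := hB i w iN.
  rewrite -(ler_pM2l (_ : 0 < x' / rho' / s)) ?divr_gt0//.
  rewrite (_ : x' / rho' / s * (eta2 * s) = e / 16); last first.
    by rewrite /eta2; field; rewrite !gt_eqF.
  by apply: le_trans; rewrite le_eqVlt; apply/orP; left; apply/eqP; rewrite /lam; ring.
have [xi [h1 h2 h3 h4]] := maximal_functional x_bnd lam0 y00 y01 he hlam.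
exists xi; split=> // L cmL; apply: le_trans (h4 _ _ _ _ cmL) _.
rewrite ler_expR.
have tE : llog (llog (v N)) = t ^+ 2 / 2 by rewrite itau_sqr; field.
rewrite tE.
have -> : lam * (x' * (s * t)) = kap * t ^+ 2.
  by rewrite /lam kapE; field; rewrite !gt_eqF.
have h5 : lam * \sum_(0 <= i < N) m i <= (kap - 1) / 8 * t ^+ 2.
  apply: le_trans (_ : lam * (eta * (s * t)) <= _); first by rewrite ler_pM2l.
  rewrite le_eqVlt; apply/orP; left; apply/eqP.
  by rewrite /lam /eta kapE; field; rewrite !gt_eqF.
have h6 : (1 + e) / 2 * lam ^+ 2 * \sum_(0 <= i < N) u i <=
    (1 + e) / 2 * (kap * t ^+ 2).
  apply: le_trans (_ : (1 + e) / 2 * lam ^+ 2 * (rho' * s ^+ 2) <= _).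
    rewrite ler_pM2l// mulr_gt0 ?exprn_gt0//; lra.
  rewrite le_eqVlt; apply/orP; left; apply/eqP.
  by rewrite /lam kapE; field; rewrite !gt_eqF.
have h7 : (1 + e) / 2 * (kap * t ^+ 2) = kap * t ^+ 2 / 2 + e * kap * t ^+ 2 / 2.
  by field.
move: h6; rewrite h7 eE; have := sqr_ge0 t; lra.
Unshelve. all: by end_near.
Qed.

End upper_half.

Let last_below (C : R) : 0 < C -> exists N, v N < C /\
  forall n, v n < C -> (n <= N)%N.
Proof.
move=> C0; have ex : exists n, C <= v n.
  by have [N hN] := near_ge (v_infty C); exists N; exact: hN.
case: (ex_minnP ex) => -[|N] hN mn; first by move: hN; rewrite v0; lra.
exists N; split.
  by rewrite ltNge; apply/negP => /mn; rewrite ltnn.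
move=> n hn; rewrite -ltnS ltnNge; apply/negP => /v_mono h.
by move: (le_trans hN h); rewrite leNgt hn.
Qed.

(** One functional per block [c ^ k <= v n < c ^ k.+1], placed at its last index [N]. There [lil]
    varies by a factor at most [c = x0 / x1], so reaching [x0 * lil (v n)] inside the block means
    reaching [x1 * lil (v N)]. Since [llog (v N) >= k * ln c], the bounds are terms of a convergent
    series. *)
Lemma upper_qnull (rho x0 : R) : 0 <= rho -> 0 < x0 -> rho < x0 ^+ 2 ->
  (forall rho', rho < rho' -> \forall N \near \oo,
    \sum_(0 <= i < N) u i <= rho' * v N) ->
  qnull x m l u [set w | forall N, exists2 n, (N <= n)%N & x0 * lil (v n) <= S n w].
Proof.
move=> rho0 x00 x0rho u_le eps eps0.
pose x1 : R := Num.sqrt ((rho + x0 ^+ 2) / 2).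
have x02 : 0 < x0 ^+ 2 by rewrite exprn_gt0.
have x12 : x1 ^+ 2 = (rho + x0 ^+ 2) / 2 by rewrite sqr_sqrtr//; lra.
have x10 : 0 < x1 by rewrite sqrtr_gt0; lra.
have x1x0 : x1 < x0.
  by rewrite -ltr_sqr ?nnegrE ?(ltW x10) ?(ltW x00)// x12; lra.
have x1rho : rho < x1 ^+ 2 by rewrite x12; lra.
pose c := x0 / x1.
have c1 : 1 < c by rewrite /c ltr_pdivlMr// mul1r.
have c0 : 0 < c by lra.
have [e e0 /near_ge[N1 hN1]] := upper_tail rho0 x10 x1rho u_le.
have lc : 0 < ln c by exact: ln_gt0.
have [k1 [k10 hk1]] := sum_riemann_tail lc e0 eps0.
have [k2 hk2] := exprn_unbounded (v N1) c1.
pose k0 := maxn k1 k2.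
pose ee k := expR (- ((1 + e) * ln (k%:R * ln c))).
have step k : (k0 <= k)%N -> exists xi : Omega -> R, [/\ exists i, past x i xi,
    forall w, 0 <= xi w,
    forall w n, c ^+ k <= v n < c ^+ k.+1 -> x0 * lil (v n) <= S n w -> 1 <= xi w &
    forall L, cond_moments x m l u L -> L xi <= ee k].
  move=> kk.
  have ck0 : 0 < c ^+ k by exact: exprn_gt0.
  have ckS : 0 < c ^+ k.+1 by exact: exprn_gt0.
  have [N [vN maxN]] := last_below ckS.
  have [ckN|Nck] := leP (c ^+ k) (v N); last first.
    (* No index falls in this block. *)
    exists (fun=> 0); split => //.
    - by exists 0%N; exact: past_cst.
    - by move=> w n /andP[h1 /maxN/v_mono h2]; move: Nck; lra.
    - move=> L cmL; rewrite (cm_cst cmL); exact: expR_ge0.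
  have N1N : (N1 <= N)%N.
    rewrite leqNgt; apply/negP => /ltnW/v_mono h.
    have : c ^+ k2 <= c ^+ k.
      by rewrite ler_eXn2l// (leq_trans _ kk)// leq_maxr.
    lra.
  have [xi [h1 h2 h3 h4]] := hN1 N N1N.
  exists xi; split=> //; first by exists N.
    move=> w n /andP[ckn /maxN nN] hS; apply: (h3 w n nN).
    apply: le_trans hS.
    have vn0 : 0 < v n by exact: lt_le_trans ckn.
    have := lil_ratio vn0 (v_mono nN).
    have : v N <= c * v n by move: vN; rewrite exprS; nra.
    move=> vNn h; have h' : v n * lil (v N) <= v n * (c * lil (v n)).
      apply: le_trans h _; rewrite mulrA [v n * c]mulrC ler_wpM2r//.
      exact: lil_ge0.
    move: h'; rewrite ler_pM2l// => h'.
    have -> : x0 = x1 * c by rewrite /c; field; rewrite gt_eqF.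
    by rewrite -mulrA ler_pM2l.
  move=> L cmL; apply: le_trans (h4 L cmL) _.
  have kpos : (0 < k)%N.
    by apply: leq_trans kk; apply: leq_trans k10 _; exact: leq_maxl.
  rewrite ler_expR lerN2 ler_pM2l; last lra.
  have klc : k%:R * ln c <= llog (v N).
    apply: le_trans (_ : ln (c ^+ k) <= _).
      by rewrite lnXn// mulr_natl.
    rewrite /llog ler_ln ?posrE//; first by rewrite le_max ckN orbT.
    by rewrite lt_max expR_gt0.
  apply: le_trans (_ : ln (llog (v N)) <= _).
    by rewrite ler_ln ?posrE ?llog_gt0// mulr_gt0// ltr0n.
  rewrite {2}/llog ler_ln ?posrE ?llog_gt0//; first by rewrite le_max lexx orbT.
  by rewrite lt_max expR_gt0.
have {}step k : exists xi : Omega -> R, [/\ exists i, past x i xi,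
    forall w, 0 <= xi w,
    forall w n, c ^+ (k0 + k) <= v n < c ^+ (k0 + k).+1 ->
       x0 * lil (v n) <= S n w -> 1 <= xi w &
    forall L, cond_moments x m l u L -> L xi <= ee (k0 + k)%N].
  by apply: step; exact: leq_addr.
have [xi hxi] := choice step.
exists xi, (fun k => ee (k0 + k)%N); split.
- by move=> n; case: (hxi n).
- by move=> n; case: (hxi n).
- by move=> n; split; [exact: expR_ge0|case: (hxi n)].
- move=> n; apply: le_trans (hk1 (k0 + n)%N).
  have hk : (k1 <= k0)%N by exact: leq_maxl.
  rewrite [leRHS](big_cat_nat hk (leq_addr _ _))/=.
  have -> : \sum_(0 <= i < n) ee (k0 + i)%N = \sum_(k0 <= i < k0 + n) ee i.
    rewrite -{2}[k0]add0n big_addn addKn.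
    by apply: eq_bigr => i _; rewrite addnC.
  by rewrite lerDr sumr_ge0// => i _; exact: expR_ge0.
- move=> w hw.
  have [N2 hN2] := near_ge (v_infty (Num.max 1 (c ^+ k0))).
  have [n N2n hS] := hw N2.
  have := hN2 n N2n; rewrite ge_max => /andP[v1 vk0].
  have [k /andP[k3 k4]] := exprn_window c1 v1.
  have kk : (k0 <= k)%N.
    by rewrite -ltnS -(ltr_eXn2l c1); exact: le_lt_trans k4.
  exists (k - k0)%N; have [_ _ h _] := hxi (k - k0)%N.
  by apply: (h w n) => //; rewrite subnKC// k3.
Qed.

Section lower_half.
Variables (rho x0 K : R).
Hypothesis x0_ge0 : 0 <= x0.
Hypothesis x0_rho : x0 ^+ 2 < rho.
Hypothesis K_ge0 : 0 <= K.
Hypothesis l_ge : forall rho', rho' < rho -> \forall N \near \oo,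
  rho' * v N <= \sum_(0 <= i < N) l i.
Hypothesis l_le : forall N, \sum_(0 <= i < N) l i <= v N.
Hypothesis v_jump : \forall n \near \oo, v n.+1 <= 2 * v n.
Hypothesis m_bnd : forall i (B : R), (forall w, `|x i w| <= B) -> m i <= 2 * B.

(** The parameters make the cost [(1 / 2 + 3 * d) * Lam] equal to the iterated logarithm of [v N]:
    [Lam = t ^ 2 / (1 + 6 * d)] and [(1 + d) * q = rr * v N] determine [lam = t / (s * z)]. The
    losses in [d] are absorbed by the gap between [x1 ^ 2] and [rr]. *)
Lemma lower_block_tail : exists x1 rr : R, [/\ x0 < x1, 0 < rr < rho &
  \forall N \near \oo, forall M, (M <= N)%N ->
  rr * v N <= \sum_(M <= i < N) l i ->
  exists g : Omega -> R, [/\ past x N g, forall w, 0 <= g w <= 1,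
    forall w, 0 < g w -> exists2 n, (M <= n <= N)%N &
      x1 * lil (v N) <= \sum_(M <= i < n) x i w &
    forall L, cond_moments x m l u L ->
      forall W, past x M W -> (forall w, 0 <= W w) ->
      2^-1 * expR (- llog (llog (v N))) * L W <= L (fun w => W w * g w)]].
Proof.
have [r0 x0r] := conj x0_ge0 x0_rho.
have x020 : 0 <= x0 ^+ 2 by exact: sqr_ge0.
pose rr : R := (x0 ^+ 2 + 2 * rho) / 3.
pose x1 : R := Num.sqrt ((2 * x0 ^+ 2 + rho) / 3).
have rr0 : 0 < rr by rewrite /rr; lra.
have rrrho : rr < rho by rewrite /rr; lra.
have x12 : x1 ^+ 2 = (2 * x0 ^+ 2 + rho) / 3 by rewrite sqr_sqrtr//; lra.
have x10 : 0 < x1 by rewrite sqrtr_gt0; lra.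
have x0x1 : x0 < x1.
  by rewrite -ltr_sqr ?nnegrE ?(ltW x10)// x12; lra.
have x1rr : x1 ^+ 2 < rr by rewrite x12 /rr; lra.
clearbody rr x1.
exists x1, rr; split; rewrite ?rr0 ?rrrho//.
pose th := x1 ^+ 2 / rr.
have th1 : th < 1 by rewrite /th ltr_pdivrMr// mul1r.
have th0 : 0 < th by rewrite divr_gt0// exprn_gt0.
have thE : x1 ^+ 2 = th * rr by rewrite /th divfK ?gt_eqF.
clearbody th.
(* [14] leaves room for [(1 - 14 * d) * (1 + d) * (1 + 6 * d) <= (1 - 3 * d) ^ 2], to which
   [x1 * s * t <= (1 - 3 * d) * lam * q] comes down. *)
pose d : R := (1 - th) / 14.
have d0 : 0 < d by rewrite /d; lra.
have d1 : d <= 1/10 by rewrite /d; lra.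
have dE : th = 1 - 14 * d by rewrite /d; field.
clearbody d.
have hd : 0 < d <= 1/10 by rewrite d0.
have d20 : 0 < d ^+ 2 by rewrite exprn_gt0.
pose e := d ^+ 2 / 20.
have e0 : 0 < e by rewrite divr_gt0.
have eE : e = d ^+ 2 / 20 by [].
clearbody e.
pose z2 : R := (1 + 6 * d) * (rr / (1 + d)).
have d10 : 0 < 1 + d by lra.
have d60 : 0 < 1 + 6 * d by lra.
have z20 : 0 < z2 by rewrite mulr_gt0// divr_gt0.
pose z : R := Num.sqrt z2.
have z0 : 0 < z by rewrite sqrtr_gt0.
have zE : z ^+ 2 = z2 by rewrite sqr_sqrtr// ltW.
clearbody z.
(* The first bound gives [lam * |x i| <= e / 32], the second [lam * m i <= 1 / 2] through
   [m_bnd]. *)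
pose eta : R := Num.min (e * z / 32) (z / 4).
have eta0 : 0 < eta by rewrite lt_min; apply/andP; split; rewrite divr_gt0// mulr_gt0.
pose eta2 := e * z / (1 + 6 * d).
have eta20 : 0 < eta2 by rewrite divr_gt0// mulr_gt0.
have [V hV] := itau_unbounded (10 * (1 + 6 * d) / d ^+ 2).
near=> N.
have vN : 0 < v N by near: N.
have ht : 10 * (1 + 6 * d) / d ^+ 2 <= itau (v N) ^+ 2.
  by apply: hV; near: N; exact: v_infty.
have hM : \sum_(0 <= i < N) m i <= eta2 * lil (v N) by near: N; exact: m_small.
have hB : forall i w, (i < N)%N -> itau (v N) * `|x i w| <= eta * Num.sqrt (v N).
  by near: N; exact: x_small.
move=> M MN hl.
have tE : llog (llog (v N)) = itau (v N) ^+ 2 / 2 by rewrite itau_sqr; field.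
rewrite tE /lil in hM *.
have t0 : 0 < itau (v N) by exact: itau_gt0.
have s0 : 0 < Num.sqrt (v N) by rewrite sqrtr_gt0.
have s2 : Num.sqrt (v N) ^+ 2 = v N by rewrite sqr_sqrtr// ltW.
move: (Num.sqrt (v N)) (itau (v N)) ht hM hB t0 s0 s2 {tE}.
move=> s t ht hM hB t0 s0 s2.
pose q := rr / (1 + d) * s ^+ 2.
have q0 : 0 < q by rewrite mulr_gt0 ?divr_gt0 ?exprn_gt0.
pose lam := t / (s * z).
have sz0 : 0 < s * z by rewrite mulr_gt0.
have lam0 : 0 < lam by rewrite divr_gt0.
have LamE : lam ^+ 2 * q = t ^+ 2 / (1 + 6 * d).
  rewrite /lam /q expr_div_n exprMn zE /z2; field.
  by rewrite !gt_eqF// exprn_gt0.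
have hL : 10 <= d ^+ 2 * (lam ^+ 2 * q).
  rewrite LamE mulrA ler_pdivlMr//; move: ht; rewrite ler_pdivrMr//; lra.
have hx i w : (M <= i < N)%N -> lam * `|x i w| <= e / 32.
  move=> /andP[_ iN]; have := hB i w iN.
  rewrite -(ler_pM2l (_ : 0 < (s * z)^-1)) ?invr_gt0// => h.
  rewrite /lam mulrAC mulrC; apply: le_trans h _.
  rewrite ler_pdivrMl//.
  apply: le_trans (_ : e * z / 32 * s <= _).
    by rewrite ler_pM2r// /eta ge_min lexx.
  by rewrite le_eqVlt; apply/orP; left; apply/eqP; ring.
have [g [h1 h2 h3 h4]] := block_functional x_bnd MN hd eE q0 lam0 hL hx.
exists g; split=> //.
- move=> w /h3 [n hn h]; exists n => //; apply: le_trans h.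
  have lqE : lam * q = s * t * (z / (1 + 6 * d)).
    rewrite /lam /q.
    have -> : rr / (1 + d) = z ^+ 2 / (1 + 6 * d).
      by rewrite zE /z2; field; rewrite !gt_eqF.
    by field; rewrite !gt_eqF.
  rewrite lqE [leLHS]mulrC [leRHS]mulrCA ler_pM2l ?mulr_gt0//.
  rewrite -ler_sqr ?nnegrE ?(ltW x10)//; last first.
    by rewrite mulr_ge0 ?divr_ge0 ?ltW//; lra.
  rewrite exprMn expr_div_n zE thE.
  have -> : z2 / (1 + 6 * d) ^+ 2 = rr / ((1 + d) * (1 + 6 * d)).
    by rewrite /z2; field; rewrite !gt_eqF.
  rewrite mulrCA [th * rr]mulrC ler_pM2l// ler_pdivlMr ?mulr_gt0// dE.
  by nra.
- move=> L cmL W hW W0.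
  have m0 i : 0 <= m i := cm_mean_ge0 cmL i.
  have := h4 m l u L cmL _ _ _ W hW W0.
  have -> : (1 / 2 + 3 * d) * (lam ^+ 2 * q) = t ^+ 2 / 2.
    by rewrite LamE; field; rewrite gt_eqF.
  apply.
  + rewrite LamE; apply: le_trans (_ : lam * (eta2 * (s * t)) <= _).
      rewrite ler_pM2l//; apply: le_trans hM.
      by rewrite [leRHS](big_cat_nat (leq0n M) MN)/= lerDr sumr_ge0.
    rewrite le_eqVlt; apply/orP; left; apply/eqP.
    by rewrite /lam /eta2; field; rewrite !gt_eqF.
  + move=> i /andP[_ iN].
    have mi : m i <= 2 * (eta * s / t).
      by apply: m_bnd => w; rewrite ler_pdivlMr// mulrC hB.
    apply: le_trans (_ : lam * (2 * (eta * s / t)) <= _); first by rewrite ler_pM2l.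
    apply: le_trans (_ : lam * (2 * (z / 4 * s / t)) <= _).
      by rewrite ler_pM2l// ler_pM2l// !ler_pM2r ?invr_gt0// /eta ge_min lexx orbT.
    rewrite le_eqVlt; apply/orP; left; apply/eqP.
    by rewrite /lam; field; rewrite !gt_eqF.
  + by rewrite /q s2 mulrA [(1 + d) * _]mulrC divfK ?gt_eqF.
Unshelve. all: by end_near.
Qed.

Let first_above (C : R) : exists N, C <= v N /\
  forall n, (n < N)%N -> v n < C.
Proof.
have ex : exists n, C <= v n.
  by have [N hN] := near_ge (v_infty C); exists N; exact: hN.
case: (ex_minnP ex) => N hN mn; exists N; split=> // n nN.
by rewrite ltNge; apply/negP => /mn; rewrite leqNgt nN.
Qed.

(* On each geometric block [g k] detects a large increment of the walk; the
   conditional mass of [g k] is of order [1 / k], so that the products of the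
   [1 - g k] tend to [0]. *)
Lemma lower_qnull : qnull x m l u
  [set w | exists N, forall n, (N <= n)%N ->
     S n w < x0 * lil (v n) /\ `|S n w| <= K * lil (v n)].
Proof.
move=> eps eps0.
have [r0 x0r k00] := And3 x0_ge0 x0_rho K_ge0.
have [x1 [rr [x0x1 /andP[rr0 rrrho] /near_ge[N1 hN1]]]] := lower_block_tail.
pose rho' := (rr + rho) / 2.
have rho'rho : rho' < rho by rewrite /rho'; lra.
have [N2 hN2] := near_ge (l_ge rho'rho).
have [N3 hN3] := near_ge v_jump.
pose del := rho' - rr.
have del0 : 0 < del by rewrite /del /rho'; lra.
pose gap := x1 - x0.
have gap0 : 0 < gap by rewrite subr_gt0.
(* The variance at the start of a block will be at most [2 / c] times that at its end. The term
   [2 / del] keeps enough lower variance inside the block, [2 * K ^ 2 / gap ^ 2] makes the walk at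
   its start at most [gap] times the final normalizer, and [3] makes the blocks nonempty. *)
pose c : R := 3 + 2 / del + 2 * K ^+ 2 / gap ^+ 2.
have gap20 : 0 < gap ^+ 2 by rewrite exprn_gt0.
have t1 : 0 < 2 / del by rewrite divr_gt0.
have t2 : 0 <= 2 * K ^+ 2 / gap ^+ 2.
  apply: divr_ge0; last exact: ltW.
  by apply: mulr_ge0 => //; exact: sqr_ge0.
have c3 : 3 <= c by rewrite /c; lra.
have c0 : 0 < c by lra.
have c1 : 1 < c by lra.
have cdel : 2 / c <= del.
  rewrite ler_pdivrMr// mulrC -ler_pdivrMr//; rewrite /c; lra.
have cK : K * Num.sqrt (2 / c) <= gap.
  rewrite -ler_sqr ?nnegrE ?mulr_ge0 ?sqrtr_ge0 ?(ltW gap0)// exprMn sqr_sqrtr ?divr_ge0 ?(ltW c0)//.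
  rewrite mulrA ler_pdivrMr// [leRHS]mulrC -ler_pdivrMr// mulrC /c; lra.
clearbody c.
have [nk hnk] := choice (fun k => first_above (c ^+ k)).
pose N0 := maxn N1 (maxn N2 N3).
have [k1 hk1] := exprn_unbounded (v N0.+1) c1.
have ck0 k : 0 < c ^+ k by exact: exprn_gt0.
have nk_low k : c ^+ k <= v (nk k) by case: (hnk k).
have nk_gt k : (k1 <= k)%N -> (N0.+1 < nk k)%N.
  move=> kk; rewrite ltnNge; apply/negP => /v_mono h.
  have := nk_low k; have : c ^+ k1 <= c ^+ k by rewrite ler_eXn2l.
  lra.
(* [nk k] is the first index where [v] reaches [c ^ k]; [v_jump] limits the overshoot to a factor
   [2]. *)
have nk_high k : (k1 <= k)%N -> v (nk k) <= 2 * c ^+ k.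
  move=> kk; have := nk_gt k kk; case: (hnk k); case: (nk k) => // n _ h hn.
  apply: le_trans (hN3 n _) _.
    by apply: leq_trans (_ : N0 <= n)%N; [rewrite /N0 !leq_max leqnn !orbT|rewrite -ltnS ltnW].
  by rewrite ler_pM2l// ltW// h.
have nk_lt k : (k1 <= k)%N -> (nk k < nk k.+1)%N.
  move=> kk; rewrite ltnNge; apply/negP => /v_mono h.
  have := nk_low k.+1; rewrite exprS; have := nk_high k kk; have := ck0 k; nra.
have nk_ratio k : (k1 <= k)%N -> v (nk k) <= 2 / c * v (nk k.+1).
  move=> kk; rewrite mulrAC ler_pdivlMr//; apply: le_trans (_ : 2 * c ^+ k * c <= _).
    by rewrite ler_pM2r// nk_high.
  by rewrite -mulrA -exprSr ler_pM2l.
(* [exp (- llog (llog (v N)))] is the inverse of the maximum of [e] and [llog (v N)], and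
   [v N <= 2 * c ^ k.+1] bounds that maximum by [k.+1 * (e + ln 2 + ln c)]. *)
pose C : R := 2^-1 / (expR 1 + ln 2 + ln c).
have lc : 0 < ln c by exact: ln_gt0.
have l2 : 0 < ln 2 :> R by apply: ln_gt0; lra.
have den0 : 0 < expR 1 + ln 2 + ln c by have := expR_gt0 (1 : R); lra.
have C0 : 0 < C by rewrite divr_gt0.
have block k : (k1 <= k)%N -> exists g : Omega -> R, [/\ past x (nk k.+1) g,
    forall w, 0 <= g w <= 1,
    forall w, 0 < g w -> exists2 n, (nk k <= n <= nk k.+1)%N &
      x1 * lil (v (nk k.+1)) <= \sum_(nk k <= i < n) x i w &
    forall L, cond_moments x m l u L ->
      forall W, past x (nk k) W -> (forall w, 0 <= W w) ->
      C / k.+1%:R * L W <= L (fun w => W w * g w)].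
  move=> kk; have MN := ltnW (nk_lt k kk).
  have kk1 : (k1 <= k.+1)%N by exact: leqW.
  have N0N := nk_gt _ kk1.
  set M := nk k in MN *; set N := nk k.+1 in MN N0N *.
  have vN0 : 0 < v N by apply: lt_le_trans (nk_low k.+1).
  have hl : rr * v N <= \sum_(M <= i < N) l i.
    have h2 : rho' * v N <= \sum_(0 <= i < N) l i.
      apply: hN2; apply: leq_trans (ltnW (ltnW N0N)).
      by rewrite /N0 !leq_max leqnn orbT.
    have vM : v M <= del * v N.
      apply: le_trans (_ : 2 / c * v N <= _); last by rewrite ler_pM2r.
      exact: nk_ratio.
    move: h2; rewrite (big_cat_nat (leq0n M) MN)/=.
    have := l_le M; move: vM; rewrite /del; lra.
  have N1N : (N1 <= N)%N.
    by apply: leq_trans (ltnW (ltnW N0N)); rewrite /N0 !leq_max leqnn.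
  have [g [h1 h2 h3 h4]] := hN1 N N1N M MN hl.
  exists g; split=> // L cmL W hW W0; apply: le_trans (h4 L cmL W hW W0).
  rewrite ler_wpM2r ?(cm_ge0 cmL hW W0)// /C -!mulrA ler_pM2l// -invfM.
  rewrite expRN lef_pV2 ?posrE ?expR_gt0 ?mulr_gt0 ?ltr0n//.
  rewrite {1}/llog lnK ?posrE; last by rewrite lt_max expR_gt0.
  have hk : 1 <= k.+1%:R :> R by rewrite ler1n.
  have hll : llog (v N) <= expR 1 + ln 2 + k.+1%:R * ln c.
    have := expR_ge1Dx (1 : R) => he1.
    rewrite /llog; have [hv|hv] := leP (v N) (expR 1).
      by rewrite expRK; have := mulr_gt0 (lt_le_trans ltr01 hk) lc; lra.
    apply: le_trans (_ : ln (2 * c ^+ k.+1) <= _).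
      by rewrite ler_ln ?posrE ?mulr_gt0 ?ck0// nk_high.
    by rewrite lnM ?posrE ?ck0// lnXn// mulr_natl; lra.
  have e1 := expR_gt0 (1 : R).
  rewrite ge_max; apply/andP; split; first nra.
  apply: le_trans hll _; nra.
have {}block k : exists g : Omega -> R, (k1 <= k)%N -> [/\ past x (nk k.+1) g,
    forall w, 0 <= g w <= 1,
    forall w, 0 < g w -> exists2 n, (nk k <= n <= nk k.+1)%N &
      x1 * lil (v (nk k.+1)) <= \sum_(nk k <= i < n) x i w &
    forall L, cond_moments x m l u L ->
      forall W, past x (nk k) W -> (forall w, 0 <= W w) ->
      C / k.+1%:R * L W <= L (fun w => W w * g w)].
  have [kk|kk] := leqP k1 k; last by exists (fun=> 0).
  by have [g hg] := block k kk; exists g.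
have [g hg] := choice block.
(* [P j n] is [1] where none of the blocks [j, ..., n - 1] detects anything. The block from which
   nothing is detected is unknown, so one product is used for each [j], stopped when its integral
   falls below [eps / 2 ^ j.+1]. *)
pose P j n w : R := \prod_(j <= k < n) (1 - g k w).
have hP j n L : (k1 <= j)%N -> (j <= n)%N ->
    [/\ past x (nk n) (P j n), forall w, 0 <= P j n w &
      cond_moments x m l u L ->
      L (P j n) <= expR (- (C * \sum_(j <= k < n) k.+1%:R^-1))].
  move=> kj /subnKC <-; elim: (n - j)%N => [|i [ih1 ih2 ih3]].
    rewrite addn0; split.
    - rewrite (_ : P j j = fun=> 1); first exact: past_cst.
      by apply/funext => w; rewrite /P big_geq.
    - by move=> w; rewrite /P big_geq.
    - move=> cmL; rewrite (_ : P j j = fun=> 1).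
        by rewrite (cm_one cmL) big_geq// mulr0 oppr0 expR0.
      by apply/funext => w; rewrite /P big_geq.
  have kji : (k1 <= j + i)%N by exact: leq_trans (leq_addr _ _).
  have [g1 g2 g3 g4] := hg _ kji.
  have nkS : (nk (j + i) <= nk (j + i).+1)%N by exact/ltnW/nk_lt.
  have PE : P j (j + i.+1)%N = fun w => P j (j + i)%N w - P j (j + i)%N w * g (j + i)%N w.
    by apply/funext => w; rewrite /P addnS big_nat_recr ?leq_addr//= mulrBr mulr1.
  have p1 : past x (nk (j + i).+1) (P j (j + i)%N) by exact: past_widen ih1.
  have p2 := past_mul p1 g1.
  rewrite PE addnS; split.
  - exact: past_sub.
  - move=> w; rewrite subr_ge0 ler_piMr ?ih2//.
    by have /andP[] := g2 w.
  - move=> cmL; rewrite (cm_sub cmL p1 p2) big_nat_recr ?leq_addr//= mulrDr opprD expRD.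
    have LP0 := cm_ge0 cmL ih1 ih2.
    apply: le_trans (_ : (1 - C / (j + i).+1%:R) * L (P j (j + i)%N) <= _).
      by rewrite mulrBl mul1r lerD2l lerN2 g4.
    apply: le_trans (_ : expR (- (C / (j + i).+1%:R)) * L (P j (j + i)%N) <= _).
      by rewrite ler_wpM2r//; exact: expR_ge1Dx.
    by rewrite mulrC ler_wpM2r ?expR_ge0// ih3.
have stop j : exists n, (j <= n)%N /\
    expR (- (C * \sum_(j <= k < n) k.+1%:R^-1)) <= eps / 2 ^+ j.+1.
  have ej : 0 < eps / 2 ^+ j.+1 by rewrite divr_gt0// exprn_gt0.
  have [n hn] := sum_harmonic_unbounded (Num.max 1 (- ln (eps / 2 ^+ j.+1) / C)) j.
  exists n; split.
    by rewrite leqNgt; apply/negP => nj; move: hn; rewrite big_geq ?(ltnW nj)// ge_max; lra.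
  rewrite -[leRHS]lnK ?posrE// ler_expR lerNl.
  rewrite -ler_pdivrMl// [leLHS]mulrC; apply: le_trans hn.
  by rewrite le_max lexx orbT.
have [nn hnn] := choice stop.
exists (fun j => P (k1 + j)%N (nn (k1 + j)%N)), (fun j => eps / 2 ^+ (k1 + j).+1).
have hk j : (k1 <= k1 + j)%N by exact: leq_addr.
split.
(* The clauses of [hP] extracted here do not mention its functional; the zero one fills the
   argument. *)
- move=> j; exists (nk (nn (k1 + j)%N)).
  by have [] := hP _ _ (fun=> 0) (hk j) (proj1 (hnn _)).
- move=> j; by have [] := hP _ _ (fun=> 0) (hk j) (proj1 (hnn _)).
- move=> j; split=> [|L cmL]; first by rewrite divr_ge0 ?exprn_ge0// ltW.
  have [_ _ /(_ cmL) h] := hP _ _ L (hk j) (proj1 (hnn _)).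
  exact: le_trans h (proj2 (hnn _)).
- move=> n; apply: le_trans (@sum_geometric_half _ eps n (ltW eps0)).
  apply: ler_sum => i _; rewrite ler_pM2l// lef_pV2 ?posrE ?exprn_gt0//.
  by rewrite ler_eXn2l ?ltr1n// ltnS leq_addl.
- move=> w [N hN].
  have [k2 hk2] := exprn_unbounded (v N) c1.
  exists k2; rewrite /P big_nat_cond big1// => k /andP[/andP[kk _] _].
  have kk1 : (k1 <= k)%N by exact: leq_trans kk.
  have [g1 g2 g3 g4] := hg _ kk1.
  have /andP[gw0 _] := g2 w.
  (* A detected increment is at least [x1 * lil] at the end of the block, and the walk at its start
     is at least [- (x1 - x0) * lil] there; the walk would then reach [x0 * lil (v n)], against
     [hN]. *)
  suff : ~ 0 < g k w.
    move=> /negP; rewrite -leNgt => gw.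
    have -> : g k w = 0 by apply/eqP; rewrite eq_le gw.
    by rewrite subr0.
  move=> /g3[n /andP[nM nN] hn].
  have NM : (N <= nk k)%N.
    rewrite leqNgt; apply/negP => /ltnW/v_mono h.
    have := nk_low k; have : c ^+ k2 <= c ^+ k.
      by rewrite ler_eXn2l// (leq_trans _ kk)// leq_addl.
    lra.
  have [_ hSM] := hN _ NM.
  have [hSn _] := hN n (leq_trans NM nM).
  have SE : S n w = S (nk k) w + \sum_(nk k <= i < n) x i w.
    by rewrite (big_cat_nat (leq0n _) nM).
  have lilM : K * lil (v (nk k)) <= gap * lil (v (nk k.+1)).
    apply: le_trans (_ : K * (Num.sqrt (2 / c) * lil (v (nk k.+1))) <= _); last first.
      by rewrite mulrA ler_wpM2r ?lil_ge0.
    rewrite ler_wpM2l// /lil mulrA -sqrtrM ?divr_ge0 ?(ltW c0)//.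
    have vv := nk_ratio _ kk1.
    rewrite ler_pM ?sqrtr_ge0// ?ler_wsqrtr//.
    by rewrite ler_pM2l// !ler_llog// v_mono// ltnW// nk_lt.
  have : x0 * lil (v n) <= x0 * lil (v (nk k.+1)).
    by rewrite ler_wpM2l//; apply: ler_lil; exact: v_mono.
  move: hSM; rewrite ler_norml => /andP[hSM _].
  move: hSn hn hSM lilM; rewrite SE /gap.
  lra.
Qed.

End lower_half.

End lil_halves.

(** * Cluster sets of real sequences *)

Section cluster_sets.
Context {R : realType}.
Implicit Types (z : nat -> R) (b l : R).

Lemma cluster_setP z l : cluster_set z l <->
  forall e : R, 0 < e -> forall N, exists2 n, (N <= n)%N & `|z n - l| < e.
Proof.
split=> [[nk nk_mono znk] e e0 N|h].
  have /cvgrPdist_lt /(_ e e0)[k0 _ hk] := znk.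
  have nk_ge k : (k <= nk k)%N.
    by elim: k => // k ih; apply: leq_ltn_trans ih (nk_mono _ _ _).
  exists (nk (maxn N k0)).
    by apply: leq_trans (nk_ge _); exact: leq_maxl.
  by rewrite distrC; apply: hk; exact: leq_maxr.
have h' (p : nat * nat) : exists n, (p.2 <= n)%N /\ `|z n - l| < p.1.+1%:R^-1.
  have [|n h1 h2] := h (p.1.+1%:R^-1) _ p.2; first by rewrite invr_gt0 ltr0n.
  by exists n.
have [f hf] := choice h'.
pose fix nk k := if k is k'.+1 then f (k, (nk k').+1) else f (0%N, 0%N).
have nkS k : (nk k < nk k.+1)%N by have [] := hf (k.+1, (nk k).+1).
exists nk; first by apply: homo_ltn => //; exact: ltn_trans.
have nk_close k : `|z (nk k) - l| < k.+1%:R^-1.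
  by case: k => [|k]; [have [] := hf (0%N, 0%N)|have [] := hf (k.+1, (nk k).+1)].
apply/cvgrPdist_lt => e e0.
have /cvgrPdist_lt /(_ e e0) := @cvg_harmonic R.
apply: filterS => k; rewrite sub0r normrN ger0_norm ?invr_ge0 ?ler0n// => hk.
by rewrite distrC; exact: lt_trans (nk_close k) hk.
Qed.

(** Bolzano-Weierstrass: [F] is the filter of the tails of the visits to [[a, c]], which has a
    cluster point in that compact segment. *)
Lemma cluster_set_segment z (a c : R) :
  (forall N, exists2 n, (N <= n)%N & a <= z n <= c) ->
  exists2 l, cluster_set z l & a <= l <= c.
Proof.
move=> io.
pose F : set_system R := [set P | exists N, forall n, (N <= n)%N -> a <= z n <= c -> P (z n)].
have FF : ProperFilter F.
  apply: Build_ProperFilter_ex.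
    move=> P [N hN]; have [n Nn hn] := io N.
    by exists (z n); exact: hN.
  split.
  - by exists 0%N.
  - move=> P Q [N hN] [M hM]; exists (maxn N M) => n; rewrite geq_max => /andP[Nn Mn] hn.
    by split; [exact: hN|exact: hM].
  - by move=> P Q PQ [N hN]; exists N => n Nn hn; apply/PQ/hN.
have := @segment_compact R a c F FF.
case.
  by exists 0%N => n _; rewrite /= in_itv.
move=> l [lac cl]; exists l; last by move: lac; rewrite /= in_itv.
apply/cluster_setP => e e0 N.
have [||y [[n Nn zn] hy]] := cl [set y | exists2 n, (N <= n)%N & z n = y] (ball l e).
- by exists N => n Nn _; exists n.
- exact: nbhsx_ballx.
by exists n => //; rewrite zn distrC.
Qed.

Lemma cluster_set_bounded z b x : cluster_set z = [set` `[- b, b]] -> b < x ->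
  (exists N, forall n, (N <= n)%N -> z n <= 2) ->
  exists N, forall n, (N <= n)%N -> z n < x.
Proof.
move=> hz bx [N hN]; apply: contrapT => hn.
have io M : exists2 n, (M <= n)%N & x <= z n <= 2.
  apply: contrapT => hM; apply: hn; exists (maxn N M) => n.
  rewrite geq_max => /andP[Nn Mn]; rewrite ltNge; apply/negP => xz.
  by apply: hM; exists n => //; rewrite xz hN.
have [l] := cluster_set_segment io.
by rewrite {}hz /= in_itv /= => /andP[_ lb] /andP[xl _]; lra.
Qed.

Let crossing z (c : R) n k : c < z n -> z (n + k)%N <= c ->
  exists2 i, (n <= i)%N & c < z i /\ z i.+1 <= c.
Proof.
elim: k => [|k ih] h1 h2; first by move: h2; rewrite addn0; lra.
have [hk|hk] := leP (z (n + k)%N) c; first exact: ih.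
by exists (n + k)%N; [exact: leq_addr|rewrite -addnS].
Qed.

Lemma cluster_set_interval z b :
  (forall x, b < x -> exists N, forall n, (N <= n)%N -> z n < x) ->
  (forall x, b < x -> exists N, forall n, (N <= n)%N -> - z n < x) ->
  (forall x, x < b -> forall N, exists2 n, (N <= n)%N & x <= z n) ->
  (forall x, x < b -> forall N, exists2 n, (N <= n)%N & x <= - z n) ->
  (forall e : R, 0 < e -> exists N, forall n, (N <= n)%N -> `|z n.+1 - z n| < e) ->
  cluster_set z = [set` `[- b, b]].
Proof.
move=> up1 up2 low1 low2 step; apply/seteqP; split => l.
  move=> /cluster_setP hl; rewrite /= in_itv /=; apply/andP; split.
    rewrite leNgt; apply/negP => lb.
    have [|N hN] := up2 ((b - l) / 2); first lra.
    have [|n Nn] := hl ((- l - b) / 2) _ N; first lra.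
    by have := hN n Nn; rewrite ltr_norml => h /andP[? ?]; lra.
  rewrite leNgt; apply/negP => lb.
  have [|N hN] := up1 ((b + l) / 2); first lra.
  have [|n Nn] := hl ((l - b) / 2) _ N; first lra.
  by have := hN n Nn; rewrite ltr_norml => h /andP[? ?]; lra.
rewrite /= in_itv /= => /andP[bl lb]; apply/cluster_setP => e e0 N.
have [N' hN'] := step e e0.
have [|n1 hn1 z1] := low1 (l - e / 2) _ (maxn N N'); first lra.
have [|n2 hn2 z2] := low2 (- l - e / 2) _ n1; first lra.
have Nn1 : (N <= n1)%N by apply: leq_trans hn1; exact: leq_maxl.
have [h|h] := leP (z n1) (l + e / 2).
  by exists n1 => //; rewrite ltr_norml; apply/andP; split; lra.
have [|i ni [h1 h2]] := @crossing z (l + e / 2) n1 (n2 - n1) h.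
  by rewrite subnKC//; lra.
have N'i : (N' <= i)%N.
  by apply: leq_trans ni; apply: leq_trans hn1; exact: leq_maxr.
exists i.+1; first by rewrite leqW// (leq_trans Nn1).
have := hN' i N'i; rewrite !ltr_norml => /andP[h3 h4].
by apply/andP; split; lra.
Qed.

(** A countable form, for measurability. Rational points suffice because limit points are stable
    under limits. The ceiling [p] accounts for escapes to infinity: outside [[- b, b]] only the
    visits to compact segments have to stop. *)
Lemma cluster_set_intervalP z b : 0 <= b ->
  cluster_set z = [set` `[- b, b]] <->
  [/\ forall q : rat, `|ratr q : R| <= b ->
        forall k N, exists2 n, (N <= n)%N & `|z n - ratr q| < k.+1%:R^-1,
      forall p, exists N, forall n, (N <= n)%N -> ~ (b + p.+1%:R^-1 <= z n <= p%:R) &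
      forall p, exists N, forall n, (N <= n)%N -> ~ (b + p.+1%:R^-1 <= - z n <= p%:R)].
Proof.
move=> b0.
have inv0 p : 0 < p.+1%:R^-1 :> R by rewrite invr_gt0 ltr0n.
split=> [hz|[h1 h2 h3]].
  split=> [q qb k N|p|p].
  - have : cluster_set z (ratr q) by rewrite {}hz /= in_itv /= -ler_norml.
    by move=> /cluster_setP; apply.
  - apply: contrapT => hn.
    have [N|l] := @cluster_set_segment z (b + p.+1%:R^-1) p%:R.
      apply: contrapT => hN; apply: hn; exists N => n Nn h.
      by apply: hN; exists n.
    rewrite {}hz /= in_itv /= => /andP[_ lb] /andP[bl _].
    by move: (inv0 p) bl; move: (p.+1%:R^-1 : R) => y; lra.
  - apply: contrapT => hn.
    have [N|l] := @cluster_set_segment z (- p%:R) (- (b + p.+1%:R^-1)).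
      apply: contrapT => hN; apply: hn; exists N => n Nn h.
      by apply: hN; exists n => //; rewrite lerNl lerNr andbC.
    rewrite {}hz /= in_itv /= => /andP[lb _] /andP[_ bl].
    by move: (inv0 p) bl {hn}; move: (p.+1%:R^-1 : R) => y; lra.
have outside (y : nat -> R) l : cluster_set y l -> b < l ->
    (forall p, exists N, forall n, (N <= n)%N -> ~ (b + p.+1%:R^-1 <= y n <= p%:R)) ->
    False.
  move=> /cluster_setP hl bl h.
  have lb0 : 0 < (l - b) / 2 by lra.
  pose p := (Num.truncn (Num.max ((l - b) / 2)^-1 (l + (l - b) / 2))).+1.
  have : Num.max ((l - b) / 2)^-1 (l + (l - b) / 2) < p%:R by exact: Num.Theory.truncnS_gt.
  rewrite gt_max => /andP[p1 p2].
  have p3 : p.+1%:R^-1 < (l - b) / 2.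
    rewrite -[ltRHS]invrK ltf_pV2 ?posrE ?invr_gt0 ?ltr0n//.
    by apply: lt_trans p1 _; rewrite ltr_nat.
  have [N hN] := h p.
  have [n Nn] := hl _ lb0 N.
  rewrite ltr_norml => /andP[? ?]; apply: (hN n Nn).
  move: p3 p2; move: (p.+1%:R^-1 : R) (p%:R : R) => a a' ? ?.
  by apply/andP; split; lra.
apply/seteqP; split => l.
  move=> hl; rewrite /= in_itv /=; apply/andP; split; rewrite leNgt; apply/negP => lb.
    apply: (outside (fun n => - z n) (- l)) => //; last lra.
    apply/cluster_setP => e e0 N; move/cluster_setP : hl => /(_ e e0 N)[n Nn hn].
    by exists n => //; rewrite -opprD normrN.
  exact: (outside z l).
rewrite /= in_itv /= => /andP[bl lb]; apply/cluster_setP => e e0 N.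
have [q qb ql] : exists2 q : rat, `|ratr q : R| <= b & `|ratr q - l| < e / 2.
  have [b1|b1] := eqVneq b 0.
    exists 0; rewrite raddf0 ?normr0// sub0r normrN.
    by rewrite (_ : l = 0) ?normr0; lra.
  have bpos : 0 < b by rewrite lt_neqAle eq_sym b1.
  have [|q] := @rat_in_itvoo R (Num.max (- b) (l - e / 2)) (Num.min b (l + e / 2)).
    by rewrite gt_max !lt_min; apply/andP; split; apply/andP; split; lra.
  rewrite in_itv /= gt_max lt_min => /andP[/andP[q1 q2] /andP[q3 q4]].
  exists q; first by rewrite ler_norml !ltW.
  by rewrite ltr_norml; apply/andP; split; lra.
have [k hk] : exists k, k.+1%:R^-1 < e / 2.
  exists (Num.truncn (e / 2)^-1).
  rewrite -[ltRHS]invrK ltf_pV2 ?posrE ?invr_gt0 ?ltr0n ?divr_gt0//.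
  exact: Num.Theory.truncnS_gt.
have [n Nn hn] := h1 q qb k N; exists n => //.
rewrite -(subrK (ratr q) (z n)) -addrA; apply: le_lt_trans (ler_normD _ _) _.
move: hk hn; move: (k.+1%:R^-1 : R) => y; lra.
Qed.

End cluster_sets.

(** * The function space and integration against one measure *)

Section function_spaces.
Context {R : realType} {d : measure_display} {Omega : measurableType d}.
Variables (H : set (Omega -> R)) (hH : function_space H).

Lemma C_bLip_C_lLip n (phi : 'rV[R]_n -> R) : C_bLip phi -> C_lLip phi.
Proof.
move=> /C_bLip_pos[K [K0 _ lK]]; exists (K + 1), 0%N; split; first lra.
move=> z t; apply: le_trans (lK z t) _; rewrite ler_wpM2r ?enorm_ge0// !expr0.
lra.
Qed.

Lemma fs_lip f (g : R -> R) (K : R) : H f ->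
  (forall a b, `|g a - g b| <= K * `|a - b|) -> H (fun w => g (f w)).
Proof.
move=> Hf gK.
have := @fs_comp _ _ _ _ hH 1%N (fun=> f) (fun z => g (z ord0 ord0)) isT (fun=> Hf).
rewrite (_ : (fun w => g ((\row_i f w) ord0 ord0)) = (fun w => g (f w))).
  apply; exists (`|K| + 1), 0%N; split; first by rewrite ltr_wpDl.
  move=> y z; apply: le_trans (gK _ _) _; rewrite !expr0.
  have := @coord_le_enorm R 1 (y - z) ord0; rewrite !mxE => h.
  apply: (@le_trans _ _ (`|K| * enorm (y - z))).
    by rewrite ler_pM ?normr_ge0 ?ler_norm//; move: (gK 1 0); rewrite subr0 normr1 mulr1; apply: le_trans.
  rewrite ler_wpM2r ?enorm_ge0//; have := normr_ge0 K; lra.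
by apply/funext => w; rewrite mxE.
Qed.

Lemma fs_cst c : H (fun=> c).
Proof.
apply: (@fs_lip (fun=> 0) (fun=> c) 0 (fs_zero hH)) => a b.
by rewrite subrr normr0 mul0r.
Qed.

Lemma fs_sum (g : nat -> Omega -> R) n : (forall i, H (g i)) ->
  H (fun w => \sum_(0 <= i < n) g i w).
Proof.
move=> Hg; elim: n => [|n ih].
  rewrite (_ : (fun w => _) = fun=> 0); first exact: fs_zero.
  by apply/funext => w; rewrite big_geq.
rewrite (_ : (fun w => _) = fun w => \sum_(0 <= i < n) g i w + g n w).
  exact: fs_add.
by apply/funext => w; rewrite big_nat_recr.
Qed.

Lemma past_bounded_part (x : nat -> Omega -> R) i f :
  (forall i, H (x i)) -> past x i f -> bounded_part H f.
Proof.
move=> Hx pf; split; last exact: past_bounded pf.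
(* [fs_comp] requires a positive dimension; in dimension [0] the functional is constant. *)
case: i pf => [|i] [phi hphi ->].
  rewrite (_ : (fun w => _) = fun=> phi 0); first exact: fs_cst.
  by apply/funext => w; congr phi; apply/rowP => -[].
by apply: (@fs_comp _ _ _ _ hH i.+1 (fun j => x j)) => //; exact: C_bLip_C_lLip.
Qed.

Lemma bounded_part_cst c : bounded_part H (fun=> c).
Proof. by split; [exact: fs_cst|exists `|c|]. Qed.

Lemma bounded_part_add f g : bounded_part H f -> bounded_part H g ->
  bounded_part H (fun w => f w + g w).
Proof.
move=> [Hf [M hM]] [Hg [N hN]]; split; first exact: fs_add.
by exists (M + N) => w; apply: le_trans (ler_normD _ _) _; exact: lerD.
Qed.

Lemma bounded_part_scale c f : bounded_part H f -> bounded_part H (fun w => c * f w).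
Proof.
move=> [Hf [M hM]]; split; first exact: fs_scale.
by exists (`|c| * M) => w; rewrite normrM ler_wpM2l.
Qed.

Lemma measurable_sigma_space f : H f ->
  measurable_fun setT (f : sigma_space H -> R).
Proof.
move=> Hf _ Y mY; apply: sub_sigma_algebra; exists f => //.
by exists Y.
Qed.

Section integral.
Variable P : probability (sigma_space H) R.

Let PT : P setT = 1%E. Proof. exact: probability_setT. Qed.

Definition Lint (f : Omega -> R) : R := fine (P_expectation P f).

Lemma integrable_bounded_part f : bounded_part H f ->
  P.-integrable setT (EFin \o (f : sigma_space H -> R)).
Proof.
move=> [Hf [M hM]]; apply: measurable_bounded_integrable => //.
- exact: (le_lt_trans (probability_le1 P measurableT) (ltry 1)).
- exact: measurable_sigma_space.
- exists M; split; first exact: num_real.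
  by move=> y My w _; apply: le_trans (hM w) (ltW My).
Qed.

Lemma LintE f : bounded_part H f -> P_expectation P f = (Lint f)%:E.
Proof.
by move=> hf; rewrite fineK//; apply: integrable_fin_num => //; exact: integrable_bounded_part.
Qed.

Lemma Lint_add f g : bounded_part H f -> bounded_part H g ->
  Lint (fun w => f w + g w) = Lint f + Lint g.
Proof.
by move=> hf hg; apply: (@RintegralD _ _ _ P setT f g) => //; exact: integrable_bounded_part.
Qed.

Lemma Lint_scale c f : bounded_part H f -> Lint (fun w => c * f w) = c * Lint f.
Proof.
by move=> hf; apply: (@RintegralZl _ _ _ P setT f c) => //; exact: integrable_bounded_part.
Qed.

Lemma Lint_ge0 f : (forall w, 0 <= f w) -> 0 <= Lint f.
Proof. by move=> f0; apply: (@Rintegral_ge0 _ _ _ P setT f) => w _. Qed.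

Lemma Lint_cst c : Lint (fun=> c) = c.
Proof.
have := @Rintegral_cst _ _ _ P setT measurableT c.
by rewrite /Lint /P_expectation /Rintegral => ->; rewrite [X in fine X](_ : _ = 1%E) ?mulr1.
Qed.

Lemma Lint_mono f g : bounded_part H f -> bounded_part H g ->
  (forall w, f w <= g w) -> Lint f <= Lint g.
Proof.
by move=> hf hg fg; apply: (@le_Rintegral _ _ _ P setT f g) => //;
  exact: integrable_bounded_part.
Qed.

Lemma Lint_markov f : bounded_part H f -> (forall w, 0 <= f w) ->
  (P [set w | (1 <= f w)%R] <= (Lint f)%:E)%E.
Proof.
move=> hf f0; have mA : measurable ([set w | 1 <= f w] : set (sigma_space H)).
  rewrite -[X in measurable X]setTI.
  have := measurable_sigma_space hf.1 measurableT (measurable_itv `[1, +oo[).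
  by congr measurable; apply/seteqP; split => w [_]; rewrite /= in_itv /= andbT.
rewrite -LintE//.
have := @integral_indic _ _ _ P setT measurableT _ mA; rewrite setIT => <-.
apply: ge0_le_integral => //.
- exact/measurable_EFinP/measurable_indic.
- by apply/measurable_EFinP; exact: measurable_sigma_space hf.1.
- move=> w _; rewrite lee_fin indicE; have [|] := boolP (w \in _); last by [].
  by rewrite inE.
Qed.

End integral.

End function_spaces.

(** * From the sub-linear expectation to the measures of the family *)

Section sublinear_interface.
Context {R : realType} {d : measure_display} {Omega : measurableType d}.
Variables (H : set (Omega -> R)) (E : (Omega -> R) -> \bar R).
Variable Pfam : set (probability (sigma_space H) R).
Hypothesis hH : function_space H.
Hypothesis hE : sublinear_expectation H E.
Hypothesis hCC : condition_CC E Pfam.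

Lemma E_fin f : bounded_part H f -> E f = (fine (E f))%:E.
Proof.
move=> [Hf [M hM]]; rewrite fineK// fin_real//; apply/andP; split.
  apply: (@lt_le_trans _ _ (- M)%:E); first exact: ltNyr.
  rewrite -(sl_cst hE (- M)); apply: (sl_mono hE) => //; first exact: fs_cst.
  by move=> w; move: (hM w); rewrite ler_norml => /andP[].
apply: (@le_lt_trans _ _ M%:E); last exact: ltry.
rewrite -(sl_cst hE M); apply: (sl_mono hE) => //; first exact: fs_cst.
by move=> w; move: (hM w); rewrite ler_norml => /andP[].
Qed.

Lemma Lint_le_E P f : Pfam P -> bounded_part H f -> Lint P f <= fine (E f).
Proof.
move=> PP hf; rewrite -lee_fin -E_fin// -LintE// hCC.1//.
by apply: ereal_sup_ubound; exists P.
Qed.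

Lemma E_le_Lint f c : bounded_part H f -> (forall P, Pfam P -> Lint P f <= c) ->
  (E f <= c%:E)%E.
Proof.
move=> hf h; rewrite hCC.1//; apply: ge_ereal_sup => _ [P PP <-].
by rewrite LintE// lee_fin h.
Qed.

Lemma Pfam_nonempty : exists P, Pfam P.
Proof.
apply: contrapT => h.
have : (E (fun=> 0%R) <= (-1)%R%:E)%E.
  by apply: E_le_Lint => [|P PP]; [exact: bounded_part_cst|case: h; exists P].
by rewrite (sl_cst hE) lee_fin; lra.
Qed.

(** Sub-additivity used with [c], then with [- c]. *)
Lemma E_addc f c : bounded_part H f ->
  fine (E (fun w => f w + c)) = fine (E f) + c.
Proof.
move=> hf.
have hc a := bounded_part_cst hH a; have hfc := bounded_part_add hH hf (hc c).
have add g a : bounded_part H g -> fine (E (fun w => g w + a)) <= fine (E g) + a.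
  move=> hg; rewrite -lee_fin -E_fin; last exact: bounded_part_add.
  rewrite EFinD -E_fin// -(sl_cst hE a).
  apply: (sl_subadd hE) => //; [exact: hg.1|exact: fs_cst|].
  by rewrite (sl_cst hE) E_fin.
apply/le_anti; rewrite add//= -lerBrDr.
have := add _ (- c) hfc; rewrite (_ : (fun w => f w + c + - c) = f)//.
by apply/funext => w; rewrite addrK.
Qed.

Variable x : nat -> Omega -> R.
Hypothesis Hx : forall i, bounded_part H (x i).
Hypothesis x_ind : forall i, (0 < i)%N ->
  independent_to E (fun w => \row_(j < 1) x i w) (fun w => \row_(j < i) x j w).

Let x_bnd i : exists M : R, forall w, `|x i w| <= M.
Proof. by case: (Hx i). Qed.

Let pb i f : past x i f -> bounded_part H f.
Proof. by apply: past_bounded_part => // j; case: (Hx j). Qed.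

Let fx_past i (f : R -> R) : locally_lipschitz f -> past x i.+1 (fun w => f (x i w)).
Proof. by move=> hf; apply: past_comp => //; exact: past_var. Qed.

(** Independence for the test function [phi + psi * f], with [f] taken at the clamped last
    coordinate so that the product is bounded and Lipschitz. *)
Lemma E_independent i (f : R -> R) G W : (0 < i)%N ->
  locally_lipschitz f -> past x i G -> past x i W ->
  E (fun w => G w + W w * f (x i w)) =
  E (fun w => fine (E (fun w' => G w + W w * f (x i w')))).
Proof.
move=> i0 hf [phi hphi ->] [psi hpsi ->].
have [M hM] := x_bnd i.
pose j0 : 'I_(i + 1) := rshift i ord0.
pose cl (z : 'rV[R]_(i + 1)) := Num.max (- `|M|) (Num.min `|M| (z ord0 j0)).
have := x_ind i0 (phi := fun z : 'rV_(i + 1) =>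
   phi (lsubmx z) + psi (lsubmx z) * f (cl z)).
have clE (a : 'rV[R]_i) w : cl (row_mx a (\row_(j < 1) x i w)) = x i w.
  rewrite /cl row_mxEr mxE clamp_id//.
  by apply: le_trans (hM w) _; exact: ler_norm.
rewrite (_ : (fun w => phi (lsubmx _) + _) =
   (fun w => phi (\row_j x j w) + psi (\row_j x j w) * f (x i w))); last first.
  by apply/funext => w; rewrite row_mxKl clE.
rewrite (_ : (fun w => fine (E (fun w' => phi (lsubmx _) + _))) =
   (fun w => fine (E (fun w' => phi (\row_j x j w) + psi (\row_j x j w) * f (x i w'))))).
  apply; apply: C_bLip_add; first exact: C_bLip_lsubmx.
  apply: C_bLip_mul; first exact: C_bLip_lsubmx.
  by apply: C_bLip_comp => //; exact: C_bLip_clamp.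
apply/funext => w; congr (fine (E _)); apply/funext => w'.
by rewrite row_mxKl clE.
Qed.

(** What independence under [E] gives for a single [P]. With [c = E (f (x i))], independence and
    homogeneity yield [E (W * (f (x i) - c)) = 0], because the inner expectation is [W * (c - c)],
    and [Lint P] lies below [E]. For [i = 0] the weight is a constant and [Lint P <= E] is
    enough. *)
Lemma Lint_cond_le P i (f : R -> R) W : Pfam P -> locally_lipschitz f ->
  past x i W -> (forall w, 0 <= W w) ->
  Lint P (fun w => W w * f (x i w)) <= fine (E (fun w => f (x i w))) * Lint P W.
Proof.
move=> PP hf pW W0; set c := fine _.
have pW' := pastS pW; have pf := fx_past i hf.
have hWf := pb (past_mul pW' pf).
have hfc : bounded_part H (fun w => f (x i w)) := pb pf.
have [i0|i0] := posnP i.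
  have [k kW] : exists k, W = fun=> k.
    move: pW; rewrite i0 => -[phi _ ->]; exists (phi 0).
    by apply/funext => w; congr phi; apply/rowP => -[].
  rewrite kW Lint_scale// Lint_cst mulrC ler_wpM2r//; last exact: Lint_le_E.
  have [w _] : exists w : Omega, True by exists point.
  by have := W0 w; rewrite kW.
rewrite -subr_le0 -(Lint_scale P c (pb pW)).
rewrite (_ : Lint P _ - _ = Lint P (fun w => W w * (f (x i w) - c))); last first.
  rewrite (_ : (fun w => W w * (f (x i w) - c)) =
     (fun w => W w * f (x i w) + (- 1) * (c * W w))); last first.
    by apply/funext => w; ring.
  have hcW : bounded_part H (fun w => c * W w) by apply: bounded_part_scale => //; exact: pb pW.
  by rewrite (Lint_add P hWf (bounded_part_scale hH (- 1) hcW)) (Lint_scale P (- 1) hcW) mulN1r.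
have pfc : locally_lipschitz (fun y => f y - c).
  by move=> M; have [K hK] := hf M; exists K => a b aM bM; rewrite opprB addrA subrK hK.
have hWfc : bounded_part H (fun w => W w * (f (x i w) - c)).
  exact: pb (past_mul pW' (fx_past i pfc)).
apply: le_trans (Lint_le_E PP hWfc) _.
have := E_independent i0 pfc (past_cst x i 0) pW.
rewrite (_ : (fun w => 0 + W w * _) = (fun w => W w * (f (x i w) - c))); last first.
  by apply/funext => w; rewrite add0r.
move=> ->.
rewrite (_ : (fun w => fine _) = fun=> 0); first by rewrite (sl_cst hE).
apply/funext => w.
rewrite (_ : (fun w' => 0 + W w * _) = (fun w' => W w * (f (x i w') - c))); last first.
  by apply/funext => w'; rewrite add0r.
rewrite (sl_homo hE) ?W0//; last exact: (pb (fx_past i pfc)).1.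
rewrite (_ : E _ = 0%E) ?mule0//.
by rewrite (E_fin (pb (fx_past i pfc))) E_addc// subrr.
Qed.

(** Once the past is frozen, [G] is a constant and passes through [E]. Iterated, it makes [E]
    additive on sums of functions of single variables, which lets one measure be nearly extremal for
    all of them. *)
Lemma E_add_independent i (f : R -> R) G : locally_lipschitz f -> past x i G ->
  fine (E (fun w => G w + f (x i w))) = fine (E G) + fine (E (fun w => f (x i w))).
Proof.
move=> hf pG; have hfb := pb (fx_past i hf).
have [i0|i0] := posnP i.
  have [k ->] : exists k, G = fun=> k.
    move: pG; rewrite i0 => -[phi _ ->]; exists (phi 0).
    by apply/funext => w; congr phi; apply/rowP => -[].
  rewrite (sl_cst hE) /= addrC -E_addc//; congr (fine (E _)).
  by apply/funext => w; rewrite addrC.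
have := E_independent i0 hf pG (past_cst x i 1).
rewrite (_ : (fun w => G w + 1 * _) = (fun w => G w + f (x i w))); last first.
  by apply/funext => w; rewrite mul1r.
move=> ->; rewrite -(E_addc _ (pb pG)); congr (fine (E _)); apply/funext => w.
rewrite addrC -E_addc//; congr (fine (E _)); apply/funext => w'.
by rewrite mul1r addrC.
Qed.

Definition mean_bound i : R :=
  `|fine (E (x i))| + `|fine (conj_expectation E (x i))|.
Definition upper_var i : R := fine (E (fun w => x i w ^+ 2)).
Definition lower_var i : R := fine (conj_expectation E (fun w => x i w ^+ 2)).

Let lip_sqr : locally_lipschitz (fun y : R => y ^+ 2).
Proof.
move=> M; exists (M + M) => a b aM bM; rewrite subr_sqr normrM mulrC ler_wpM2r//.
by apply: le_trans (ler_normD _ _) _; exact: lerD.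
Qed.

Let lip_opp (f : R -> R) : locally_lipschitz f -> locally_lipschitz (fun y => - f y).
Proof.
by move=> hf M; have [K hK] := hf M; exists K => a b aM bM; rewrite -opprD normrN hK.
Qed.

Let lip_id : locally_lipschitz (fun y : R => y).
Proof. by move=> M; exists 1 => a b _ _; rewrite mul1r. Qed.

Lemma fine_conj f : fine (conj_expectation E f) = - fine (E (fun w => - f w)).
Proof. by rewrite /conj_expectation fineN. Qed.

(** [Lint_cond_le] for [y], [- y], [y ^ 2] and [- y ^ 2]. *)
Lemma cond_moments_Lint P : Pfam P ->
  cond_moments x mean_bound lower_var upper_var (Lint P).
Proof.
move=> PP; split.
- by move=> i f g pf pg; exact: (Lint_add P (pb pf) (pb pg)).
- by move=> i c f pf; exact: (Lint_scale P c (pb pf)).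
- by move=> i f _; exact: Lint_ge0.
- exact: Lint_cst.
- by move=> i; rewrite addr_ge0.
- move=> i f pf f0; have Lf0 : 0 <= Lint P f by exact: Lint_ge0.
  have hfx : bounded_part H (fun w => f w * x i w).
    by apply: pb; apply: past_mul (pastS pf) _; exact: past_var.
  have h1 := Lint_cond_le PP lip_id pf f0.
  have := Lint_cond_le PP (lip_opp lip_id) pf f0.
  rewrite (_ : (fun w => f w * - x i w) = (fun w => (-1) * (f w * x i w))); last first.
    by apply/funext => w; ring.
  rewrite Lint_scale// mulN1r => h2.
  rewrite ler_norml; apply/andP; split.
    rewrite lerNl; apply: le_trans h2 _; rewrite ler_wpM2r// /mean_bound fine_conj normrN.
    by apply: le_trans (ler_norm _) _; rewrite lerDr.
  apply: le_trans h1 _; rewrite ler_wpM2r// /mean_bound.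
  by apply: le_trans (ler_norm _) _; rewrite lerDl.
- move=> i f pf f0.
  have hfx : bounded_part H (fun w => f w * x i w ^+ 2).
    apply: pb; apply: past_mul (pastS pf) _.
    by apply: past_exprn; exact: past_var.
  have h1 := Lint_cond_le PP lip_sqr pf f0.
  have := Lint_cond_le PP (lip_opp lip_sqr) pf f0.
  rewrite (_ : (fun w => f w * - x i w ^+ 2) = (fun w => (-1) * (f w * x i w ^+ 2))); last first.
    by apply/funext => w; ring.
  rewrite Lint_scale// mulN1r => h2.
  rewrite h1 andbT /lower_var fine_conj mulNr lerNl.
  exact: h2.
Qed.

(* Maximising [E (\sum +- x_i^2)] forces the second moments to be extremal;
   weak compactness passes to all [i] at once. *)
Lemma exists_extremal_measure (up : nat -> bool) : exists2 P, Pfam P &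
  forall i, Lint P (fun w => x i w ^+ 2) = if up i then upper_var i else lower_var i.
Proof.
pose sg i : R := if up i then 1 else -1.
pose f i (y : R) := sg i * y ^+ 2.
have hf i : locally_lipschitz (f i).
  rewrite /f /sg; case: (up i).
    by move=> M; have [K hK] := lip_sqr M; exists K => a b; rewrite !mul1r; exact: hK.
  by move=> M; have [K hK] := lip_opp lip_sqr M; exists K => a b; rewrite !mulN1r; exact: hK.
pose c i := fine (E (fun w => f i (x i w))).
have hfb i : bounded_part H (fun w => f i (x i w)) by exact: pb (fx_past i (hf i)).
pose G n w := \sum_(0 <= i < n) f i (x i w).
have pG n : past x n (G n).
  apply: past_sum => i /andP[_ iN]; apply: (@past_widen _ _ _ i.+1) => //.
  exact: fx_past.
have EG n : fine (E (G n)) = \sum_(0 <= i < n) c i.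
  elim: n => [|n ih].
    rewrite (_ : G 0%N = fun=> 0) ?(sl_cst hE) ?big_geq//.
    by apply/funext => w; rewrite /G big_geq.
  rewrite (_ : G n.+1 = (fun w => G n w + f n (x n w))); last first.
    by apply/funext => w; rewrite /G big_nat_recr.
  by rewrite E_add_independent// ih big_nat_recr.
have LG (P : probability (sigma_space H) R) n : Lint P (G n) = \sum_(0 <= i < n) Lint P (fun w => f i (x i w)).
  elim: n => [|n ih].
    rewrite (_ : G 0%N = fun=> 0) ?Lint_cst ?big_geq//.
    by apply/funext => w; rewrite /G big_geq.
  rewrite (_ : G n.+1 = (fun w => G n w + f n (x n w))); last first.
    by apply/funext => w; rewrite /G big_nat_recr.
  by rewrite (Lint_add P (pb (pG n)) (hfb n)) ih big_nat_recr.
(* Each term falls short of its maximum [c i] by a nonnegative amount, and these amounts add up to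
   at most [1 / n.+1]; so each of them is that small. *)
have step n : exists P, Pfam P /\ forall i, (i < n)%N ->
    c i - n.+1%:R^-1 <= Lint P (fun w => f i (x i w)) <= c i.
  have n0 : 0 < n.+1%:R^-1 :> R by rewrite invr_gt0 ltr0n.
  have [P [PP hP]] : exists P, Pfam P /\ \sum_(0 <= i < n) c i - n.+1%:R^-1 <= Lint P (G n).
    apply: contrapT => h.
    have : (E (G n) <= (\sum_(0 <= i < n) c i - n.+1%:R^-1)%:E)%E.
      apply: E_le_Lint => [|P PP]; first exact: pb.
      by rewrite leNgt; apply/negP => /ltW h'; apply: h; exists P.
    rewrite (E_fin (pb (pG n))) lee_fin EG.
    by move: n0 {h}; move: (n.+1%:R^-1 : R) => y; lra.
  exists P; split=> // i iN; have hle j : Lint P (fun w => f j (x j w)) <= c j.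
    exact: Lint_le_E.
  have D1 (F : nat -> R) : \sum_(0 <= j < n) F j = F i + \sum_(0 <= j < n | j != i) F j.
    by rewrite (bigD1_seq i)//= ?mem_index_iota ?iota_uniq.
  rewrite hle andbT; move: hP; rewrite LG !D1.
  have : \sum_(0 <= j < n | j != i) Lint P (fun w => f j (x j w)) <=
     \sum_(0 <= j < n | j != i) c j by apply: ler_sum => j _; exact: hle.
  clear; move: (\sum_(0 <= j < n | j != i) c j) (n.+1%:R^-1 : R) (c i).
  move: (\sum_(0 <= j < n | j != i) Lint P (fun w => f j (x j w))).
  move: (Lint P (fun w => f i (x i w))) => a b y z t; lra.
have [Pn hPn] := choice step.
have [nk [P [nk_mono PP hP]]] := hCC.2 x Pn Hx (fun n => (hPn n).1).
exists P => // i; have {}hP : P_expectation (Pn (nk k)) (fun w => f i (x i w)) @[k --> \oo]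
    --> P_expectation P (fun w => f i (x i w)).
  have [M hM] := x_bnd i.
  pose cl (z : 'rV[R]_i.+1) := Num.max (- `|M|) (Num.min `|M| (z ord0 ord_max)).
  have clE w : cl (\row_(j < i.+1) x j w) = x i w.
    rewrite /cl mxE clamp_id//.
    by apply: le_trans (hM w) _; exact: ler_norm.
  have := hP i.+1 (fun z => f i (cl z)) isT _.
  rewrite (_ : (fun w => f i (cl _)) = (fun w => f i (x i w))).
    by apply; apply: C_bLip_comp => //; exact: C_bLip_clamp.
  by apply/funext => w; rewrite clE.
have Pc : Lint P (fun w => f i (x i w)) = c i.
  have nk_ge k : (k <= nk k)%N.
    by elim: k => // k ih; apply: leq_ltn_trans ih (nk_mono _ _ _).
  have cv1 : Lint (Pn (nk k)) (fun w => f i (x i w)) @[k --> \oo]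
      --> Lint P (fun w => f i (x i w)).
    apply: fine_cvg; rewrite -LintE//; exact: hP.
  have cv2 : Lint (Pn (nk k)) (fun w => f i (x i w)) @[k --> \oo] --> c i.
    apply/cvgrPdist_lt => e e0.
    have /cvgrPdist_lt /(_ e e0) := @cvg_harmonic R.
    move=> [N _ hN]; exists (maxn N i.+1) => // k /=; rewrite geq_max => /andP[Nk ik].
    have := (hPn (nk k)).2 i (leq_trans ik (nk_ge k)).
    have := hN k Nk; rewrite /= sub0r normrN ger0_norm ?invr_ge0 ?ler0n// => hk.
    have : (nk k).+1%:R^-1 <= k.+1%:R^-1 :> R.
      by rewrite lef_pV2 ?posrE ?ltr0n// ler_nat ltnS.
    move: hk; move: (k.+1%:R^-1 : R) ((nk k).+1%:R^-1 : R) => a b ae ba /andP[h1 h2].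
    by rewrite ger0_norm; lra.
  exact: (cvg_unique _ cv1 cv2).
move: Pc; rewrite /c /f /sg /upper_var /lower_var fine_conj.
have hsq : bounded_part H (fun w => x i w ^+ 2) := pb (fx_past i lip_sqr).
case: (up i).
  rewrite (_ : (fun w => 1 * x i w ^+ 2) = (fun w => x i w ^+ 2))//.
  by apply/funext => w; rewrite mul1r.
rewrite Lint_scale// mulN1r => /eqP; rewrite eqr_oppLR => /eqP ->.
by congr (- fine (E _)); apply/funext => w; rewrite mulN1r.
Qed.

(** The one-sided bounds for the complementary weights [f] and [|M| - f] add up to [|M|] times the
    second moment, which is extremal; hence both are equalities. *)
Lemma cond_moments_extremal P (up : nat -> bool) : Pfam P ->
  (forall i, Lint P (fun w => x i w ^+ 2) = if up i then upper_var i else lower_var i) ->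
  let v' i := if up i then upper_var i else lower_var i in
  cond_moments x mean_bound v' v' (Lint P).
Proof.
move=> PP hP v'; have [c1 c2 c3 c4 c5 c6 c7] := cond_moments_Lint PP.
split=> // i f pf f0.
have [M hM] := past_bounded pf.
have pM : past x i (fun w => `|M| - f w) by apply: past_sub => //; exact: past_cst.
have M0 w : 0 <= `|M| - f w.
  rewrite subr_ge0; apply: le_trans (ler_norm _) _; apply: le_trans (hM w) _.
  exact: ler_norm.
have psq := fx_past i lip_sqr.
have LM : Lint P (fun w => `|M| - f w) = `|M| - Lint P f.
  rewrite (_ : (fun w => _) = (fun w => `|M| + (-1) * f w)); last first.
    by apply/funext => w; rewrite mulN1r.
  rewrite Lint_add ?Lint_cst ?Lint_scale ?mulN1r//; first exact: (pb pf).
    exact: bounded_part_cst.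
  by apply: bounded_part_scale => //; exact: (pb pf).
have LMx : Lint P (fun w => (`|M| - f w) * x i w ^+ 2) =
    `|M| * v' i - Lint P (fun w => f w * x i w ^+ 2).
  rewrite (_ : (fun w => _) = (fun w => `|M| * x i w ^+ 2 + (-1) * (f w * x i w ^+ 2))); last first.
    by apply/funext => w; ring.
  have hq : bounded_part H (fun w => f w * x i w ^+ 2) by exact: pb (past_mul (pastS pf) psq).
  rewrite Lint_add; [|exact: bounded_part_scale (pb psq)|exact: bounded_part_scale hq].
  by rewrite !Lint_scale// ?hP ?mulN1r//; exact: pb psq.
have := c7 i f pf f0; have := c7 i _ pM M0; rewrite LM LMx /v'.
by case: (up i) => /andP[h1 h2] /andP[h3 h4]; apply/andP; split; lra.
Qed.

End sublinear_interface.

(** * Comparison of the capacities and null sets *)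

Section capacity_bounds.
Context {R : realType} {d : measure_display} {Omega : measurableType d}.
Variables (H : set (Omega -> R)) (E : (Omega -> R) -> \bar R).
Variable Pfam : set (probability (sigma_space H) R).
Hypothesis hH : function_space H.
Hypothesis hE : sublinear_expectation H E.
Hypothesis hCC : condition_CC E Pfam.

Let E_ge0 f : H f -> (forall w, 0 <= f w) -> (0 <= E f)%E.
Proof.
by move=> Hf f0; rewrite -[leLHS](sl_cst hE 0); apply: (sl_mono hE) => //; exact: fs_zero.
Qed.

Lemma V_hat_ge0 A : (0 <= V_hat H E A)%E.
Proof.
apply: le_ereal_inf_tmp => _ [xi [Hxi h] <-]; apply: E_ge0 => // w.
by apply: le_trans (h w); rewrite indicE ler0n.
Qed.

Lemma V_hat_star_ge0 A : (0 <= V_hat_star H E A)%E.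
Proof.
apply: le_ereal_inf_tmp => _ [B _ <-].
by apply: nneseries_ge0 => n _ _; exact: V_hat_ge0.
Qed.

Let partial_nd (g : nat -> Omega -> R) : (forall n, H (g n) /\ forall w, 0 <= g n w) ->
  {homo (fun n => E (fun w => \sum_(0 <= i < n) g i w)) : m n / (m <= n)%N >-> (m <= n)%E}.
Proof.
move=> hg m n mn; apply: (sl_mono hE).
- by apply: fs_sum => // i; case: (hg i).
- by apply: fs_sum => // i; case: (hg i).
- move=> w; rewrite [leRHS](big_cat_nat (leq0n m) mn)/= lerDl sumr_ge0// => i _.
  by case: (hg i).
Qed.

Lemma C_star_ge0 A : (0 <= C_star H E A)%E.
Proof.
apply: le_ereal_inf_tmp => _ [g [hg _] <-]; apply: lime_ge.
  by apply: ereal_nondecreasing_is_cvgn => m n; exact: partial_nd.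
apply: nearW => n; apply: E_ge0; first by apply: fs_sum => // i; case: (hg i).
by move=> w; apply: sumr_ge0 => i _; case: (hg i).
Qed.

Lemma V_hat_star_le1 A : (V_hat_star H E A <= 1)%E.
Proof.
pose B n : set Omega := if n is 0%N then setT else set0.
apply: (@le_trans _ _ (\sum_(0 <= n <oo) V_hat H E (B n))%E).
  apply: ereal_inf_lbound; exists B => //; split.
    by case=> [|n]; [exact: measurableT|exact: measurable0].
  by move=> w _; exists 0%N.
apply: lime_le.
  by apply: is_cvg_nneseries => n _ _; exact: V_hat_ge0.
apply: nearW => -[|n]; first by rewrite big_geq// lee01.
rewrite big_nat_recl//= big1 ?adde0.
  rewrite -(sl_cst hE 1); apply: ereal_inf_lbound; exists (fun=> 1) => //.
  split; first exact: fs_cst.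
  by move=> w; rewrite indicE; case: (_ \in _); rewrite ?lexx ?ler01.
move=> i _; apply/le_anti; rewrite V_hat_ge0 andbT -[leRHS](sl_cst hE 0).
apply: ereal_inf_lbound; exists (fun=> 0) => //.
by split; [exact: fs_zero|move=> w; rewrite indicE in_set0].
Qed.

Lemma E_sum_le (xi : nat -> Omega -> R) (e : nat -> \bar R) n :
  (forall i, H (xi i) /\ forall w, 0 <= xi i w) ->
  (forall i, (E (xi i) <= e i)%E) ->
  (E (fun w => (\sum_(0 <= i < n) xi i w)%R) <= \sum_(0 <= i < n) e i)%E.
Proof.
move=> hxi hle; elim: n => [|n ih].
  rewrite (_ : (fun w => _) = fun=> 0%R) ?(sl_cst hE) ?big_geq//.
  by apply/funext => w; rewrite big_geq.
rewrite (_ : (fun w => _) = fun w => (\sum_(0 <= i < n) xi i w + xi n w)%R); last first.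
  by apply/funext => w; rewrite big_nat_recr.
have HS : H (fun w => \sum_(0 <= i < n) xi i w).
  by apply: fs_sum => // i; case: (hxi i).
have [Hn n0] := hxi n.
rewrite big_nat_recr//=; apply: le_trans (leeD ih (hle n)).
apply: (sl_subadd hE) => //; apply: ge0_adde_def; rewrite inE; apply: E_ge0 => // w.
by apply: sumr_ge0 => i _; case: (hxi i).
Qed.

(** Functions nearly optimal for the sets of a cover, with errors [e / 2 ^ n.+1], form an admissible
    series, whose partial sums are bounded by sub-additivity. *)
Lemma C_star_le_V_hat_star A : (C_star H E A <= V_hat_star H E A)%E.
Proof.
apply: le_ereal_inf_tmp => _ [B [mB AB] <-].
have V1 n : (V_hat H E (B n) <= 1)%E.
  rewrite -(sl_cst hE 1); apply: ereal_inf_lbound; exists (fun=> 1) => //.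
  split; first exact: fs_cst.
  by move=> w; rewrite indicE; case: (_ \in _); rewrite ?lexx ?ler01.
apply/lee_addgt0Pr => e e0.
have hxi n : exists xi : Omega -> R, [/\ H xi, forall w, \1_(B n) w <= xi w &
    (E xi <= V_hat H E (B n) + (e / 2 ^+ n.+1)%:E)%E].
  have e20 : 0 < e / 2 ^+ n.+1 by rewrite divr_gt0// exprn_gt0.
  have Vfin : V_hat H E (B n) \is a fin_num.
    rewrite ge0_fin_numE ?V_hat_ge0//.
    by apply: le_lt_trans (V1 n) _; exact: ltry.
  have [_ [xi [Hxi h] <-] hlt] := lb_ereal_inf_adherent e20 Vfin.
  by exists xi; split=> //; exact: ltW.
have [xi {}hxi] := choice hxi.
have hx n : H (xi n) /\ forall w, 0 <= xi n w.
  have [h1 h2 _] := hxi n; split=> // w; apply: le_trans (h2 w).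
  by rewrite indicE ler0n.
apply: (@le_trans _ _ (limn (fun n => E (fun w => \sum_(0 <= i < n) xi i w)%R))).
  apply: ereal_inf_lbound; exists xi => //; split => // w.
  have [wA|wA] := boolP (w \in A); last first.
    rewrite indicE (negbTE wA); apply: nneseries_ge0 => n _ _.
    by rewrite lee_fin; case: (hx n).
  have [n _ wn] := AB w (set_mem wA).
  apply: le_trans (_ : _ <= (xi n w)%:E)%E _.
    have [_ h _] := hxi n; rewrite lee_fin; apply: le_trans (h w).
    by rewrite !indicE wA mem_set.
  apply: le_trans (_ : _ <= \sum_(0 <= i < n.+1) (xi i w)%:E)%E _.
    rewrite big_nat_recr//= leeDr// sume_ge0// => i _.
    by rewrite lee_fin; case: (hx i).
  by apply: nneseries_lim_ge => i _ _; rewrite lee_fin; case: (hx i).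
apply: lime_le; first by apply: ereal_nondecreasing_is_cvgn => m n; exact: partial_nd.
apply: nearW => n; apply: le_trans (_ : _ <= \sum_(0 <= i < n)
   (V_hat H E (B i) + (e / 2 ^+ i.+1)%:E))%E _.
  by apply: E_sum_le => // i; have [] := hxi i.
rewrite big_split/=; apply: leeD.
  by apply: nneseries_lim_ge => i _ _; exact: V_hat_ge0.
by rewrite sumEFin lee_fin; apply: sum_geometric_half; exact: ltW.
Qed.

Let fs_min1 f : H f -> H (fun w => Num.min 1 (f w)).
Proof.
move=> Hf; apply: (@fs_lip _ _ _ _ hH f (fun y => Num.min 1 y) 1) => // a b.
rewrite mul1r /Num.min; do 2 case: ifPn; rewrite ?ltNge ?negbK => *.
- by rewrite subrr normr0.
- by rewrite ler_norml; case: (ger0P (a - b)) => ?; apply/andP; split; lra.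
- by rewrite ler_norml; case: (ger0P (a - b)) => ?; apply/andP; split; lra.
- by [].
Qed.

(** (CC) compares [E] with [P] on bounded functions only, so the partial sums are truncated at [1].
    The truncated limit is still at least [1] on [A], and monotone convergence gives [P A] as a
    lower bound. *)
Lemma C_star_ge1 (P : probability (sigma_space H) R) (A : set Omega) : Pfam P ->
  measurable (A : set (sigma_space H)) -> P A = 1%E -> (1 <= C_star H E A)%E.
Proof.
move=> PP mA PA; apply: le_ereal_inf_tmp => _ [g [hg Ag] <-].
pose h n w := Num.min 1 (\sum_(0 <= i < n) g i w).
have Hs n : H (fun w => \sum_(0 <= i < n) g i w) by apply: fs_sum => // i; case: (hg i).
have s0 n w : 0 <= \sum_(0 <= i < n) g i w by apply: sumr_ge0 => i _; case: (hg i).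
have h0 n w : 0 <= h n w by rewrite le_min ler01 s0.
have h1 n w : h n w <= 1 by rewrite ge_min lexx.
have hb n : bounded_part H (h n).
  split; first exact: fs_min1.
  by exists 1 => w; rewrite ger0_norm.
have hE' n : (\int[P]_w (h n w)%:E <= E (fun w => (\sum_(0 <= i < n) g i w)%R))%E.
  apply: (@le_trans _ _ (E (h n))).
    have := Lint_le_E hH hE hCC PP (hb n).
    by rewrite -lee_fin -(E_fin hH hE (hb n)) -LintE.
  apply: (sl_mono hE) => //; first exact: (hb n).1.
  by move=> w; rewrite ge_min lexx orbT.
have hnd w : {homo (fun n => (h n w)%:E) : m n / (m <= n)%N >-> (m <= n)%E}.
  move=> m n mn; rewrite lee_fin /h le_min ge_min lexx /= ge_min; apply/orP; right.
  by rewrite [leRHS](big_cat_nat (leq0n m) mn)/= lerDl sumr_ge0// => i _; case: (hg i).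
have mh n : measurable_fun setT (fun w : sigma_space H => (h n w)%:E).
  by apply/measurable_EFinP; exact: measurable_sigma_space (hb n).1.
have cvh := @cvg_monotone_convergence _ _ _ P setT measurableT
  (fun n (w : sigma_space H) => (h n w)%:E) mh
  (fun n w _ => h0 n w) (fun w _ => hnd w).
have lim_int : (1 <= \int[P]_w (limn (fun n => (h n w)%:E)))%E.
  rewrite -PA -[A]setIT -(@integral_indic _ _ _ P setT measurableT A mA).
  apply: ge0_le_integral => //.
  - exact/measurable_EFinP/measurable_indic.
  - apply: (emeasurable_fun_cvg (fun n (w : sigma_space H) => (h n w)%:E)) => //.
    by move=> w _; exact: ereal_nondecreasing_is_cvgn.
  - move=> w _; rewrite indicE; have [wA|wA] := boolP (w \in A); last first.
      apply: lime_ge; first exact: ereal_nondecreasing_is_cvgn.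
      by apply: nearW => n; rewrite lee_fin.
    have := Ag w; rewrite indicE wA /= mulr1n => Agw.
    apply/lee_subgt0Pr => e e0.
    have e1 : ((1 - e)%:E < \sum_(0 <= n <oo) (g n w)%:E)%E.
      by apply: lt_le_trans Agw; rewrite lte_fin; lra.
    have [n hn] : exists n, 1 - e <= \sum_(0 <= i < n) g i w.
      apply: contrapT => hn.
      suff : (\sum_(0 <= n <oo) (g n w)%:E <= (1 - e)%:E)%E by rewrite leNgt e1.
      apply: lime_le.
        by apply: is_cvg_nneseries => i _ _; rewrite lee_fin; case: (hg i).
      apply: nearW => n; rewrite sumEFin lee_fin leNgt; apply/negP => hlt.
      by apply: hn; exists n; exact: ltW.
    apply: (@le_trans _ _ (h n w)%:E).
      by rewrite -EFinB lee_fin /h le_min hn andbT; lra.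
    apply: lime_ge; first exact: ereal_nondecreasing_is_cvgn.
    by exists n => // k /=; exact: hnd.
apply: le_trans lim_int _; rewrite -(cvg_lim _ cvh)//; apply: lee_lim.
- by apply/cvg_ex; eexists; exact: cvh.
- by apply: ereal_nondecreasing_is_cvgn => m n; exact: partial_nd.
- exact: nearW.
Qed.

Section null_events.
Variables (x : nat -> Omega -> R) (m l u : nat -> R).
Hypothesis Hx : forall i, H (x i).

Let pb i f : past x i f -> bounded_part H f.
Proof. exact: past_bounded_part. Qed.

(** [xi n] dominates the indicator of [{xi n >= 1}], and by (CC) a bound common to all [P] is a
    bound for [E (xi n)]. *)
Lemma qnull_V_hat_star A :
  (forall P, Pfam P -> cond_moments x m l u (Lint P)) -> qnull x m l u A ->
  V_hat_star H E A = 0%E.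
Proof.
move=> hP hA; apply/le_anti; rewrite V_hat_star_ge0 andbT.
apply/lee_addgt0Pr => e e0; rewrite add0e.
have [xi [ee [h1 h2 h3 h4 h5]]] := hA e e0.
have hb n : bounded_part H (xi n) by have [i /pb] := h1 n.
have Ee n : (E (xi n) <= (ee n)%:E)%E.
  by apply: (E_le_Lint hCC) => // P /hP; have [_] := h3 n; apply.
pose B n := [set w | 1 <= xi n w].
apply: (@le_trans _ _ (\sum_(0 <= n <oo) V_hat H E (B n))%E).
  apply: ereal_inf_lbound; exists B => //; split.
    move=> n; rewrite -[X in measurable X]setTI.
    have := fs_measurable hH (hb n).1 measurableT (measurable_itv `[1, +oo[).
    by congr measurable; apply/seteqP; split => w [_]; rewrite /= in_itv /= andbT.
  by move=> w /h5[n hn]; exists n.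
apply: lime_le; first by apply: is_cvg_nneseries => n _ _; exact: V_hat_ge0.
apply: nearW => n; apply: le_trans (_ : _ <= \sum_(0 <= i < n) (ee i)%:E)%E _.
  apply: lee_sum => i _; apply: le_trans (Ee i).
  apply: ereal_inf_lbound; exists (xi i) => //; split; first exact: (hb i).1.
  move=> w; rewrite indicE; have [|_] := boolP (w \in _); last exact: h2.
  by rewrite inE.
by rewrite sumEFin lee_fin.
Qed.

(** Markov's inequality for each [xi n]; [A] is not assumed measurable, but the intersection of its
    covers of mass at most [1 / k.+1] is measurable and null. *)
Lemma qnull_negligible (P : probability (sigma_space H) R) A :
  cond_moments x m l u (Lint P) -> qnull x m l u A -> P.-negligible A.
Proof.
move=> hP hA.
have inv0 k : 0 < k.+1%:R^-1 :> R by rewrite invr_gt0 ltr0n.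
have hk k := hA _ (inv0 k).
have [xi hxi] := choice hk.
pose B k := \bigcup_n [set w : sigma_space H | 1 <= xi k n w].
have mB k n : measurable ([set w | 1 <= xi k n w] : set (sigma_space H)).
  have [ee [h1 _ _ _ _]] := hxi k; have [i /pb[Hxi _]] := h1 n.
  rewrite -[X in measurable X]setTI.
  have := measurable_sigma_space Hxi measurableT (measurable_itv `[1, +oo[).
  by congr measurable; apply/seteqP; split => w [_]; rewrite /= in_itv /= andbT.
have PB k : (P (B k) <= (k.+1%:R^-1)%:E)%E.
  have [ee [h1 h2 h3 h4 h5]] := hxi k.
  apply: le_trans (measure_sigma_subadditive _ (mB k) _ (@subset_refl _ _)) _.
    exact: bigcupT_measurable.
  apply: lime_le; first exact: is_cvg_nneseries.
  apply: nearW => n; apply: le_trans (_ : _ <= \sum_(0 <= i < n) (ee i)%:E)%E _.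
    apply: lee_sum => i _; have [j /pb hb] := h1 i.
    apply: le_trans (Lint_markov P hb (h2 i)) _; rewrite lee_fin.
    by have [_] := h3 i; apply.
  by rewrite sumEFin lee_fin.
exists (\bigcap_k B k); split.
- by apply: bigcapT_measurable => k; apply: bigcupT_measurable => n; exact: mB.
- apply/le_anti; rewrite measure_ge0 andbT.
  apply/lee_addgt0Pr => e e0; rewrite add0e.
  have [k _ hke] : exists2 k : nat, True & k.+1%:R^-1 < e.
    exists (Num.truncn e^-1) => //.
    rewrite -[ltRHS]invrK ltf_pV2 ?posrE ?invr_gt0 ?ltr0n//.
    exact: Num.Theory.truncnS_gt.
  apply: (@le_trans _ _ (P (B k))).
    apply: le_measure; rewrite ?inE.
    + by apply: bigcapT_measurable => j; apply: bigcupT_measurable => n; exact: mB.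
    + by apply: bigcupT_measurable => n; exact: mB.
    + by move=> w; apply.
  by apply: le_trans (PB k) _; rewrite lee_fin ltW.
- move=> w Aw k _; have [ee [_ _ _ _ h5]] := hxi k.
  by have [n hn] := h5 w Aw; exists n.
Qed.

End null_events.

End capacity_bounds.

Lemma measurable_cluster_set {R : realType} {d : measure_display}
    (T : measurableType d) (z : nat -> T -> R) (b : R) : 0 <= b ->
  (forall n, measurable_fun setT (z n)) ->
  measurable [set w | cluster_set (fun n => z n w) = [set` `[- b, b]]].
Proof.
move=> b0 mz.
have mI n (I : interval R) (f : R -> R) : measurable_fun setT (f \o z n) ->
    measurable [set w | f (z n w) \in I].
  move=> mf; rewrite -[X in measurable X]setTI.
  exact: (mf measurableT _ (measurable_itv I)).
have mo n : measurable_fun setT (-%R \o z n).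
  by apply: measurableT_comp => //; exact: mz.
rewrite (_ : [set w | _] =
  (\bigcap_(q in [set q : rat | `|ratr q : R| <= b]) \bigcap_k \bigcap_N
     \bigcup_(n in [set n | (N <= n)%N])
     [set w | z n w \in `](ratr q - k.+1%:R^-1), (ratr q + k.+1%:R^-1)[]) `&`
  ((\bigcap_p \bigcup_N \bigcap_(n in [set n | (N <= n)%N])
     ~` [set w | z n w \in `[(b + p.+1%:R^-1), p%:R]]) `&`
  (\bigcap_p \bigcup_N \bigcap_(n in [set n | (N <= n)%N])
     ~` [set w | - z n w \in `[(b + p.+1%:R^-1), p%:R]]))); last first.
  apply/seteqP; split => w.
    move=> /(cluster_set_intervalP _ b0)[h1 h2 h3]; split; [|split].
    - move=> q qb k _ N _; have [n Nn hn] := h1 q qb k N; exists n => //=.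
      by rewrite in_itv /= -ltr_distl.
    - move=> p _; have [N hN] := h2 p; exists N; first by [].
      by move=> n Nn; rewrite /= in_itv /=; exact: hN.
    - move=> p _; have [N hN] := h3 p; exists N; first by [].
      by move=> n Nn; rewrite /= in_itv /=; exact: hN.
  move=> [h1 [h2 h3]]; apply/(cluster_set_intervalP _ b0); split.
  - move=> q qb k N; have [n Nn] := h1 q qb k I N I.
    by rewrite /= in_itv /= -ltr_distl => hn; exists n.
  - move=> p; have [N _ hN] := h2 p I; exists N => n Nn.
    by have := hN n Nn; rewrite /= ?in_itv.
  - move=> p; have [N _ hN] := h3 p I; exists N => n Nn.
    by have := hN n Nn; rewrite /= ?in_itv.
apply: measurableI; last apply: measurableI.
- rewrite -[X in measurable X]setCK setC_bigcap; apply: measurableC.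
  rewrite bigcup_mkcond; apply: bigcupT_measurable_rat => q.
  case: ifPn => _; last exact: measurable0.
  apply: measurableC; apply: bigcapT_measurable => k; apply: bigcapT_measurable => N.
  by apply: bigcup_measurable => n _; exact: (mI n _ id (mz n)).
- apply: bigcapT_measurable => p; apply: bigcupT_measurable => N.
  apply: bigcap_measurableType => n _; apply: measurableC.
  exact: (mI n _ id (mz n)).
- apply: bigcapT_measurable => p; apply: bigcupT_measurable => N.
  apply: bigcap_measurableType => n _; apply: measurableC.
  exact: (mI n _ -%R (mo n)).
Qed.

(* Greedy choice: the selected mass stays within one increment of [b] times the
   total. *)
Lemma greedy_selection {R : realType} (b : R) (a v : nat -> R) :
  0 <= b <= 1 -> (forall i, 0 <= a i) -> (forall C, \forall n \near \oo, C <= v n) ->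
  {homo v : i j / (i <= j)%N >-> i <= j} ->
  (forall e : R, 0 < e -> \forall i \near \oo, a i <= e * v i.+1) ->
  exists up : nat -> bool, forall e : R, 0 < e -> \forall n \near \oo,
    `|\sum_(0 <= i < n) (if up i then a i else 0) - b * \sum_(0 <= i < n) a i|
      <= e * v n.
Proof.
move=> /andP[b0 b1] a0 v_infty v_mono ha.
pose D := fix D n : R := if n is n'.+1
  then D n' + (if D n' <= b * \sum_(0 <= i < n') a i then a n' else 0) else 0.
pose up i := D i <= b * \sum_(0 <= j < i) a j.
have DE n : D n = \sum_(0 <= i < n) (if up i then a i else 0).
  by elim: n => [|n ih]; [rewrite big_geq|rewrite big_nat_recr//= -ih].
exists up => e e0.
pose g n : R := `|D n - b * \sum_(0 <= i < n) a i|.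
(* The step moves the difference towards [0], by adding [(1 - b) * a n] or removing [b * a n]; if it
   changes sign, it ends within [a n] of [0]. *)
have gS n : g n.+1 <= Num.max (g n) (a n).
  rewrite /g [X in X - _]/= big_nat_recr//= mulrDr.
  set s := b * \sum_(0 <= i < n) a i.
  have an := a0 n; have ban : 0 <= b * a n <= a n.
    by rewrite mulr_ge0//= ler_piMl.
  move: ban => /andP[ban0 ban1].
  rewrite le_max; case: ifPn => [hle|]; last rewrite -ltNge => hlt.
    rewrite (ler0_norm (_ : D n - s <= 0)) ?subr_le0//.
    rewrite !ler_norml; case: (leP (D n - s + a n - b * a n) 0) => hs.
      by apply/orP; left; apply/andP; split; lra.
    by apply/orP; right; apply/andP; split; lra.
  rewrite (gtr0_norm (_ : 0 < D n - s)) ?subr_gt0//.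
  rewrite !ler_norml; case: (leP (D n - s - b * a n) 0) => hs.
    by apply/orP; right; apply/andP; split; lra.
  by apply/orP; left; apply/andP; split; lra.
have [N _ hN] := ha e e0.
have gN n : (N <= n)%N -> g n <= Num.max (g N) (e * v n).
  move=> /subnKC <-; elim: (n - N)%N => [|k ih]; first by rewrite addn0 le_max lexx.
  rewrite addnS; apply: le_trans (gS _) _; rewrite ge_max; apply/andP; split.
    apply: le_trans ih _; rewrite ge_max le_max lexx /= le_max; apply/orP; right.
    by rewrite ler_pM2l// v_mono.
  by rewrite le_max; apply/orP; right; apply: hN; exact: leq_addr.
near=> n.
rewrite -DE -/(g n); apply: (le_trans (gN n _)); first by near: n; exact: nbhs_infty_ge.
rewrite ge_max lexx andbT -ler_pdivrMl//.
by near: n; exact: v_infty.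
Unshelve. all: by end_near.
Qed.

(** * Symmetry under change of sign *)

Section opposite_sequence.
Context {Omega : Type} {R : realType}.
Variables (x : nat -> Omega -> R) (m l u : nat -> R).
Hypothesis x_bnd : forall i, exists M : R, forall w, `|x i w| <= M.

Lemma past_opp_sequence i f : past (fun i w => - x i w) i f -> past x i f.
Proof.
move=> [phi [[M hM] [K hK]] ->]; exists (fun z => phi (- z)).
  split; first by exists M => z; exact: hM.
  exists K => y z; apply: le_trans (hK _ _) _; rewrite le_eqVlt; apply/orP; left.
  rewrite -opprD; apply/eqP; congr (_ * Num.sqrt _); apply: eq_bigr => j _.
  by rewrite mxE sqrrN.
by apply/funext => w; congr phi; apply/rowP => j; rewrite !mxE.
Qed.

Lemma cond_moments_opp L : cond_moments x m l u L ->
  cond_moments (fun i w => - x i w) m l u L.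
Proof.
move=> [c1 c2 c3 c4 c5 c6 c7]; split => //.
- by move=> i f g /past_opp_sequence hf /past_opp_sequence; exact: c1 hf.
- by move=> i c f /past_opp_sequence; exact: c2.
- by move=> i f /past_opp_sequence; exact: c3.
- move=> i f /past_opp_sequence hf f0.
  rewrite (_ : (fun w => _) = (fun w => (-1) * (f w * x i w))).
    rewrite (c2 i.+1); first by rewrite mulN1r normrN; exact: c6.
    by apply: past_mul; [exact: pastS|exact: past_var].
  by apply/funext => w; ring.
- move=> i f /past_opp_sequence hf f0.
  rewrite (_ : (fun w => _) = (fun w => f w * x i w ^+ 2)); first exact: c7.
  by apply/funext => w; rewrite sqrrN.
Qed.

Lemma qnull_opp A : qnull (fun i w => - x i w) m l u A -> qnull x m l u A.
Proof.
move=> hA eps eps0; have [xi [e [h1 h2 h3 h4 h5]]] := hA eps eps0.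
exists xi, e; split => //.
  by move=> n; have [i /past_opp_sequence hi] := h1 n; exists i.
move=> n; have [e0 he] := h3 n; split=> // L /cond_moments_opp; exact: he.
Qed.

End opposite_sequence.

(** * From the two halves to the cluster set *)

Section cluster_lil.
Context {Omega : Type} {R : realType}.
Variables (x : nat -> Omega -> R) (m v : nat -> R).
Hypothesis x_bnd : forall i, exists M : R, forall w, `|x i w| <= M.
Hypothesis v0 : v 0%N = 0.
Hypothesis v_mono : {homo v : i j / (i <= j)%N >-> i <= j}.
Hypothesis v_infty : forall C, \forall n \near \oo, C <= v n.
Hypothesis v_step : forall e : R, 0 < e ->
  \forall n \near \oo, v n.+1 - v n <= e * v n.+1.
Hypothesis x_small : forall eta : R, 0 < eta -> \forall N \near \oo,
  forall i w, (i < N)%N -> itau (v N) * `|x i w| <= eta * Num.sqrt (v N).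
Hypothesis m_small : forall eta : R, 0 < eta -> \forall N \near \oo,
  \sum_(0 <= i < N) m i <= eta * lil (v N).
Hypothesis m_bnd : forall i (B : R), (forall w, `|x i w| <= B) -> m i <= 2 * B.

Local Notation S n w := (\sum_(0 <= i < n) x i w).
Local Notation z n w := (S n w / lil (v n)).
Local Notation event t :=
  [set w | cluster_set (fun n => z n w) = [set` `[- Num.sqrt t, Num.sqrt t]]].
Local Notation upper_bound u rho := (forall rho', rho < rho' ->
  \forall N \near \oo, \sum_(0 <= i < N) u i <= rho' * v N).
Local Notation lower_bound l rho := (forall rho', rho' < rho ->
  \forall N \near \oo, rho' * v N <= \sum_(0 <= i < N) l i).

Let near_ge (P : nat -> Prop) : (\forall n \near \oo, P n) ->
  exists N, forall n, (N <= n)%N -> P n.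
Proof. by move=> [N _ hN]; exists N. Qed.

Let lil_pos : \forall n \near \oo, 0 < lil (v n).
Proof.
apply: filterS (v_infty 1) => n v1; rewrite mulr_gt0 ?itau_gt0// sqrtr_gt0.
exact: lt_le_trans v1.
Qed.

Let v_jump : \forall n \near \oo, v n.+1 <= 2 * v n.
Proof.
have h : 0 < 2^-1 :> R by rewrite invr_gt0.
by apply: filterS (v_step h) => n; lra.
Qed.

Let sum_opp n w : \sum_(0 <= i < n) - x i w = - S n w.
Proof. by rewrite sumrN. Qed.

Lemma limsup_qnull l u rho x0 : upper_bound u rho -> 0 <= rho -> 0 < x0 ->
  rho < x0 ^+ 2 ->
  qnull x m l u [set w | forall N, exists2 n, (N <= n)%N & x0 * lil (v n) <= `|S n w|].
Proof.
move=> u_le rho0 x00 hx0.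
have h1 := @upper_qnull _ _ x m l u v x_bnd v0 v_mono v_infty x_small m_small
  rho x0 rho0 x00 hx0 u_le.
have h2 : qnull x m l u
    [set w | forall N, exists2 n, (N <= n)%N & x0 * lil (v n) <= - S n w].
  apply: qnull_opp => //.
  apply: qnull_sub (@upper_qnull _ _ (fun i w => - x i w) m l u v _ v0 v_mono
    v_infty _ m_small rho x0 rho0 x00 hx0 u_le).
  - by move=> w h N; have [n Nn hn] := h N; exists n => //; rewrite sum_opp.
  - by move=> i; have [M hM] := x_bnd i; exists M => w; rewrite normrN.
  - move=> eta /x_small; apply: filterS => N h i w iN.
    by rewrite normrN; exact: h.
apply: qnull_sub (qnullU h1 h2) => w hw; apply: contrapT => /not_orP[/existsNP[N1 n1] /existsNP[N2 n2]].
have [n] := hw (maxn N1 N2); rewrite geq_max => /andP[N1n N2n].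
rewrite ler_normr => /orP[h|h]; first by apply: n1; exists n.
by apply: n2; exists n.
Qed.

(** The restriction to [bounded] feeds the block argument, which must control the walk at the start
    of each block; the upper half removes it later. *)
Lemma liminf_qnull l u rho x0 K : lower_bound l rho ->
  (forall N, \sum_(0 <= i < N) l i <= v N) -> 0 <= x0 -> x0 ^+ 2 < rho -> 0 <= K ->
  let bounded := [set w | exists N, forall n, (N <= n)%N -> `|S n w| <= K * lil (v n)] in
  qnull x m l u ([set w | exists N, forall n, (N <= n)%N -> S n w < x0 * lil (v n)] `&` bounded) /\
  qnull x m l u ([set w | exists N, forall n, (N <= n)%N -> - S n w < x0 * lil (v n)] `&` bounded).
Proof.
move=> l_ge l_le x00 hx0 K0 bounded; split.
  apply: qnull_sub (@lower_qnull _ _ x m l u v x_bnd v_mono v_infty x_small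
    m_small rho x0 K x00 hx0 K0 l_ge l_le v_jump m_bnd).
  move=> w [[N hN] [M hM]]; exists (maxn N M) => n.
  by rewrite geq_max => /andP[Nn Mn]; split; [exact: hN|exact: hM].
apply: qnull_opp => //.
apply: qnull_sub (@lower_qnull _ _ (fun i w => - x i w) m l u v _ v_mono v_infty _
  m_small rho x0 K x00 hx0 K0 l_ge l_le v_jump _).
- move=> w [[N hN] [M hM]]; exists (maxn N M) => n.
  by rewrite geq_max sum_opp normrN => /andP[Nn Mn]; split; [exact: hN|exact: hM].
- by move=> i; have [M hM] := x_bnd i; exists M => w; rewrite normrN.
- move=> eta /x_small; apply: filterS => N h i w iN.
  by rewrite normrN; exact: h.
- by move=> i B hB; apply: m_bnd => w; rewrite -normrN.
Qed.

Lemma cluster_qnull_gt l u rho t : upper_bound u rho -> 0 <= rho -> rho < t ->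
  qnull x m l u (event t).
Proof.
move=> u_le rho0 rhot; have v_inf := v_infty.
pose x0 : R := Num.sqrt ((rho + t) / 2).
have x02 : x0 ^+ 2 = (rho + t) / 2 by rewrite sqr_sqrtr//; lra.
have x00 : 0 < x0 by rewrite sqrtr_gt0; lra.
have x0t : x0 < Num.sqrt t by rewrite ltr_sqrt; lra.
have hx0 : rho < x0 ^+ 2 by rewrite x02; lra.
apply: qnull_sub (limsup_qnull l u_le rho0 x00 hx0) => w hw N.
have [M hM] := near_ge lil_pos.
have : cluster_set (fun n => z n w) (Num.sqrt t).
  by rewrite hw /= in_itv /= lexx andbT; lra.
move=> /cluster_setP/(_ (Num.sqrt t - x0)).
have tx0 : 0 < Num.sqrt t - x0 by lra.
move=> /(_ tx0 (maxn N M))[n]; rewrite geq_max => /andP[Nn Mn].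
rewrite ltr_norml => /andP[h _]; exists n => //.
apply: le_trans (ler_norm _).
by rewrite -ler_pdivlMr ?hM//; lra.
Qed.

Lemma cluster_qnull_lt l u rho t : upper_bound u 1 -> lower_bound l rho ->
  (forall N, \sum_(0 <= i < N) l i <= v N) -> 0 <= t -> t < rho ->
  qnull x m l u (event t).
Proof.
move=> u_le l_ge l_le t0 trho.
pose x0 : R := Num.sqrt ((rho + t) / 2).
have x02 : x0 ^+ 2 = (rho + t) / 2 by rewrite sqr_sqrtr//; lra.
have x00 : 0 <= x0 by rewrite sqrtr_ge0.
have x0t : Num.sqrt t < x0 by rewrite ltr_sqrt; lra.
have hx0 : x0 ^+ 2 < rho by rewrite x02; lra.
(* Since [2 ^ 2 > 1], the upper half gives [|S n| <= 2 * lil (v n)] eventually outside a null set: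
   this excludes an escape to infinity and serves as [K]. *)
have two2 : 1 < 2 ^+ 2 :> R by rewrite expr2; lra.
have h1 := limsup_qnull l u_le ler01 (ltr0Sn R 1) two2.
have [h2 _] := liminf_qnull u l_ge l_le x00 hx0 (ler0n R 2).
apply: qnull_sub (qnullU h1 h2) => w hw.
have [/existsNP[N hN]|] := pselect (~ (forall N, exists2 n, (N <= n)%N & 2 * lil (v n) <= `|S n w|)); last first.
  by move=> /contrapT; left.
have {}hN n : (N <= n)%N -> `|S n w| <= 2 * lil (v n).
  by move=> Nn; rewrite leNgt; apply/negP => /ltW h; apply: hN; exists n.
have [M hM] := near_ge lil_pos.
right; split; last by exists N.
have [|N1 hN1] := cluster_set_bounded hw x0t.
  exists (maxn N M) => n; rewrite geq_max => /andP[/hN Nn /hM Mn].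
  by rewrite ler_pdivrMr//; exact: le_trans (ler_norm _) Nn.
exists (maxn N1 M) => n; rewrite geq_max => /andP[/hN1 Nn /hM Mn].
by rewrite -ltr_pdivrMr.
Qed.

(** With [lil'] at [n + 1], the increment is [x n / lil' - z n * (1 - lil / lil')]. The first term
    is small by [x_small]; by [lil_ratio], [lil / lil'] is at least [v n / v n.+1], which is close
    to [1] by [v_step]. *)
Let bounded_step w K : (exists N, forall n, (N <= n)%N -> `|S n w| <= K * lil (v n)) ->
  forall e : R, 0 < e -> exists N, forall n, (N <= n)%N -> `|z n.+1 w - z n w| < e.
Proof.
move=> [N hN] e e0.
pose e1 : R := e / 4; pose e2 : R := e / (4 * (`|K| + 1)).
have K1 : 0 < `|K| + 1 by rewrite ltr_wpDl.
have e10 : 0 < e1 by rewrite divr_gt0.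
have e20 : 0 < e2 by rewrite divr_gt0// mulr_gt0.
have [N1 hN1] := near_ge (x_small e10).
have [N2 hN2] := near_ge (v_step e20).
have [N3 hN3] := near_ge (v_infty 1).
exists (maxn (maxn N N1) (maxn N2 N3)) => n.
rewrite !geq_max => /andP[/andP[Nn N1n] /andP[N2n N3n]].
have hx := hN1 n.+1 (leqW N1n) n w (leqnn _).
have hv := hN2 n N2n; have v1 := hN3 n N3n; have hS := hN n Nn.
have vv' : v n <= v n.+1 by exact: v_mono.
have vn0 : 0 < v n by lra.
have vn'0 : 0 < v n.+1 by lra.
have hr := lil_ratio vn0 vv'.
have hl := ler_lil vv'.
have L0 : 0 < lil (v n) by rewrite mulr_gt0 ?itau_gt0// sqrtr_gt0.
have L'0 : 0 < lil (v n.+1) by lra.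
have s0 : 0 < Num.sqrt (v n.+1) by rewrite sqrtr_gt0.
have t2 := itau_sqr_ge2 (v n.+1).
have t0 := itau_gt0 (v n.+1).
have hx' : `|x n w| <= e1 * lil (v n.+1).
  rewrite -(ler_pM2l t0); apply: le_trans hx _; rewrite /lil.
  have -> : itau (v n.+1) * (e1 * (Num.sqrt (v n.+1) * itau (v n.+1))) =
    itau (v n.+1) ^+ 2 * (e1 * Num.sqrt (v n.+1)) by ring.
  by rewrite ler_peMl ?mulr_ge0 ?ltW//; lra.
rewrite big_nat_recr//=.
have -> : (S n w + x n w) / lil (v n.+1) - S n w / lil (v n) =
  x n w / lil (v n.+1) - S n w / lil (v n) * (1 - lil (v n) / lil (v n.+1)).
  by field; rewrite !gt_eqF.
apply: le_lt_trans (ler_normB _ _) _; rewrite !normrM.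
have -> : `|(lil (v n.+1))^-1| = (lil (v n.+1))^-1.
  by rewrite ger0_norm// invr_ge0 ltW.
have -> : `|(lil (v n))^-1| = (lil (v n))^-1.
  by rewrite ger0_norm// invr_ge0 ltW.
have h1 : `|x n w| / lil (v n.+1) <= e1 by rewrite ler_pdivrMr.
have h2 : `|S n w| / lil (v n) <= `|K| + 1.
  rewrite ler_pdivrMr//; apply: le_trans hS _; rewrite ler_pM2r//.
  by have := ler_norm K; lra.
have h3 : `|1 - lil (v n) / lil (v n.+1)| <= e2.
  rewrite ger0_norm; last by rewrite subr_ge0 ler_pdivrMr// mul1r.
  have : v n / v n.+1 <= lil (v n) / lil (v n.+1).
    by rewrite ler_pdivrMr// mulrAC ler_pdivlMr// [leRHS]mulrC.
  have : 1 - e2 <= v n / v n.+1 by rewrite ler_pdivlMr//; lra.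
  lra.
have h4 : `|S n w| / lil (v n) * `|1 - lil (v n) / lil (v n.+1)| <= (`|K| + 1) * e2.
  by rewrite ler_pM// divr_ge0// ltW.
have h5 : (`|K| + 1) * e2 = e / 4 by rewrite /e2; field; rewrite !gt_eqF.
move: h1 h4; rewrite h5 /e1; lra.
Qed.

(** Both variance bounds have the constant [t], as under an extremal measure. The levels
    [sqrt t + 1 / k.+1] from above and [sqrt t - 1 / k.+1] from below, on both sides, together with
    the small steps, determine the cluster set. The null sets are kept as a sequence; the measure
    will take their union. *)
Lemma cluster_qnull_compl l u t : upper_bound u t -> lower_bound l t ->
  (forall N, \sum_(0 <= i < N) l i <= v N) -> 0 < t ->
  exists2 A : nat -> set Omega, forall k, qnull x m l u (A k) &
    ~` event t `<=` \bigcup_k A k.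
Proof.
move=> u_le l_ge l_le t0.
have inv0 k : 0 < k.+1%:R^-1 :> R by rewrite invr_gt0 ltr0n.
pose b : R := Num.sqrt t.
have b0 : 0 < b by rewrite sqrtr_gt0.
have b2 : b ^+ 2 = t by rewrite sqr_sqrtr// ltW.
pose up k : R := b + k.+1%:R^-1.
pose lo k : R := Num.max 0 (b - k.+1%:R^-1).
have up0 k : 0 < up k by rewrite addr_gt0.
have upt k : t < up k ^+ 2.
  by rewrite -b2 ltr_sqr ?nnegrE ?(ltW b0) ?(ltW (up0 k))// ltrDl.
have lo0 k : 0 <= lo k by rewrite le_max lexx.
have lot k : lo k ^+ 2 < t.
  by rewrite -b2 ltr_sqr ?nnegrE ?(ltW b0) ?lo0// gt_max b0 gtrDl oppr_lt0 inv0.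
have hU k := limsup_qnull l u_le (ltW t0) (up0 k) (upt k).
have hL k := liminf_qnull u l_ge l_le (lo0 k) (lot k) (ltW (up0 0%N)).
have hA k := qnullU (hU k) (qnullU (proj1 (hL k)) (proj2 (hL k))).
refine (ex_intro2 _ _ _ hA _).
move=> w ncl; apply: contrapT => nw; apply: ncl.
have {nw}hw k : ~ (_ \/ (_ /\ _ \/ _ /\ _)) := fun Aw => nw (ex_intro2 _ _ k I Aw).
have [M hM] := near_ge lil_pos.
have small (e : R) : 0 < e -> exists k, k.+1%:R^-1 < e.
  move=> e0; exists (Num.truncn e^-1).
  rewrite -[ltRHS]invrK ltf_pV2 ?posrE ?invr_gt0 ?ltr0n//.
  exact: Num.Theory.truncnS_gt.
have ev_up k : exists N, forall n, (N <= n)%N -> `|S n w| < up k * lil (v n).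
  have /not_orP[/existsNP[N hN] _] := hw k.
  exists N => n Nn; rewrite ltNge; apply/negP => h; apply: hN.
  by exists n.
have bounded : exists N, forall n, (N <= n)%N -> `|S n w| <= up 0%N * lil (v n).
  by have [N hN] := ev_up 0%N; exists N => n /hN/ltW.
have ub (y : nat -> R) : (forall n, `|y n| = `|z n w|) -> forall c, b < c ->
    exists N, forall n, (N <= n)%N -> y n < c.
  move=> hy c bc; have [|k hk] := small (c - b); first by rewrite subr_gt0.
  have [N hN] := ev_up k; exists (maxn N M) => n; rewrite geq_max => /andP[/hN h /hM L0].
  apply: le_lt_trans (ler_norm _) _; rewrite hy normrM normfV (gtr0_norm L0).
  rewrite ltr_pdivrMr//; apply: lt_trans h _; rewrite ltr_pM2r// /up.
  by rewrite -ltrBrDl.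
apply: cluster_set_interval.
- exact: ub.
- by apply: ub => n; rewrite normrN.
- move=> c cb N; apply: contrapT => hn.
  have [|k hk] := small (b - c); first by rewrite subr_gt0.
  have /not_orP[_ /not_orP[+ _]] := hw k; apply; split => //.
  exists (maxn N M) => n; rewrite geq_max => /andP[Nn /hM L0].
  rewrite -ltr_pdivrMr// lt_max; apply/orP; right.
  apply: (@lt_trans _ _ c); last by rewrite ltrBrDr addrC -ltrBrDr.
  by rewrite ltNge; apply/negP => h; apply: hn; exists n.
- move=> c cb N; apply: contrapT => hn.
  have [|k hk] := small (b - c); first by rewrite subr_gt0.
  have /not_orP[_ /not_orP[_ +]] := hw k; apply; split => //.
  exists (maxn N M) => n; rewrite geq_max => /andP[Nn /hM L0].
  rewrite -ltr_pdivrMr// mulNr lt_max; apply/orP; right.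
  apply: (@lt_trans _ _ c); last by rewrite ltrBrDr addrC -ltrBrDr.
  by rewrite ltNge; apply/negP => h; apply: hn; exists n.
- exact: bounded_step bounded.
Qed.

End cluster_lil.

(** * The hypotheses of the theorem translated, and the conclusion *)

Section theorem_setting.
Context {R : realType} {d : measure_display} {Omega : measurableType d}.
Variables (H : set (Omega -> R)) (E : (Omega -> R) -> \bar R).
Variable Pfam : set (probability (sigma_space H) R).
Variables (X : nat -> Omega -> R) (alpha : nat -> R) (r : R).
Hypothesis hH : function_space H.
Hypothesis hE : sublinear_expectation H E.
Hypothesis hCC : condition_CC E Pfam.
Hypothesis hX : forall n, (1 <= n)%N -> H (X n).
Hypothesis hind : independent_seq E X.
Hypothesis hr : 0 < r.
Hypothesis hi : s2_low E X n / s2 E X n @[n --> \oo] --> r.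
Hypothesis hs : s2 E X n @[n --> \oo] --> +oo.
Hypothesis halpha : alpha n @[n --> \oo] --> (0 : R).
Hypothesis hbound : forall n, (1 <= n)%N -> forall w,
  `|X n w| <= alpha n * (s_ E X n / t_ E X n).
Hypothesis hiii : (\sum_(1 <= j < n.+1)
    (`|fine (E (X j))| + `|fine (conj_expectation E (X j))|)) / a_ E X n
  @[n --> \oo] --> (0 : R).

(** A shift of indices: sums now start at [0], and [x i] goes with [v i.+1]. *)
Let x i := X i.+1.
Let v := s2 E X.
Let m := mean_bound E x.
Let l := lower_var E x.
Let u := upper_var E x.
Local Notation S n w := (\sum_(0 <= i < n) x i w).
Local Notation event t := [set w |
  cluster_set (fun n => S n w / lil (v n)) = [set` `[- Num.sqrt t, Num.sqrt t]]].

Let near_ge (P : nat -> Prop) : (\forall n \near \oo, P n) ->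
  exists N, forall n, (N <= n)%N -> P n.
Proof. by move=> [N _ hN]; exists N. Qed.

Let Hx i : bounded_part H (x i).
Proof.
split; first exact: hX.
by exists (alpha i.+1 * (s_ E X i.+1 / t_ E X i.+1)) => w; exact: hbound.
Qed.

Let x_bnd i : exists M : R, forall w, `|x i w| <= M.
Proof. by case: (Hx i). Qed.

Let x_ind i : (0 < i)%N ->
  independent_to E (fun w => \row_(j < 1) x i w) (fun w => \row_(j < i) x j w).
Proof. exact: hind. Qed.

Let Hsq i : bounded_part H (fun w => x i w ^+ 2).
Proof.
by apply: (@past_bounded_part _ _ _ _ hH x i.+1) => [j|]; [case: (Hx j)|exact/past_exprn/past_var].
Qed.

Let cm P : Pfam P -> cond_moments x m l u (Lint P).
Proof. exact: cond_moments_Lint. Qed.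

Let fine_E_le f c : bounded_part H f -> (forall w, f w <= c) -> fine (E f) <= c.
Proof.
move=> hf fc; rewrite -lee_fin -(E_fin hH hE hf).
apply: (E_le_Lint hCC hf) => P _; rewrite -[leRHS](@Lint_cst _ _ _ H P).
by apply: Lint_mono => //; exact: bounded_part_cst.
Qed.

Let fine_E_ge f c : bounded_part H f -> (forall w, c <= f w) -> c <= fine (E f).
Proof.
move=> hf fc; have [P PP] := Pfam_nonempty hH hE hCC.
apply: le_trans (Lint_le_E hH hE hCC PP hf); rewrite -[leLHS](@Lint_cst _ _ _ H P).
by apply: Lint_mono => //; exact: bounded_part_cst.
Qed.

Let v_sum n : v n = \sum_(0 <= i < n) u i.
Proof. by rewrite /v /s2 big_add1. Qed.

Let v_low n : s2_low E X n = \sum_(0 <= i < n) l i.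
Proof. by rewrite /s2_low big_add1. Qed.

Let l_ge0 i : 0 <= l i.
Proof.
rewrite /l /lower_var fine_conj oppr_ge0; apply: fine_E_le => [|w].
  rewrite (_ : (fun w => _) = (fun w => -1 * x i w ^+ 2)); last first.
    by apply/funext => w; rewrite mulN1r.
  exact: bounded_part_scale.
by rewrite oppr_le0 sqr_ge0.
Qed.

Let l_le_u i : l i <= u i.
Proof.
have [P /cm[_ _ _ h1 _ _ hv]] := Pfam_nonempty hH hE hCC.
have := hv i (fun=> 1) (past_cst x i 1) (fun=> ler01); rewrite h1 !mulr1.
by move=> /andP[]; exact: le_trans.
Qed.

Let u_ge0 i : 0 <= u i. Proof. exact: le_trans (l_ge0 i) (l_le_u i). Qed.

Let v0 : v 0%N = 0. Proof. by rewrite v_sum big_geq. Qed.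

Let v_mono : {homo v : i j / (i <= j)%N >-> i <= j}.
Proof.
move=> i j ij; rewrite !v_sum (big_cat_nat (leq0n i) ij)/= lerDl.
exact: sumr_ge0.
Qed.

Let v_ge0 n : 0 <= v n. Proof. by rewrite -v0 v_mono. Qed.

Let v_infty C : \forall n \near \oo, C <= v n.
Proof. by move/cvgryPge : hs. Qed.

Let v_pos : \forall n \near \oo, 0 < v n.
Proof. by apply: filterS (v_infty 1) => n; exact: lt_le_trans. Qed.

Let alpha_small (e : R) : 0 < e -> \forall n \near \oo, `|alpha n.+1| <= e.
Proof.
move=> e0; have /cvgr0Pnorm_le/(_ e e0)[N _ hN] := halpha; exists N => // n Nn.
by apply: hN; exact: leqW.
Qed.

Let x_bound i w : itau (v i.+1) * `|x i w| <= `|alpha i.+1| * Num.sqrt (v i.+1).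
Proof.
have t0 : 0 < itau (v i.+1) by exact: itau_gt0.
apply: le_trans (_ : itau (v i.+1) * (`|alpha i.+1| * (s_ E X i.+1 / t_ E X i.+1)) <= _).
  rewrite ler_pM2l//; apply: le_trans (hbound _ _) _ => //.
  by rewrite ler_wpM2r ?ler_norm// divr_ge0// sqrtr_ge0.
rewrite le_eqVlt; apply/orP; left; apply/eqP.
rewrite /s_ -/v /t_ -/(itau (s2 E X i.+1)) -/(v i.+1).
by field; rewrite gt_eqF.
Qed.

Let v_diff n : v n.+1 - v n = u n.
Proof. by rewrite !v_sum big_nat_recr//= addrAC subrr add0r. Qed.

(** The increment is [u n], at most [alpha ^ 2 * s ^ 2 / t ^ 2] at index [n.+1], with [t ^ 2 >= 2];
    taking [|alpha|] below both [1] and [e] makes its square at most [e]. *)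
Let v_step (e : R) : 0 < e -> \forall n \near \oo, v n.+1 - v n <= e * v n.+1.
Proof.
move=> e0; have m0 : 0 < Num.min 1 e by rewrite lt_min ltr01.
apply: filterS (alpha_small m0) => n; rewrite le_min => /andP[a1 ae].
rewrite v_diff.
apply: fine_E_le => // w.
have := x_bound n w; have := itau_gt0 (v n.+1); have := itau_sqr_ge2 (v n.+1).
rewrite -(@real_normK _ (x n w)) ?num_real//.
have := sqr_sqrtr (v_ge0 n.+1); have := sqrtr_ge0 (v n.+1).
have := normr_ge0 (x n w); have := normr_ge0 (alpha n.+1); have vn := v_ge0 n.+1.
move: a1 ae; move: (`|x n w|) (`|alpha n.+1|) (Num.sqrt _) (itau _) => y a s t.
move=> a1 ae a0 y0 s0 sE t2 t0 h.
have h2 : t ^+ 2 * y ^+ 2 <= a ^+ 2 * s ^+ 2.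
  by rewrite -!exprMn ler_sqr ?nnegrE ?mulr_ge0// ltW.
have h3 : a ^+ 2 <= e by rewrite expr2; apply: le_trans ae; rewrite ler_piMl.
rewrite -sE; apply: le_trans (_ : a ^+ 2 * s ^+ 2 <= _).
  by apply: le_trans h2; rewrite ler_peMl ?sqr_ge0//; lra.
by rewrite ler_wpM2r ?sqr_ge0.
Qed.

(** The hypothesis bounds each variable at its own index. From [N1] on the bound carries over to [N]
    because [itau / sqrt] is nonincreasing; the finitely many earlier variables are bounded, and
    [itau (v N) / sqrt (v N)] tends to [0]. *)
Let x_small (eta : R) : 0 < eta -> \forall N \near \oo,
  forall i w, (i < N)%N -> itau (v N) * `|x i w| <= eta * Num.sqrt (v N).
Proof.
move=> eta0; have [N1 hN1] := near_ge (alpha_small eta0).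
have [M hM] := choice x_bnd.
pose B := 1 + \sum_(0 <= j < N1) `|M j|.
have s0 : 0 <= \sum_(0 <= j < N1) `|M j| by exact: sumr_ge0.
have B0 : 0 < B by rewrite ltr_pwDl.
have [V hV] := itau_small (divr_gt0 eta0 B0).
near=> N => i w iN.
have [iN1|N1i] := ltnP i N1.
  have xB : `|x i w| <= B.
    apply: le_trans (hM i w) _; apply: le_trans (ler_norm _) _.
    rewrite /B (big_cat_nat (leq0n i) (ltnW iN1))/= (big_ltn iN1)/=.
    have : 0 <= \sum_(0 <= j < i) `|M j| by exact: sumr_ge0.
    have : 0 <= \sum_(i.+1 <= j < N1) `|M j| by exact: sumr_ge0.
    lra.
  have hb : itau (v N) <= eta / B * Num.sqrt (v N).
    by apply: hV; near: N; exact: v_infty.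
  apply: le_trans (_ : eta / B * Num.sqrt (v N) * B <= _); last first.
    by rewrite mulrAC divfK// gt_eqF.
  by rewrite ler_pM// ltW// itau_gt0.
have t0 := itau_gt0 (v i.+1).
have hx : itau (v i.+1) * `|x i w| <= eta * Num.sqrt (v i.+1).
  by apply: le_trans (x_bound i w) _; rewrite ler_wpM2r ?sqrtr_ge0// hN1.
have [vi0|vi0] := eqVneq (v i.+1) 0.
  move: hx; rewrite vi0 sqrtr0 mulr0 pmulr_rle0 ?itau_gt0// normr_le0 => /eqP ->.
  by rewrite normr0 mulr0 mulr_ge0 ?sqrtr_ge0// ltW.
have vi : 0 < v i.+1 by rewrite lt_neqAle eq_sym vi0 v_ge0.
have si : 0 < Num.sqrt (v i.+1) by rewrite sqrtr_gt0.
rewrite -(ler_pM2l si) mulrA.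
apply: le_trans (_ : Num.sqrt (v N) * itau (v i.+1) * `|x i w| <= _).
  by rewrite ler_wpM2r//; apply: itau_ratio => //; exact: v_mono.
have := ler_wpM2l (sqrtr_ge0 (v N)) hx; rewrite mulrA => /le_trans; apply.
by rewrite le_eqVlt; apply/orP; left; apply/eqP; ring.
Unshelve. all: by end_near.
Qed.

Let m_small (eta : R) : 0 < eta -> \forall N \near \oo,
  \sum_(0 <= i < N) m i <= eta * lil (v N).
Proof.
move=> eta0; near=> N.
have vN : 0 < v N by near: N; exact: v_pos.
have L0 : 0 < lil (v N) by rewrite mulr_gt0 ?itau_gt0// sqrtr_gt0.
have : `|(\sum_(1 <= j < N.+1)
    (`|fine (E (X j))| + `|fine (conj_expectation E (X j))|)) / a_ E X N| <= eta.
  by near: N; exact: cvgr0_norm_le hiii _ eta0.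
rewrite big_add1 => /(le_trans (ler_norm _)).
by rewrite ler_pdivrMr.
Unshelve. all: by end_near.
Qed.

Let m_bnd i (B : R) : (forall w, `|x i w| <= B) -> m i <= 2 * B.
Proof.
move=> hB; have hN : bounded_part H (fun w => - x i w).
  rewrite (_ : (fun w => _) = (fun w => -1 * x i w)); last first.
    by apply/funext => w; rewrite mulN1r.
  exact: bounded_part_scale.
have bd f : bounded_part H f -> (forall w, `|f w| <= B) -> `|fine (E f)| <= B.
  move=> hf hfB; rewrite ler_norml; apply/andP; split.
    by apply: fine_E_ge => // w; have := hfB w; rewrite ler_norml => /andP[].
  by apply: fine_E_le => // w; apply: le_trans (ler_norm _) (hfB w).
rewrite /m /mean_bound fine_conj normrN mulr_natl mulr2n; apply: lerD; apply: bd => //.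
by move=> w; rewrite normrN.
Qed.

Let l_sum_le N : \sum_(0 <= i < N) l i <= v N.
Proof. by rewrite v_sum; apply: ler_sum. Qed.

Let l_near (e : R) : 0 < e -> \forall n \near \oo,
  `|\sum_(0 <= i < n) l i - r * v n| <= e * v n.
Proof.
move=> e0; near=> n; have vn : 0 < v n by near: n; exact: v_pos.
have : `|r - s2_low E X n / s2 E X n| <= e by near: n; exact: cvgr_dist_le hi _ e0.
rewrite v_low -/(v n) => h.
have -> : \sum_(0 <= i < n) l i - r * v n =
    - ((r - (\sum_(0 <= i < n) l i) / v n) * v n).
  by rewrite mulrBl divfK ?gt_eqF// opprB.
by rewrite normrN normrM (gtr0_norm vn) ler_pM2r.
Unshelve. all: by end_near.
Qed.

Let l_lower rho' : rho' < r -> \forall N \near \oo,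
  rho' * v N <= \sum_(0 <= i < N) l i.
Proof.
rewrite -subr_gt0 => h; apply: filterS (l_near h) => n.
by rewrite ler_norml mulrBl => /andP[? _]; lra.
Qed.

Let u_upper rho rho' : 1 <= rho -> rho < rho' -> \forall N \near \oo,
  \sum_(0 <= i < N) u i <= rho' * v N.
Proof.
move=> h1 h2; apply: nearW => n; rewrite -v_sum ler_peMl//; lra.
Qed.

Let event_qnull (t : R) : 0 <= t -> ~~ (r <= t <= 1) -> qnull x m l u (event t).
Proof.
move=> t0; rewrite negb_and -!ltNge => /orP[tr|t1].
  apply: (@cluster_qnull_lt _ _ x m v _ v0 _ _ _ _ _ _ l u r) => //.
  by move=> rho'; exact: u_upper.
apply: (@cluster_qnull_gt _ _ x m v _ v0 _ _ _ _ l u 1) => //.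
by move=> rho'; exact: u_upper.
Qed.

Let event_measurable t : measurable (event t : set (sigma_space H)).
Proof.
apply: (@measurable_cluster_set _ _ (sigma_space H) (fun n w => S n w / lil (v n))).
  exact: sqrtr_ge0.
move=> n; apply: measurable_sigma_space; rewrite (_ : (fun w => _) =
    (fun w => (lil (v n))^-1 * S n w)).
  by apply: fs_scale => //; apply: fs_sum => // i; case: (Hx i).
by apply/funext => w; rewrite mulrC.
Qed.

(** Writing [t = r + b * (1 - r)], a proportion [b] of the gaps [u i - l i], selected on top of the
    lower second moments, brings the total variance to [t * v n] up to [o (v n)]. *)
Let event_full t : r <= t <= 1 -> exists2 P, Pfam P & P (event t) = 1%E.
Proof.
move=> /andP[rt t1].
have [b b01 tE] : exists2 b, 0 <= b <= 1 & t = r + b * (1 - r).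
  (* If [r = 1] then [t = 1] as well and the segment is a point, so [b = 0] is taken. *)
  have [r1|r1] := eqVneq r 1.
    by exists 0; [rewrite lexx ler01|rewrite mul0r addr0; apply/le_anti; rewrite rt r1 t1].
  have r10 : 0 < 1 - r by rewrite subr_gt0 lt_neqAle r1 (le_trans rt).
  exists ((t - r) / (1 - r)); last by rewrite divfK ?gt_eqF// addrC subrK.
  by rewrite divr_ge0 ?ler_pdivrMr ?mul1r ?(ltW r10) ?subr_ge0 ?lerB.
pose a i := u i - l i.
have a0 i : 0 <= a i by rewrite subr_ge0.
have ha (e : R) : 0 < e -> \forall i \near \oo, a i <= e * v i.+1.
  move=> /v_step; apply: filterS => i; apply: le_trans.
  by rewrite v_diff gerBl.
have [up hup] := greedy_selection b01 a0 v_infty v_mono ha.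
have [P PP hP] := exists_extremal_measure hH hE hCC Hx x_ind up.
exists P => //.
pose v' i := if up i then u i else l i.
have cmP : cond_moments x m v' v' (Lint P).
  exact: (cond_moments_extremal hH hE hCC Hx x_ind PP hP).
have v'E n : \sum_(0 <= i < n) v' i =
    \sum_(0 <= i < n) l i + \sum_(0 <= i < n) (if up i then a i else 0).
  rewrite -big_split; apply: eq_bigr => i _.
  by rewrite /v' /a; case: (up i); rewrite /= ?addr0// addrC subrK.
have v'near (e : R) : 0 < e -> \forall n \near \oo,
    `|\sum_(0 <= i < n) v' i - t * v n| <= e * v n.
  move=> e0; have e20 : 0 < e / 2 by rewrite divr_gt0.
  apply: filterS2 (l_near e20) (hup _ e20) => n.
  rewrite v'E; have -> : \sum_(0 <= i < n) a i = v n - \sum_(0 <= i < n) l i.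
    by rewrite v_sum -sumrB.
  have := v_ge0 n; move: (\sum_(0 <= i < n) l i) (v n)
    (\sum_(0 <= i < n) (if up i then a i else 0)) => L V D V0.
  have /andP[b0 b1] := b01.
  rewrite tE !ler_norml => /andP[h1 h2] /andP[h3 h4].
  have b1' : 0 <= 1 - b by rewrite subr_ge0.
  have c0 : 0 <= e / 2 * V by rewrite mulr_ge0// ltW.
  have k0 : (1 - b) * (e / 2 * V) <= e / 2 * V by rewrite ler_piMl// gerBl.
  have k1 := ler_wpM2l b1' h2; have k2 := ler_wpM2l b1' h1.
  move: k0 k1 k2 h3 h4 {hup hP b01 cmP v'E}.
  (* The total error is the greedy error [D - b * (V - L)] plus [(1 - b) * (L - r * V)], each at
     most [e / 2 * V] in absolute value. *)
  have -> : D - b * (V - L) = D + L - (r + b * (1 - r)) * V - (1 - b) * (L - r * V).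
    by ring.
  rewrite [L + D]addrC mulrN; set Z := D + L - _.
  by move=> k0 k1 k2 h3 h4; clearbody Z; apply/andP; split; lra.
have up_bd rho' : t < rho' -> \forall N \near \oo, \sum_(0 <= i < N) v' i <= rho' * v N.
  rewrite -subr_gt0 => h; apply: filterS (v'near _ h) => n.
  by rewrite ler_norml mulrBl => /andP[_ ?]; lra.
have lo_bd rho' : rho' < t -> \forall N \near \oo, rho' * v N <= \sum_(0 <= i < N) v' i.
  rewrite -subr_gt0 => h; apply: filterS (v'near _ h) => n.
  by rewrite ler_norml mulrBl => /andP[? _]; lra.
have v'_le N : \sum_(0 <= i < N) v' i <= v N.
  rewrite v_sum; apply: ler_sum => i _; rewrite /v'.
  by case: (up i) => //; exact: l_le_u.
have t0 : 0 < t by exact: lt_le_trans rt.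
have [A hA hAe] := @cluster_qnull_compl _ _ x m v x_bnd v0 v_mono v_infty v_step
  x_small m_small m_bnd v' v' t up_bd lo_bd v'_le t0.
have nA : P.-negligible (\bigcup_k A k).
  apply: negligible_bigcup => k; apply: (qnull_negligible hH _ cmP (hA k)).
  by move=> i; case: (Hx i).
have ncl : P.-negligible (~` event t) by apply: negligibleS nA; exact: hAe.
have mcl := measurableC (event_measurable t).
have : P (~` event t) = 0%E by exact: measure_negligible ncl.
rewrite (probability_setC P (event_measurable t)).
have : (P (event t) \is a fin_num) by exact: (fin_num_measure _ _ (event_measurable t)).
move=> /fineK <-; rewrite -EFinB => -[] /eqP.
by rewrite subr_eq0 => /eqP <-.
Qed.

Let cluster_eventE t : cluster_event E X t = event t.
Proof.
rewrite /cluster_event; apply/seteqP.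
suff h w : (fun n => (\sum_(1 <= i < n.+1) X i w) /
      Num.sqrt (2 * s2 E X n * llog (llog (s2 E X n)))) =
    (fun n => S n w / lil (v n)) by split=> w /=; rewrite h.
apply/funext => n; rewrite big_add1 /= /lil /itau -sqrtrM//; congr (_ / Num.sqrt _).
by rewrite -/(v n) mulrCA mulrA.
Qed.

Lemma capacities_cluster_event (t : R) : 0 <= t ->
  [/\ V_P Pfam (cluster_event E X t) = (if (r <= t <= 1)%R then 1 else 0)%E,
      C_star H E (cluster_event E X t) = (if (r <= t <= 1)%R then 1 else 0)%E &
      V_hat_star H E (cluster_event E X t) = (if (r <= t <= 1)%R then 1 else 0)%E].
Proof.
move=> t0; rewrite cluster_eventE.
have me := event_measurable t.
have CV := C_star_le_V_hat_star hH hE (event t).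
have V1 := V_hat_star_le1 hH hE (event t).
case: ifPn => ht.
  have [P PP P1] := event_full ht.
  have C1 := C_star_ge1 hH hE hCC PP me P1.
  split; apply/le_anti/andP; split => //.
  - by apply: ge_ereal_sup => _ [Q _ <-]; exact: probability_le1.
  - by rewrite -P1; apply: ereal_sup_ubound; exists P.
  - exact: le_trans CV V1.
  - exact: le_trans C1 CV.
have hq := event_qnull t0 ht.
have Hx' i : H (x i) by case: (Hx i).
have V0 := qnull_V_hat_star hH hE hCC Hx' cm hq.
split => //.
- have PE Q : Pfam Q -> Q (event t) = 0%E.
    by move=> PQ; apply: measure_negligible => //; apply: (qnull_negligible hH Hx' (cm PQ)).
  apply/le_anti/andP; split.
    by apply: ge_ereal_sup => _ [Q PQ <-]; rewrite PE.
  have [Q PQ] := Pfam_nonempty hH hE hCC.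
  by rewrite -(PE Q PQ); apply: ereal_sup_ubound; exists Q.
- by apply/le_anti; rewrite (C_star_ge0 hH hE) andbT -V0.
Qed.

End theorem_setting.

Theorem theorem3p1 (R : realType) (d : measure_display)
    (Omega : measurableType d)
    (H : set (Omega -> R)) (E : (Omega -> R) -> \bar R)
    (Pfam : set (probability (sigma_space H) R))
    (X : nat -> Omega -> R) (alpha : nat -> R) (r : R)
    (hH : function_space H) (hE : sublinear_expectation H E)
    (hCC : condition_CC E Pfam)
    (hX : forall n, (1 <= n)%N -> H (X n)) (hind : independent_seq E X)
    (hr : 0 < r) (hi : s2_low E X n / s2 E X n @[n --> \oo] --> r)
    (hs : s2 E X n @[n --> \oo] --> +oo)
    (halpha : alpha n @[n --> \oo] --> (0 : R))
    (hbound : forall n, (1 <= n)%N -> forall w,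
       `|X n w| <= alpha n * (s_ E X n / t_ E X n))
    (hiii : (\sum_(1 <= j < n.+1)
               (`|fine (E (X j))| + `|fine (conj_expectation E (X j))|))
            / a_ E X n @[n --> \oo] --> (0 : R)) :
  forall t : R, 0 <= t ->
    [/\ V_P Pfam (cluster_event E X t) = (if (r <= t <= 1)%R then 1 else 0)%E,
        C_star H E (cluster_event E X t) = (if (r <= t <= 1)%R then 1 else 0)%E &
        V_hat_star H E (cluster_event E X t) = (if (r <= t <= 1)%R then 1 else 0)%E].
Proof. by move=> t; exact: (capacities_cluster_event hH hE hCC hX hind hr hi hs halpha hbound hiii). Qed.
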